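(* Let $0<\beta_1<\beta_0<\tfrac14$. Let $X_1,\dots,X_n$ be i.i.d. on $[0,1]$ with density $f$ and let $\phi(f)=\int_0^1 f^2(x)\,dx$. Put $$k_0=\lceil n^{2/(1+4\beta_0)}\rceil,\qquad k_1=\lceil n^{2/(1+4\beta_1)}\rceil,\qquad k_*=\Big\lceil \Big(\tfrac{n^2}{\log n}\Big)^{1/(1+4\beta_1)}\Big\rceil ,$$ $$U_{n,0}=U_n^{(k_0)},\quad U_{n,1}=U_n^{(k_1)},\quad U_{n,*}=U_n^{(k_* )},\qquad \hat I(k_0,k_* )=U_{n,*}-U_{n,0}.$$ Then there is a deterministic constant $\kappa>0$, depending only on the parent wavelets and on $M^*$, such that, with $$\hat j=\mathbf 1\Big\{\hat I(k_0,k_* )>\kappa\sqrt{\log n}\,\frac{\sqrt{k_*}}{n}\Big\}\in\{0,1\},\qquad \hat\phi=U_{n,\hat j},$$ one has $$\sup_{f\in H(\beta_0)}\mathbb E_f\big[\hat\phi-\phi(f)\big]^2\lesssim n^{-\frac{8\beta_0}{1+4\beta_0}},\qquad \sup_{f\in H(\beta_1)}\mathbb E_f\big[\hat\phi-\phi(f)\big]^2\lesssim (\log n)^{\frac{4\beta_1}{1+4\beta_1}}\,n^{-\frac{8\beta_1}{1+4\beta_1}} .$$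
   Context: Fix a radius $C>0$ and constants $0<M_*<M^*$. For $\beta\in(0,1)$, the Hölder ball $H(\beta,C)$ is the set of functions $h$ on $[0,1]$ with $|h|\le C$ and $|h(x)-h(y)|\le C|x-y|^{\beta}$ for all $x,y$. $H(\beta)$ denotes the set of probability densities $f\in H(\beta,C)$ on $[0,1]$ with $M_*\le f\le M^*$. $\mathbb E_f$ is expectation when $X_1,\dots,X_n$ are i.i.d. with density $f$. Projection kernels: let $\varphi$ be a bounded compactly supported father wavelet of an orthonormal wavelet basis of $L_2(\mathbb R)$, whose (bounded, compactly supported) mother wavelet has enough vanishing moments (e.g. the Haar basis, $\varphi=\mathbf 1_{(0,1]}$); $\varphi$ and the mother wavelet are the ''parent wavelets''. For a truncation level $k\ge1$ let $J=\lceil\log_2 k\rceil$ and $$K_k(x,y)=\sum_{j\in\mathbb Z}2^{J}\varphi(2^Jx-j)\varphi(2^Jy-j),$$ the orthogonal projection kernel onto the resolution-$J$ space (of dimension of order $k$ when restricted to functions on $[0,1]$). Define the second order U-statistic $$U_n^{(k)}=\frac1{n(n-1)}\sum_{1\le i_1\ne i_2\le n}K_k(X_{i_1},X_{i_2}).$$ $a_n\lesssim b_n$ means $a_n\le c\,b_n$ for all sufficiently large $n$, with $c$ not depending on $n$ (nor on $f$). *)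

(* Defs.v *)
From HB Require Import structures.
From mathcomp Require Import all_boot all_order all_algebra.
From mathcomp Require Import all_classical all_reals all_analysis.

Set Implicit Arguments.
Unset Strict Implicit.
Unset Printing Implicit Defensive.

Import Order.TTheory GRing.Theory Num.Theory.
Import numFieldNormedType.Exports.

Local Open Scope classical_set_scope.
Local Open Scope ring_scope.

Section Wavelets.
Context {R : realType}.
Local Notation mu := (@lebesgue_measure R).

(* Index set of the basis phi(. - j), 2^(i/2) psi(2^i . - j), i : nat, j : int. *)
Definition wavelet_index : Type := (int + nat * int)%type.

Definition wavelet_system (phi psi : R -> R) (a : wavelet_index) : R -> R :=
  match a with
  | inl j => fun x => phi (x - j%:~R)
  | inr (i, j) => fun x => Num.sqrt (2 ^+ i) * psi (2 ^+ i * x - j%:~R)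
  end.

(* Orthonormality together with density of the finite linear combinations. *)
Definition L2_orthonormal_basis (I : eqType) (e : I -> R -> R) : Prop :=
  [/\ forall a, e a \in Lfun mu 2%:E,
      forall a b, \int[mu]_x (e a x * e b x) = (a == b)%:R &
      forall (g : R -> R) (eps : R), g \in Lfun mu 2%:E -> 0 < eps ->
        exists (s : seq I) (c : I -> R),
          ('N[mu]_2%:E[(fun x => (g x - \sum_(a <- s) c a * e a x)%R%:E)]
             <= eps%:E)%E].

Definition bounded_compact_support (g : R -> R) : Prop :=
  [/\ measurable_fun [set: R] g, bounded_fun g &
      compact (closure [set x | g x != 0])].

(* Only smoothness beta < 1 is ever used, for which one vanishing moment of the
   mother wavelet is enough; the Haar wavelet has exactly one. *)
Definition parent_wavelets (phi psi : R -> R) : Prop :=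
  [/\ bounded_compact_support phi,
      bounded_compact_support psi,
      L2_orthonormal_basis (wavelet_system phi psi) &
      \int[mu]_x psi x = 0].

(* [up_log 2 k] is the ceiling of log_2 k.  Finitely many terms of the sum are
   nonzero when phi has compact support. *)
Definition proj_kernel (phi : R -> R) (k : nat) (x y : R) : R :=
  let J := up_log 2 k in
  \sum_(j \in [set: int])
    2 ^+ J * phi (2 ^+ J * x - j%:~R) * phi (2 ^+ J * y - j%:~R).

End Wavelets.

Section Estimators.
Context {R : realType}.

Definition U_stat (phi : R -> R) (k n : nat) (x : 'I_n -> R) : R :=
  (n%:R * (n%:R - 1))^-1 *
  \sum_(i1 < n) \sum_(i2 < n | i1 != i2) proj_kernel phi k (x i1) (x i2).

Definition ceil_nat (r : R) : nat := `|Num.ceil r|%N.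

Definition level (beta : R) (n : nat) : nat :=
  ceil_nat (n%:R `^ (2 / (1 + 4 * beta))).

Definition level_star (beta : R) (n : nat) : nat :=
  ceil_nat ((n%:R ^+ 2 / ln n%:R) `^ (1 / (1 + 4 * beta))).

Definition I_hat (phi : R -> R) (k l n : nat) (x : 'I_n -> R) : R :=
  U_stat phi l x - U_stat phi k x.

Definition j_hat (phi : R -> R) (kappa beta0 beta1 : R) (n : nat)
    (x : 'I_n -> R) : bool :=
  let k0 := level beta0 n in
  let ks := level_star beta1 n in
  kappa * Num.sqrt (ln n%:R) * (Num.sqrt ks%:R / n%:R) < I_hat phi k0 ks x.

Definition phi_hat (phi : R -> R) (kappa beta0 beta1 : R) (n : nat)
    (x : 'I_n -> R) : R :=
  if j_hat phi kappa beta0 beta1 x then U_stat phi (level beta1 n) x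
  else U_stat phi (level beta0 n) x.

End Estimators.

Section Model.
Context {R : realType}.
Local Notation mu := (@lebesgue_measure R).

(* Functions on [0, 1] are represented by functions on the line of which only
   the values on [0, 1] are constrained or used. *)
Definition holder_ball (beta C : R) : set (R -> R) :=
  [set h | (forall x, x \in `[0, 1] -> `|h x| <= C) /\
           (forall x y, x \in `[0, 1] -> y \in `[0, 1] ->
              `|h x - h y| <= C * `|x - y| `^ beta)].

Definition probability_density01 (f : R -> R) : Prop :=
  [/\ measurable_fun (`[0, 1]%classic : set R) f,
      forall x, x \in `[0, 1] -> 0 <= f x &
      (\int[mu]_(x in `[0%R, 1%R]) (f x)%:E = 1)%E].

Definition density_class (C Mlow Mup beta : R) : set (R -> R) :=
  [set f | [/\ probability_density01 f, holder_ball beta C f &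
               forall x, x \in `[0, 1] -> Mlow <= f x <= Mup]].

Definition quad_functional (f : R -> R) : R :=
  \int[mu]_(x in `[0, 1]) (f x ^+ 2).

Definition mutually_independent d (T : measurableType d) (P : probability T R)
    (n : nat) (X : 'I_n -> {RV P >-> R}) : Prop :=
  forall A : 'I_n -> set R, (forall i, measurable (A i)) ->
    (P (\bigcap_(i in [set: 'I_n]) (X i @^-1` A i)) = \prod_(i < n) P (X i @^-1` A i))%E.

Definition has_density01 d (T : measurableType d) (P : probability T R)
    (Y : {RV P >-> R}) (f : R -> R) : Prop :=
  forall A : set R, measurable A ->
    (distribution P Y A = \int[mu]_(x in A `&` `[0%R, 1%R]) (f x)%:E)%E.

Definition iid_density01 d (T : measurableType d) (P : probability T R)
    (n : nat) (X : 'I_n -> {RV P >-> R}) (f : R -> R) : Prop :=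
  mutually_independent X /\ forall i, has_density01 (X i) f.

(* The supremum over f in F of E_f (est(X_1, ..., X_n) - phi(f))^2.  The
   expectation depends on the law of the sample only, so E_f is taken in every
   probability space carrying an i.i.d. sample of size n from f. *)
Definition sup_risk (F : set (R -> R)) (n : nat) (est : ('I_n -> R) -> R) :
    \bar R :=
  ereal_sup [set r | exists f : R -> R, F f /\
    exists (d : measure_display) (T : measurableType d) (P : probability T R)
      (X : 'I_n -> {RV P >-> R}),
      iid_density01 X f /\
      r = 'E_P[(fun w =>
             ((est (fun i => X i w) - quad_functional f) ^+ 2)%R)]%E].

Definition lesssim (a : nat -> \bar R) (b : nat -> R) : Prop :=
  exists2 c : R, 0 < c & \forall n \near \oo, (a n <= (c * b n)%:E)%E.

End Model.

(* Main.v *)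
(* With K_k the projection kernel, E U_n^(k) = |P_k f|^2, so that the bias
   phi(f) - E U_n^(k) = |f - P_k f|^2 is nonnegative and, by the decay of the
   wavelet coefficients, at most of order k^(-2 beta); the variance is of order
   k / n^2 + 1 / n.  Since the bias of U_{n,*} is nonnegative, on H(beta_0) the
   event I_hat > kappa sqrt(k_* log n) / n forces one of U_{n,*}, U_{n,0}
   to deviate from its mean by a multiple of that threshold.  This is too
   unlikely to matter: the centred U-statistic is a sum of martingale
   differences, and its exponential moments are bounded after truncation to the
   samples in which no dyadic cell of side of order 1 / k contains many points
   and few pairs of points share a cell; both properties hold with overwhelming
   probability because k >= n^(1 + delta).  On H(beta_1), when U_{n,0} is kept,
   the test itself bounds phi(f) - U_{n,0} by the threshold plus the error of
   U_{n,*}, which is of the required order. *)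

From HB Require Import structures.
Require Import Defs.
From mathcomp Require Import all_boot all_order all_algebra.
From mathcomp Require Import all_classical all_reals all_analysis.
From mathcomp Require Import measurable_realfun ring lra zify.

Set Implicit Arguments.
Unset Strict Implicit.
Unset Printing Implicit Defensive.

Import Order.TTheory GRing.Theory Num.Theory.
Import numFieldNormedType.Exports.

Local Open Scope classical_set_scope.
Local Open Scope ring_scope.

(** * Expectations of bounded measurable functions *)

(** At these levels [k] exceeds [n], so a kernel of height of order [k] defeats any inequality for
    bounded differences. What rescues the argument is locality: the kernel vanishes unless the cells
    of its two arguments are a bounded number of cells apart, and a cell has mass at most [M / k].
    Cell counts thus control the martingale differences, same-cell pairs control their conditional
    variances, and a constant cap [m] on the counts is enough. On the smoother class the test errs
    with probability of order [n^(-5)]. This beats the crude bound of order [n^4] on the squared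
    loss, because [1 / n] is below the rate when [beta0 < 1 / 4]. The deviation constants involve
    only the wavelets and the upper bound of the density. The Hölder radius enters through the bias
    of the coarse statistic, which is smaller than the threshold by a power of [n]; hence [kappa]
    can be fixed before the radius and the smoothness. *)

Section BoundedExpectation.
Context d (T : measurableType d) (R : realType).

(** Closed under every operation used below, exponentials included, and integrable for any
    probability, so that no integrability condition has to be tracked. Statistics qualify because
    the kernel is bounded at each fixed level. *)
Definition bmeas (F : T -> R) : Prop :=
  measurable_fun [set: T] F /\ exists B, forall x, `|F x| <= B.

Lemma eq_bmeas F G : F =1 G -> bmeas F -> bmeas G.
Proof. by move=> /funext->. Qed.

Lemma bmeas_cst c : bmeas (fun=> c).
Proof. by split=> //; exists `|c|. Qed.

Lemma bmeasD F G : bmeas F -> bmeas G -> bmeas (fun x => F x + G x).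
Proof.
move=> [mF [B HB]] [mG [C HC]]; split; first exact: measurable_funD.
by exists (B + C) => x; rewrite (le_trans (ler_normD _ _))// lerD.
Qed.

Lemma bmeasM F G : bmeas F -> bmeas G -> bmeas (fun x => F x * G x).
Proof.
move=> [mF [B HB]] [mG [C HC]]; split; first exact: measurable_funM.
by exists (B * C) => x; rewrite normrM ler_pM.
Qed.

Lemma bmeasN F : bmeas F -> bmeas (fun x => - F x).
Proof.
move=> [mF [B HB]]; split; first exact: measurable_funN.
by exists B => x; rewrite normrN.
Qed.

Lemma bmeasB F G : bmeas F -> bmeas G -> bmeas (fun x => F x - G x).
Proof. by move=> bF bG; apply: bmeasD => //; exact: bmeasN. Qed.

Lemma bmeasX F n : bmeas F -> bmeas (fun x => F x ^+ n).
Proof.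
move=> bF; elim: n => [|n IH]; first exact: bmeas_cst.
by apply: (eq_bmeas _ (bmeasM bF IH)) => x; rewrite exprS.
Qed.

Lemma bmeas_norm F : bmeas F -> bmeas (fun x => `|F x|).
Proof.
move=> [mF [B HB]]; split; first exact: measurableT_comp.
by exists B => x; rewrite normr_id.
Qed.

Lemma bmeas_expR F : bmeas F -> bmeas (fun x => expR (F x)).
Proof.
move=> [mF [B HB]]; split; first exact: measurableT_comp.
exists (expR B) => x; rewrite ger0_norm ?expR_ge0// ler_expR.
by rewrite (le_trans _ (HB x))// ler_norm.
Qed.

Lemma bmeas_sum (I : Type) (s : seq I) (p : pred I) (F : I -> T -> R) :
  (forall i, p i -> bmeas (F i)) -> bmeas (fun x => \sum_(i <- s | p i) F i x).
Proof.
move=> bF; elim: s => [|i s IH].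
  by apply: (eq_bmeas _ (bmeas_cst 0)) => x; rewrite big_nil.
case: (boolP (p i)) => pi.
  by apply: (eq_bmeas _ (bmeasD (bF i pi) IH)) => x; rewrite big_cons pi.
by apply: (eq_bmeas _ IH) => x; rewrite big_cons (negbTE pi).
Qed.

Lemma bmeas_prod (I : Type) (s : seq I) (p : pred I) (F : I -> T -> R) :
  (forall i, p i -> bmeas (F i)) -> bmeas (fun x => \prod_(i <- s | p i) F i x).
Proof.
move=> bF; elim: s => [|i s IH].
  by apply: (eq_bmeas _ (bmeas_cst 1)) => x; rewrite big_nil.
case: (boolP (p i)) => pi.
  by apply: (eq_bmeas _ (bmeasM (bF i pi) IH)) => x; rewrite big_cons pi.
by apply: (eq_bmeas _ IH) => x; rewrite big_cons (negbTE pi).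
Qed.

Lemma bmeas_bool (b : T -> bool) :
  measurable_fun [set: T] b -> bmeas (fun x => (b x)%:R).
Proof.
move=> mb; split; last by exists 1 => x; case: (b x); rewrite ?normr1 ?normr0.
rewrite (_ : (fun _ => _) = fun x => if b x then 1 else 0 : R).
  exact: measurable_fun_ifT.
by apply/funext => x; case: (b x).
Qed.

End BoundedExpectation.

Lemma bmeas_comp d d' (T : measurableType d) (U : measurableType d')
    (R : realType) (F : U -> R) (phi : T -> U) :
  measurable_fun [set: T] phi -> bmeas F -> bmeas (F \o phi).
Proof.
by move=> mphi [mF [B HB]]; split; [exact: measurableT_comp|exists B => x; exact: HB].
Qed.

Notation Ex P F := (Rintegral P [set: _] F).

Section Ex.
Context d (T : measurableType d) (R : realType) (P : probability T R).
Implicit Types F G : T -> R.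

Lemma bmeas_integrable F : bmeas F -> P.-integrable [set: T] (EFin \o F).
Proof.
move=> [mF [B HB]]; apply: measurable_bounded_integrable => //.
  by rewrite (le_lt_trans (probability_le1 P _))// ltry.
exists B; split; first exact: num_real.
by move=> M BM x _ /=; rewrite (le_trans (HB x))// ltW.
Qed.

Lemma EFin_Ex F : bmeas F -> (\int[P]_x (F x)%:E)%E = (Ex P F)%:E.
Proof.
by move=> bF; rewrite /Rintegral fineK// integrable_fin_num// bmeas_integrable.
Qed.

Lemma Ex_cst c : Ex P (fun=> c) = c.
Proof. by rewrite /Rintegral integral_cst//= probability_setT mule1. Qed.

Lemma ExD F G : bmeas F -> bmeas G ->
  Ex P (fun x => F x + G x) = Ex P F + Ex P G.
Proof. by move=> bF bG; rewrite RintegralD//; exact: bmeas_integrable. Qed.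

Lemma ExB F G : bmeas F -> bmeas G ->
  Ex P (fun x => F x - G x) = Ex P F - Ex P G.
Proof. by move=> bF bG; rewrite RintegralB//; exact: bmeas_integrable. Qed.

Lemma ExZl F c : bmeas F -> Ex P (fun x => c * F x) = c * Ex P F.
Proof. by move=> bF; rewrite RintegralZl//; exact: bmeas_integrable. Qed.

Lemma ExN F : bmeas F -> Ex P (fun x => - F x) = - Ex P F.
Proof.
move=> bF; rewrite -[RHS]mulN1r -ExZl//.
by congr Rintegral; apply/funext => x; rewrite mulN1r.
Qed.

Lemma Ex_le F G : bmeas F -> bmeas G -> (forall x, F x <= G x) ->
  Ex P F <= Ex P G.
Proof.
by move=> bF bG FG; apply: le_Rintegral => //; exact: bmeas_integrable.
Qed.

Lemma Ex_le_cst F c : bmeas F -> (forall x, F x <= c) -> Ex P F <= c.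
Proof.
by move=> bF Fc; rewrite -[leRHS]Ex_cst; apply: Ex_le => //; exact: bmeas_cst.
Qed.

Lemma Ex_norm F : bmeas F -> `|Ex P F| <= Ex P (fun x => `|F x|).
Proof. by move=> bF; apply: le_normr_Rintegral => //; exact: bmeas_integrable. Qed.

Lemma Ex_norm_le F c : bmeas F -> (forall x, `|F x| <= c) -> `|Ex P F| <= c.
Proof.
move=> bF Fc; apply: (le_trans (Ex_norm bF)).
by apply: Ex_le_cst => //; exact: bmeas_norm.
Qed.

Lemma Ex_sum (I : Type) (s : seq I) (p : pred I) (F : I -> T -> R) :
  (forall i, p i -> bmeas (F i)) ->
  Ex P (fun x => \sum_(i <- s | p i) F i x) = \sum_(i <- s | p i) Ex P (F i).
Proof.
move=> bF; elim: s => [|i s IH].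
  rewrite big_nil -[RHS](Ex_cst 0); congr Rintegral.
  by apply/funext => x; rewrite big_nil.
rewrite big_cons -IH; case: ifPn => pi.
  rewrite -ExD//; last exact: bmeas_sum.
    by congr Rintegral; apply/funext => x; rewrite big_cons pi.
  exact: bF.
by congr Rintegral; apply/funext => x; rewrite big_cons (negbTE pi).
Qed.

Lemma Ex_sqr_centered F : bmeas F ->
  Ex P (fun x => (F x - Ex P F) ^+ 2) <= Ex P (fun x => F x ^+ 2).
Proof.
move=> bF; have bF2 : bmeas (fun x => F x ^+ 2) by exact: bmeasX.
have bE : bmeas (fun _ : T => Ex P F ^+ 2) by exact: bmeas_cst.
have bc : bmeas (fun x : T => (Ex P F *+ 2) * F x).
  by apply: bmeasM => //; exact: bmeas_cst.
rewrite (_ : (fun x => (F x - _) ^+ 2) =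
   fun x => (F x ^+ 2 - (Ex P F *+ 2) * F x) + Ex P F ^+ 2); last first.
  by apply/funext => x; ring.
rewrite ExD//; last exact: bmeasB.
rewrite ExB// ExZl// Ex_cst.
by rewrite -[leRHS]addr0 -addrA lerD2l; have := sqr_ge0 (Ex P F); lra.
Qed.

End Ex.

(** * Samples *)

Section Upd.
Context (R : realType) (n : nat).

Definition upd (x : n.-tuple R) (m : 'I_n) (y : R) : n.-tuple R :=
  [tuple if i == m then y else tnth x i | i < n].

Lemma tnth_upd x m y i : tnth (upd x m y) i = if i == m then y else tnth x i.
Proof. by rewrite tnth_mktuple. Qed.

Lemma measurable_upd m :
  measurable_fun [set: n.-tuple R * R] (fun p => upd p.1 m p.2).
Proof.
apply/measurable_fun_tnthP => i.
rewrite (_ : _ \o _ = fun p => if i == m then p.2 else tnth p.1 i); last first.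
  by apply/funext => p /=; rewrite tnth_upd.
case: (i == m); first exact: measurable_snd.
by apply: (measurableT_comp (measurable_tnth i)); exact: measurable_fst.
Qed.

Definition rectangle (A : 'I_n -> set R) : set (n.-tuple R) :=
  [set x | forall i, A i (tnth x i)].

Definition rectangles : set (set (n.-tuple R)) :=
  [set B | exists2 A : 'I_n -> set R, (forall i, measurable (A i)) & B = rectangle A].

Lemma measurable_rectangle A : (forall i, measurable (A i)) ->
  measurable (rectangle A).
Proof.
move=> mA.
rewrite (_ : rectangle A =
   \bigcap_(i in [set: 'I_n]) ((@tnth n R)^~ i @^-1` A i)); last first.
  by apply/seteqP; split => [x Ax i _|x Ax i]; exact: Ax.
apply: fin_bigcap_measurable => // i _.
by rewrite -[X in measurable X]setTI; exact: (measurable_tnth i).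
Qed.

(** Unlike the coordinate cylinders that define the structure on tuples, rectangles are stable under
    intersection, as uniqueness of measures requires. *)
Lemma measurable_rectangles :
  (@measurable _ (n.-tuple R)) = <<s rectangles >>.
Proof.
apply/seteqP; split; last first.
  apply: smallest_sub; first exact: sigma_algebra_measurable.
  by move=> _ [A mA ->]; exact: measurable_rectangle.
apply: smallest_sub; first exact: smallest_sigma_algebra.
move=> B; rewrite -bigcup_seq/= => -[i _] [A mA <-].
apply: sub_sigma_algebra; exists (fun j => if j == i then A else setT).
  by move=> j; case: ifP.
apply/seteqP; split => [x [_ Ax] j|x]; first by case: eqP => // ->.
by move=> Ax; split => //; have := Ax i; rewrite /= eqxx.
Qed.

Lemma rectanglesI : setI_closed rectangles.
Proof.
move=> _ _ [A mA ->] [B mB ->]; exists (fun i => A i `&` B i).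
  by move=> i; exact: measurableI.
apply/seteqP; split => [x [Ax Bx] i|x ABx]; first by split.
by split => i; have [] := ABx i.
Qed.

Lemma eq_measure_rectangles (m1 m2 : probability (n.-tuple R) R) :
  (forall A, (forall i, measurable (A i)) ->
     m1 (rectangle A) = m2 (rectangle A)) ->
  forall B, measurable B -> m1 B = m2 B.
Proof.
move=> m12; apply: (measure_unique rectangles (fun=> setT)).
- exact: measurable_rectangles.
- exact: rectanglesI.
- move=> _; exists (fun=> setT) => //.
  by apply/seteqP; split.
- by rewrite bigcup_const.
- by move=> _ [A mA ->]; exact: m12.
- by move=> _ /=; rewrite probability_setT ltry.
Qed.

End Upd.

Section Fubini.
Context d1 d2 (T1 : measurableType d1) (T2 : measurableType d2) (R : realType).
Variables (P1 : probability T1 R) (P2 : probability T2 R).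

Lemma bmeas_pair1 (F : T1 * T2 -> R) x : bmeas F -> bmeas (fun y => F (x, y)).
Proof. by move=> bF; apply: (bmeas_comp _ bF); exact: measurable_pair1. Qed.

Lemma bmeas_Ex (F : T1 * T2 -> R) : bmeas F ->
  bmeas (fun x => Ex P2 (fun y => F (x, y))).
Proof.
move=> bF; have [mF [B HB]] := bF; split.
  apply: measurableT_comp; first exact: fine_measurable.
  apply: (measurable_fubini_F (m1 := P1) (m2 := P2) (f := EFin \o F)).
  exact: bmeas_integrable.
by exists B => x; apply: Ex_norm_le => // ; exact: bmeas_pair1.
Qed.

Lemma Ex_fubini (F : T1 * T2 -> R) : bmeas F ->
  Ex (P1 \x P2)%E F = Ex P1 (fun x => Ex P2 (fun y => F (x, y))).
Proof.
move=> bF; rewrite /Rintegral -integral12_prod_meas1//; last exact: bmeas_integrable.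
congr fine; apply: eq_integral => x _; rewrite /fubini_F -EFin_Ex//.
exact: bmeas_pair1.
Qed.

End Fubini.

(* All that is used of the independence of the sample points. *)
Definition resampling (R : realType) n (rho : probability R R)
    (Q : probability (n.-tuple R) R) : Prop :=
  forall m (F : n.-tuple R -> R), bmeas F ->
    Ex Q F = Ex Q (fun x => Ex rho (fun y => F (upd x m y))).

Section Sample.
Context d (T : measurableType d) (R : realType) (P : probability T R) (n : nat).
Variable X : 'I_n -> {RV P >-> R}.

Definition sample (w : T) : n.-tuple R := [tuple X i w | i < n].

Lemma measurable_sample : measurable_fun [set: T] sample.
Proof.
apply/measurable_fun_tnthP => i.
rewrite (_ : _ \o _ = X i); first exact: measurable_funPT.
by apply/funext => w /=; rewrite tnth_mktuple.
Qed.

HB.instance Definition _ := isMeasurableFun.Build _ _ _ _ sample measurable_sample.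

Definition sample_law : probability (n.-tuple R) R := distribution P sample.

Lemma Ex_sample_law F : bmeas F -> Ex sample_law F = Ex P (F \o sample).
Proof.
move=> bF; rewrite /Rintegral /sample_law /distribution/=.
rewrite integral_pushforward//.
- by apply/measurable_EFinP; case: bF.
- by apply: bmeas_integrable; apply: bmeas_comp => //; exact: measurable_sample.
Qed.

(** The law of the sample and its law after redrawing point [m] give every rectangle the same
    product mass, hence coincide. *)
Lemma sample_law_resampling (rho : probability R R) :
  mutually_independent X ->
  (forall i A, measurable A -> P (X i @^-1` A) = rho A) ->
  resampling rho sample_law.
Proof.
move=> indep XE m F bF.
have lawE A : (forall i, measurable (A i)) ->
    sample_law (rectangle A) = (\prod_(i < n) rho (A i))%E.
  move=> mA; rewrite -(eq_bigr _ (fun i _ => XE i (A i) (mA i))) -indep//.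
  congr (P _); apply/seteqP; split => [w /= Aw i _|w /= Aw i].
    by have := Aw i; rewrite tnth_mktuple.
  by rewrite tnth_mktuple; exact: Aw.
pose upd' (p : n.-tuple R * R) := upd p.1 m p.2.
have mupd : measurable_fun [set: n.-tuple R * R] upd' by exact: measurable_upd.
pose updmix := isMeasurableFun.Build _ _ _ _ upd' mupd.
pose updM : {mfun _ >-> _} := HB.pack upd' updmix.
pose m2 : probability (n.-tuple R) R := distribution (sample_law \x rho)%E updM.
have E B : measurable B -> sample_law B = m2 B.
  apply: eq_measure_rectangles => A mA; rewrite lawE//.
  (* The redrawn sample does not read its old coordinate [m], so that side is freed. *)
  pose A' i := if i == m then setT else A i.
  have mA' i : measurable (A' i) by rewrite /A'; case: ifP.
  have -> : m2 (rectangle A) = (sample_law \x rho)%E (rectangle A' `*` A m).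
    congr ((_ \x _)%E _); apply/seteqP; split => -[x y] /= H.
      split=> [i|]; last by have := H m; rewrite tnth_upd/= eqxx.
      by have := H i; rewrite tnth_upd/= /A'; case: eqP.
    move=> i; rewrite tnth_upd; case: H => H1 H2; case: eqP => [->//|/eqP im].
    by have := H1 i; rewrite /A' (negbTE im).
  transitivity (sample_law (rectangle A') * rho (A m))%E.
    rewrite lawE// [in RHS](bigD1 m)//= (bigD1 m)//= /A' eqxx probability_setT mul1e.
    by rewrite muleC; congr (_ * _)%E; apply: eq_bigr => i /negbTE ->.
  by apply/esym/product_measure1E => //; exact: measurable_rectangle.
transitivity (Ex m2 F).
  by rewrite /Rintegral; congr fine; apply: eq_measure_integral => A mA _; exact: E.
rewrite -[RHS](Ex_fubini _ _ (bmeas_comp mupd bF)) /Rintegral.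
rewrite /m2 /distribution/= integral_pushforward//.
- by apply/measurable_EFinP; case: bF.
- by apply: bmeas_integrable; exact: bmeas_comp.
Qed.

End Sample.

Section Resampling.
Context (R : realType) (n : nat) (rho : probability R R).
Variable Q : probability (n.-tuple R) R.
Hypothesis resampleQ : resampling rho Q.
Implicit Types (F G : n.-tuple R -> R) (l m : 'I_n).

Lemma bmeas_upd F x m : bmeas F -> bmeas (fun y => F (upd x m y)).
Proof.
move=> bF; exact: (bmeas_pair1 x (bmeas_comp (measurable_upd m) bF)).
Qed.

Lemma bmeas_Ex_upd F m : bmeas F -> bmeas (fun x => Ex rho (fun y => F (upd x m y))).
Proof. by move=> bF; exact: (bmeas_Ex Q rho (bmeas_comp (measurable_upd m) bF)). Qed.

Definition free_of F m := forall x y, F (upd x m y) = F x.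

(** Averaging over a redrawn point [m] is conditional expectation given the other points; a factor
    that does not read [m] comes out of it. *)
Lemma resampleM F G m : bmeas F -> bmeas G -> free_of F m ->
  Ex Q (fun x => F x * G x) =
  Ex Q (fun x => F x * Ex rho (fun y => G (upd x m y))).
Proof.
move=> bF bG Fm; rewrite (resampleQ m); last exact: bmeasM.
congr Rintegral; apply/funext => x.
rewrite -ExZl; last exact: bmeas_upd.
by congr Rintegral; apply/funext => y; rewrite Fm.
Qed.

(* [adapted h s]: reading [s] from its head, each factor may be integrated out
   before the ones that follow it. *)
Fixpoint adapted (h : 'I_n -> n.-tuple R -> R) (s : seq 'I_n) : Prop :=
  if s is l :: s' then
    (forall l', l' \in s' -> free_of (h l') l) /\ adapted h s'
  else True.

(** Supermartingale argument: the head of the list is integrated out first, the remaining product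
    being constant in that point. *)
Lemma Ex_prod_le1 (h : 'I_n -> n.-tuple R -> R) (s : seq 'I_n) :
  (forall l, bmeas (h l)) -> (forall l x, 0 <= h l x) ->
  (forall l x, l \in s -> Ex rho (fun y => h l (upd x l y)) <= 1) ->
  adapted h s -> Ex Q (fun x => \prod_(l <- s) h l x) <= 1.
Proof.
move=> bh h0 h1; elim: s h1 => [|l s IH] h1 /=.
  move=> _; rewrite -[leRHS](Ex_cst Q 1) (_ : (fun _ => _) = fun=> 1)//.
  by apply/funext => x; rewrite big_nil.
move=> [fr ad].
have bp : bmeas (fun x => \prod_(l <- s) h l x) by exact: bmeas_prod.
apply: le_trans (IH _ ad); last by move=> l' x ls; apply: h1; rewrite inE ls orbT.
rewrite (_ : (fun _ => _) = fun x => (\prod_(l <- s) h l x) * h l x); last first.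
  by apply/funext => x; rewrite big_cons mulrC.
rewrite (@resampleM _ _ l)//; last first.
  by move=> x y; apply: eq_big_seq => l' ls; exact: fr.
apply: Ex_le => // [|x].
  by apply: bmeasM => //; exact: bmeas_Ex_upd.
by rewrite ler_piMr ?prodr_ge0// h1// mem_head.
Qed.

(** Orthogonality of martingale differences: integrating out the head point kills its cross term
    with the rest. *)
Lemma Ex_sqr_sum (D : 'I_n -> n.-tuple R -> R) (s : seq 'I_n) :
  (forall l, bmeas (D l)) ->
  (forall l x, Ex rho (fun y => D l (upd x l y)) = 0) ->
  adapted D s ->
  Ex Q (fun x => (\sum_(l <- s) D l x) ^+ 2) = \sum_(l <- s) Ex Q (fun x => D l x ^+ 2).
Proof.
move=> bD D0; elim: s => [|l s IH] /=.
  move=> _; rewrite big_nil -[RHS](Ex_cst Q 0); congr Rintegral.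
  by apply/funext => x; rewrite big_nil expr0n.
move=> [fr ad].
have bs : bmeas (fun x => \sum_(l <- s) D l x) by exact: bmeas_sum.
rewrite big_cons -IH// (_ : (fun _ => _) = fun x => (D l x ^+ 2 +
    (\sum_(l <- s) D l x) ^+ 2) + 2 * ((\sum_(l <- s) D l x) * D l x)); last first.
  by apply/funext => x; rewrite big_cons; ring.
have b1 : bmeas (fun x => D l x ^+ 2) by exact: bmeasX.
have b2 : bmeas (fun x => (\sum_(l <- s) D l x) ^+ 2) by exact: bmeasX.
have b3 : bmeas (fun x => (\sum_(l <- s) D l x) * D l x) by exact: bmeasM.
rewrite ExD; [|exact: bmeasD|by apply: bmeasM => //; exact: bmeas_cst].
rewrite ExD// ExZl// (@resampleM _ _ l)//; last first.
  by move=> x y; apply: eq_big_seq => l' ls; exact: fr.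
rewrite [X in _ + 2 * X](_ : _ = 0) ?mulr0 ?addr0//.
rewrite -[RHS](Ex_cst Q 0); congr Rintegral.
by apply/funext => x; rewrite D0 mulr0.
Qed.

End Resampling.

(** * Variance and deviations of second order U-statistics *)

(** From [expR u <= (1 - u)^-1] and [(1 + u + 2 * u ^+ 2) * (1 - u) = 1 + u ^+ 2 * (1 - 2 * u)]. *)
Lemma expR_le_quadratic (R : realType) (u : R) :
  u *+ 2 <= 1 -> expR u <= 1 + u + 2 * u ^+ 2.
Proof.
move=> u2; have h : 1 - u <= expR (- u) by exact: expR_ge1Dx.
have u1 : 0 < 1 - u by lra.
rewrite -[u in expR u]opprK expRN.
apply: (@le_trans _ _ (1 - u)^-1); first by rewrite lef_pV2// posrE expR_gt0.
rewrite -[leLHS]mul1r ler_pdivrMr//.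
have : 0 <= u ^+ 2 * (1 - u *+ 2) by rewrite mulr_ge0 ?sqr_ge0// subr_ge0.
by rewrite !mulr2n; nra.
Qed.

Lemma sqr_sum_le (R : realType) (r : nat) (u : 'I_r -> R) :
  (\sum_i u i) ^+ 2 <= r%:R * \sum_i u i ^+ 2.
Proof.
have h : 0 <= \sum_(i < r) \sum_(j < r) (u i - u j) ^+ 2.
  by apply: sumr_ge0 => i _; apply: sumr_ge0 => j _; exact: sqr_ge0.
have : \sum_(i < r) \sum_(j < r) (u i - u j) ^+ 2 =
    (r%:R * \sum_i u i ^+ 2 - (\sum_i u i) ^+ 2) *+ 2.
  transitivity (\sum_(i < r) (r%:R * u i ^+ 2 + \sum_j u j ^+ 2
      - (u i * \sum_j u j) *+ 2)).
    apply: eq_bigr => i _; rewrite mulr_sumr -sumrMnl.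
    rewrite -[X in X * _](_ : \sum_(j < r) 1 = r%:R); last first.
      by rewrite sumr_const card_ord.
    rewrite mulr_suml -big_split/= -sumrB; apply: eq_bigr => j _; ring.
  rewrite sumrB big_split/= -mulr_sumr sumr_const card_ord sumrMnl -mulr_suml.
  by rewrite -mulr_natl; ring.
by move=> E; move: h; rewrite E pmulrn_lge0// subr_ge0.
Qed.

Section UStatistic.
Context (R : realType) (n : nat) (rho : probability R R).
Variable Q : probability (n.-tuple R) R.
Hypothesis resampleQ : resampling rho Q.
(** Abstract form of the projection kernel, with [k] dyadic cells per unit length, each interacting
    with [r0] of its shifts. Keeping [h] abstract yields the lower tail as the upper tail for the
    negated kernel. *)
Variables (h : R -> R -> R) (cell : R -> R) (e : nat -> R) (b k M : R) (r0 : nat).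
Hypotheses (b0 : 0 <= b) (k0 : 0 < k) (M0 : 0 <= M).
Hypothesis bh : bmeas (fun p : R * R => h p.1 p.2).
Hypothesis mcell : measurable_fun [set: R] cell.
Hypothesis hcell : forall x y,
  `|h x y| <= b * k * \sum_(r < r0) (cell y == cell x + e r)%R%:R.
Hypothesis rho_cell : forall c, Ex rho (fun y => (cell y == c)%R%:R) <= M / k.
Implicit Types (x : n.-tuple R) (y : R) (i l : 'I_n) (j : nat).

(** The first-order Hoeffding projection; its mean [hmean] is the mean of the U-statistic. *)
Definition marg y : R := Ex rho (h y).
Definition hmean : R := Ex rho marg.

Let A := b * r0%:R * M.
Let A0 : 0 <= A. Proof. by rewrite !mulr_ge0. Qed.

Lemma bmeas_h y : bmeas (h y).
Proof. exact: (bmeas_pair1 y bh). Qed.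

Lemma bmeas_marg : bmeas marg.
Proof. exact: (bmeas_Ex rho rho bh). Qed.

Lemma bmeas_cell (c : R) : bmeas (fun y => (cell y == c)%R%:R : R).
Proof. by apply: bmeas_bool; exact: measurable_fun_eqr. Qed.

Lemma marg_le y : `|marg y| <= A.
Proof.
apply: (le_trans (Ex_norm _ (bmeas_h y))).
apply: (@le_trans _ _ (Ex rho (fun z =>
    b * k * \sum_(r < r0) (cell z == cell y + e r)%R%:R))).
  apply: Ex_le => //; first exact/bmeas_norm/bmeas_h.
  apply: bmeasM; first exact: bmeas_cst.
  by apply: bmeas_sum => r _; exact: bmeas_cell.
rewrite ExZl; last by apply: bmeas_sum => r _; exact: bmeas_cell.
rewrite Ex_sum; last by move=> r _; exact: bmeas_cell.
apply: (@le_trans _ _ (b * k * \sum_(r < r0) (M / k))).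
  by rewrite ler_wpM2l ?mulr_ge0// ?(ltW k0)//; apply: ler_sum => r _; exact: rho_cell.
rewrite sumr_const card_ord -mulr_natr /A.
have kn : k != 0 by rewrite gt_eqF.
by rewrite (_ : b * k * _ = b * r0%:R * M)//; field.
Qed.

Definition cnt (j : nat) x (c : R) : R :=
  \sum_(i < n | (i < j)%N) (cell (tnth x i) == c)%R%:R.

(** The pairs are ordered and each point is also paired with itself, so [pairs n x] is at least [n];
    the truncation below therefore allows [2 * n]. *)
Definition pairs (j : nat) x : R :=
  \sum_(i < n | (i < j)%N) cnt j x (cell (tnth x i)).

Definition hsum (j : nat) x y : R := \sum_(i < n | (i < j)%N) h (tnth x i) y.

Lemma cnt_ge0 j x c : 0 <= cnt j x c.
Proof. exact: sumr_ge0. Qed.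

Lemma hsum_le j x y :
  `|hsum j x y| <= b * k * \sum_(r < r0) cnt j x (cell y - e r).
Proof.
apply: (le_trans (ler_norm_sum _ _ _)).
rewrite /cnt exchange_big/= mulr_sumr; apply: ler_sum => i _.
apply: (le_trans (hcell _ _)); rewrite ler_wpM2l ?mulr_ge0// ?(ltW k0)//.
by apply: ler_sum => r _; rewrite [in leRHS]eq_sym subr_eq.
Qed.

Lemma bmeas_hsum j x : bmeas (hsum j x).
Proof. by apply: bmeas_sum => i _; exact: bmeas_h. Qed.

(** After Cauchy-Schwarz over the [r0] shifts, squared counts become pairs of points in one cell,
    with [y] confined to a shift of that cell. The confinement has mass at most [M / k], which
    cancels one of the two factors [k]. *)
Lemma Ex_hsum_sqr j x :
  Ex rho (fun y => hsum j x y ^+ 2) <= b ^+ 2 * r0%:R ^+ 2 * M * k * pairs j x.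
Proof.
pose u (r : 'I_r0) y := \sum_(i < n | (i < j)%N) \sum_(i' < n | (i' < j)%N)
  (cell (tnth x i) == cell (tnth x i'))%R%:R *
  (cell y == cell (tnth x i) + e r)%R%:R : R.
have bu r : bmeas (u r).
  apply: bmeas_sum => i _; apply: bmeas_sum => i' _.
  by apply: bmeasM; [exact: bmeas_cst|exact: bmeas_cell].
apply: (@le_trans _ _ (Ex rho (fun y =>
    (b * k) ^+ 2 * r0%:R * \sum_(r < r0) u r y))).
  apply: Ex_le => [||y].
  - by apply: bmeasX; exact: bmeas_hsum.
  - by apply: bmeasM; [exact: bmeas_cst|exact: bmeas_sum].
  rewrite -real_normK ?num_real//.
  apply: (@le_trans _ _ ((b * k * \sum_(r < r0) cnt j x (cell y - e r)) ^+ 2)).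
    rewrite ler_sqr ?nnegrE//; first exact: hsum_le.
    by rewrite !mulr_ge0// ?(ltW k0)// sumr_ge0// => r _; exact: cnt_ge0.
  rewrite exprMn -[leRHS]mulrA ler_wpM2l ?sqr_ge0//.
  apply: (le_trans (sqr_sum_le _)); rewrite ler_wpM2l//.
  apply: ler_sum => r _; rewrite expr2 /cnt mulr_suml; apply: ler_sum => i _.
  rewrite mulr_sumr; apply: ler_sum => i' _; rewrite -!natrM ler_nat !mulnb.
  case: eqP => //= c1; case: eqP => //= c2.
  by rewrite c1 c2 eqxx subrK eqxx.
rewrite ExZl; last exact: bmeas_sum.
rewrite Ex_sum//.
have ur r : Ex rho (u r) <= M / k * pairs j x.
  rewrite /u Ex_sum; last first.
    move=> i _; apply: bmeas_sum => i' _.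
    by apply: bmeasM; [exact: bmeas_cst|exact: bmeas_cell].
  rewrite /pairs mulr_sumr; apply: ler_sum => i _.
  rewrite Ex_sum; last first.
    by move=> i' _; apply: bmeasM; [exact: bmeas_cst|exact: bmeas_cell].
  rewrite /cnt mulr_sumr; apply: ler_sum => i' _.
  rewrite ExZl; last exact: bmeas_cell.
  by rewrite mulrC eq_sym ler_wpM2r.
apply: (@le_trans _ _ ((b * k) ^+ 2 * r0%:R * \sum_(r < r0) (M / k * pairs j x))).
  rewrite ler_wpM2l ?mulr_ge0 ?(ltW k0)//; apply: ler_sum => r _; exact: ur.
rewrite sumr_const card_ord -[(_ * _) *+ _]mulr_natr.
have kn : k != 0 by rewrite gt_eqF.
by rewrite (_ : _ * _ = b ^+ 2 * r0%:R ^+ 2 * M * k * pairs j x)//; field.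
Qed.

(* [dev i] is the [i]-th martingale difference, along the natural filtration of
   the sample, of the sum over unordered pairs (see [devsumE]). *)
Definition incr (j : nat) x y : R := hsum j x y + (n - j.+1)%:R * marg y.

Definition dev i x : R := incr i x (tnth x i) - Ex rho (incr i x).

Let c1 := 2 * b ^+ 2 * r0%:R ^+ 2 * M.
Let c2 := 2 * A ^+ 2.

Lemma bmeas_incr j x : bmeas (incr j x).
Proof.
apply: bmeasD; first exact: bmeas_hsum.
by apply: bmeasM; [exact: bmeas_cst|exact: bmeas_marg].
Qed.

Lemma Ex_incr j x : Ex rho (incr j x) =
  \sum_(i < n | (i < j)%N) marg (tnth x i) + (n - j.+1)%:R * hmean.
Proof.
rewrite ExD; [|exact: bmeas_hsum|]; last first.
  by apply: bmeasM; [exact: bmeas_cst|exact: bmeas_marg].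
rewrite ExZl; last exact: bmeas_marg.
by rewrite Ex_sum// => i _; exact: bmeas_h.
Qed.

(** The inequality [(u + v)^2 <= 2 u^2 + 2 v^2] separates the kernel sum over earlier points from
    the averaged pairs with later points, which is at most [n] times the bound on [marg]. *)
Lemma Ex_incr_sqr (j : nat) x :
  Ex rho (fun y => incr j x y ^+ 2) <= c1 * k * pairs j x + c2 * n%:R ^+ 2.
Proof.
have bS : bmeas (fun y => hsum j x y ^+ 2) by apply: bmeasX; exact: bmeas_hsum.
apply: (@le_trans _ _ (Ex rho (fun y => 2 * hsum j x y ^+ 2 + c2 * n%:R ^+ 2))).
  apply: Ex_le => [||y].
  - by apply: bmeasX; exact: bmeas_incr.
  - apply: bmeasD; last exact: bmeas_cst.
    by apply: bmeasM; [exact: bmeas_cst|].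
  apply: (@le_trans _ _ (2 * hsum j x y ^+ 2 + 2 * ((n - j.+1)%:R * marg y) ^+ 2)).
    rewrite -subr_ge0 /incr.
    rewrite (_ : _ - _ = (hsum j x y - (n - j.+1)%:R * marg y) ^+ 2) ?sqr_ge0//.
    by ring.
  rewrite lerD2l /c2 -mulrA ler_wpM2l// -exprMn -real_normK ?num_real//.
  rewrite ler_sqr ?nnegrE ?mulr_ge0// normrM mulrC ler_pM//; first exact: marg_le.
  by rewrite ger0_norm// ler_nat leq_subr.
rewrite ExD ?Ex_cst ?ExZl//; last 2 first.
  by apply: bmeasM; [exact: bmeas_cst|].
  exact: bmeas_cst.
rewrite lerD2r.
apply: (le_trans (ler_wpM2l _ (Ex_hsum_sqr _ _))) => //.
by rewrite /c1 !mulrA.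
Qed.

Lemma incr_upd (j : nat) x l y : (j <= l)%N -> incr j (upd x l y) = incr j x.
Proof.
move=> jl; apply/funext => z; congr (_ + _); apply: eq_bigr => i ij.
by rewrite tnth_upd; case: eqP => // il; move: ij; rewrite il ltnNge jl.
Qed.

Lemma cnt_upd (j : nat) x l y c : (j <= l)%N -> cnt j (upd x l y) c = cnt j x c.
Proof.
move=> jl; apply: eq_bigr => i ij.
by rewrite tnth_upd; case: (i =P l) => // il; move: ij; rewrite il ltnNge jl.
Qed.

Lemma pairs_upd (j : nat) x l y : (j <= l)%N -> pairs j (upd x l y) = pairs j x.
Proof.
move=> jl; apply: eq_bigr => i ij; rewrite cnt_upd// tnth_upd.
by case: eqP => // il; move: ij; rewrite il ltnNge jl.
Qed.

Lemma dev_upd x i y : dev i (upd x i y) = incr i x y - Ex rho (incr i x).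
Proof. by rewrite /dev incr_upd// tnth_upd eqxx. Qed.

Lemma bmeas_tnth (F : R -> R) i : bmeas F -> bmeas (fun x => F (tnth x i)).
Proof. by move=> bF; apply: (bmeas_comp _ bF); exact: measurable_tnth. Qed.

Lemma bmeas_dev i : bmeas (dev i).
Proof.
apply: bmeasB.
  apply: bmeasD.
    apply: bmeas_sum => l _.
    apply: (bmeas_comp (phi := fun x => (tnth x l, tnth x i)) _ bh).
    by apply: measurable_fun_pair; exact: measurable_tnth.
  by apply: bmeasM; [exact: bmeas_cst|exact/bmeas_tnth/bmeas_marg].
apply: (eq_bmeas (fun x => esym (Ex_incr i x))); apply: bmeasD.
  by apply: bmeas_sum => l _; exact/bmeas_tnth/bmeas_marg.
exact: bmeas_cst.
Qed.

Lemma bmeas_same_cell i l :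
  bmeas (fun x => (cell (tnth x i) == cell (tnth x l))%R%:R : R).
Proof.
apply: bmeas_bool; apply: measurable_fun_eqr.
  by apply: measurableT_comp => //; exact: measurable_tnth.
by apply: measurableT_comp => //; exact: measurable_tnth.
Qed.

Lemma bmeas_cnt j i : bmeas (fun x => cnt j x (cell (tnth x i))).
Proof. by apply: bmeas_sum => l _; exact: bmeas_same_cell. Qed.

Lemma bmeas_pairs j : bmeas (pairs j).
Proof. by apply: bmeas_sum => l _; exact: bmeas_cnt. Qed.

Lemma Ex_dev i x : Ex rho (fun y => dev i (upd x i y)) = 0.
Proof.
under [X in Ex _ X]eq_fun do rewrite dev_upd.
by rewrite ExB ?Ex_cst ?subrr//; [exact: bmeas_incr|exact: bmeas_cst].
Qed.

Lemma Ex_dev_sqr i x : Ex rho (fun y => dev i (upd x i y) ^+ 2) <=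
  c1 * k * pairs i x + c2 * n%:R ^+ 2.
Proof.
under [X in Ex _ X]eq_fun do rewrite dev_upd.
by apply: (le_trans _ (Ex_incr_sqr i x)); apply: Ex_sqr_centered; exact: bmeas_incr.
Qed.

(** * Natural filtration of the sample, and the variance *)

Definition depends_upto (F : 'I_n -> n.-tuple R -> R) : Prop :=
  forall i l x y, (i < l)%N -> F i (upd x l y) = F i x.

Lemma dev_depends : depends_upto dev.
Proof.
move=> i l x y il; rewrite /dev incr_upd ?(ltnW il)// tnth_upd.
by case: eqP => // eil; move: il; rewrite eil ltnn.
Qed.

(** Last point first: [adapted] integrates out the head before the rest, and the differences of
    earlier points do not read later ones. *)
Let lst := rev (enum 'I_n).

Lemma adapted_lst F : depends_upto F -> adapted F lst.
Proof.
move=> dF; have : sorted (fun i l : 'I_n => (l < i)%N) lst.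
  rewrite /lst rev_sorted; have := iota_ltn_sorted 0 n.
  by rewrite -val_enum_ord sorted_map.
elim: lst => //= l s IH pl; split; last exact/IH/(path_sorted pl).
move=> i si x y; apply: dF.
have tr : transitive (fun i l : 'I_n => (l < i)%N).
  by move=> u v w uv vw; exact: ltn_trans vw uv.
by have /allP/(_ _ si) := order_path_min tr pl.
Qed.

Lemma big_lst idx (op : Monoid.com_law idx) (F : 'I_n -> R) :
  \big[op/idx]_(i <- lst) F i = \big[op/idx]_(i < n) F i.
Proof.
rewrite -[RHS]big_enum; apply: perm_big.
by rewrite /lst perm_rev.
Qed.

Definition devsum x : R := \sum_(i < n) dev i x.

Lemma bmeas_devsum : bmeas devsum.
Proof. by apply: bmeas_sum => i _; exact: bmeas_dev. Qed.

Lemma Ex_same_cell i l : i != l ->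
  Ex Q (fun x => (cell (tnth x l) == cell (tnth x i))%R%:R) <= M / k.
Proof.
move=> il; rewrite (resampleQ l); last exact: bmeas_same_cell.
apply: Ex_le_cst => [|x].
  exact: (bmeas_Ex_upd rho Q l (bmeas_same_cell l i)).
under [X in Ex _ X]eq_fun do rewrite !tnth_upd eqxx (negbTE il).
exact: rho_cell.
Qed.

(** The diagonal contributes at most [n], every other pair at most [M / k] on average. *)
Lemma Ex_pairs j : Ex Q (pairs j) <= n%:R + n%:R ^+ 2 * (M / k).
Proof.
have Mk : 0 <= M / k by rewrite divr_ge0// ltW.
rewrite Ex_sum; last by move=> i _; exact: bmeas_cnt.
apply: (@le_trans _ _ (\sum_(i < n) (1 + n%:R * (M / k)))); last first.
  by rewrite sumr_const card_ord -[(_ + _) *+ _]mulr_natl; lra.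
rewrite big_mkcond/=; apply: ler_sum => i _; case: ifP => _; last first.
  by rewrite addr_ge0// mulr_ge0.
rewrite Ex_sum; last by move=> l _; exact: bmeas_same_cell.
apply: (@le_trans _ _ (\sum_(l < n) ((l == i)%:R + M / k))); last first.
  rewrite big_split/= sumr_const card_ord -[(_ / _) *+ _]mulr_natl lerD2r.
  rewrite (bigD1 i)//= eqxx big1 ?addr0// => l li.
  by rewrite (negbTE li).
rewrite big_mkcond/=; apply: ler_sum => l _; case: ifP => _; last first.
  by rewrite addr_ge0.
have [->|li] := eqVneq l i; last first.
  by rewrite add0r Ex_same_cell// eq_sym.
rewrite (@le_trans _ _ 1)// ?lerDl//; apply: Ex_le_cst.
  exact: bmeas_same_cell.
by move=> x; rewrite lern1 leq_b1.
Qed.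

(** By orthogonality the conditional variances add up. Second moments see only the average number of
    pairs, so they are computed without truncation. *)
Lemma Ex_devsum_sqr : Ex Q (fun x => devsum x ^+ 2) <=
  c1 * k * n%:R ^+ 2 + (c1 * M + c2) * n%:R ^+ 3.
Proof.
have c10 : 0 <= c1 by rewrite !mulr_ge0 ?sqr_ge0.
have -> : Ex Q (fun x => devsum x ^+ 2) =
    \sum_(i <- lst) Ex Q (fun x => dev i x ^+ 2).
  rewrite -(Ex_sqr_sum resampleQ bmeas_dev Ex_dev (adapted_lst dev_depends)).
  by congr Rintegral; apply/funext => x; rewrite (big_lst _ (dev^~ x)).
rewrite (big_lst _ (fun i => Ex Q (fun x => dev i x ^+ 2))).
apply: (@le_trans _ _ (\sum_(i < n)
    (c1 * k * (n%:R + n%:R ^+ 2 * (M / k)) + c2 * n%:R ^+ 2))); last first.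
  rewrite sumr_const card_ord -[(_ + _) *+ _]mulr_natl.
  have kn : k != 0 by rewrite gt_eqF.
  by rewrite (_ : n%:R * _ = c1 * k * n%:R ^+ 2 + (c1 * M + c2) * n%:R ^+ 3)//; field.
apply: ler_sum => i _.
have bd : bmeas (fun x => dev i x ^+ 2) by apply: bmeasX; exact: bmeas_dev.
have bp : bmeas (fun x => c1 * k * pairs i x).
  by apply: bmeasM; [exact: bmeas_cst|exact: bmeas_pairs].
rewrite (resampleQ i)//.
apply: (@le_trans _ _ (Ex Q (fun x => c1 * k * pairs i x + c2 * n%:R ^+ 2))).
  apply: Ex_le => [||x].
  - exact: (bmeas_Ex_upd rho Q i bd).
  - by apply: bmeasD => //; exact: bmeas_cst.
  - exact: Ex_dev_sqr.
rewrite ExD ?Ex_cst//; last exact: bmeas_cst.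
rewrite lerD2r ExZl; last exact: bmeas_pairs.
by rewrite ler_wpM2l ?Ex_pairs// mulr_ge0// ltW.
Qed.

(** * Truncation and exponential moments *)

Lemma cntE j x c :
  cnt j x c = (\sum_(i < n | (i < j)%N) (cell (tnth x i) == c)%R)%N%:R.
Proof. by rewrite natr_sum. Qed.

(* The exponential moments are computed on [good], where the martingale
   differences are bounded and their conditional variances controlled.  It
   depends on the first [j] points only, so that truncating with it keeps the
   factors adapted. *)
Definition sparse (m j : nat) x : bool :=
  [forall i : 'I_n, (i < j)%N ==> (cnt j x (cell (tnth x i)) <= m%:R)].

Definition good (m j : nat) x : bool :=
  sparse m j x && (pairs j x <= 2 * n%:R).

(** [sparse] inspects only cells occupied by one of the first [j] points; the other cells have count
    0. *)
Lemma cnt_le_sparse m j x c : sparse m j x -> cnt j x c <= m%:R.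
Proof.
move=> /forallP H.
have [i /andP[ij /eqP <-]|H0] :=
    pickP (fun i : 'I_n => (i < j)%N && (cell (tnth x i) == c)).
  by have := H i; rewrite ij.
rewrite /cnt big1// => i ij.
by have := H0 i; rewrite ij/= => ->.
Qed.

Lemma cnt_mono j j' x c : (j <= j')%N -> cnt j x c <= cnt j' x c.
Proof.
move=> jj; rewrite /cnt big_mkcond [leRHS]big_mkcond/=; apply: ler_sum => i _.
by case: ifP => [ij|_]; [rewrite (leq_trans ij jj)|case: ifP].
Qed.

Lemma pairs_mono j j' x : (j <= j')%N -> pairs j x <= pairs j' x.
Proof.
move=> jj; rewrite /pairs big_mkcond [leRHS]big_mkcond/=; apply: ler_sum => i _.
by case: ifP => [ij|_]; [rewrite (leq_trans ij jj) cnt_mono|case: ifP => // _; exact: cnt_ge0].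
Qed.

Lemma sparse_mono m j j' x : (j <= j')%N -> sparse m j' x -> sparse m j x.
Proof.
move=> jj /forallP H; apply/forallP => i; apply/implyP => ij.
by have := H i; rewrite (leq_trans ij jj) /=; apply: le_trans; exact: cnt_mono.
Qed.

Lemma good_mono m j j' x : (j <= j')%N -> good m j' x -> good m j x.
Proof.
move=> jj /andP[/(sparse_mono jj) s p]; rewrite /good s/=.
exact: le_trans (pairs_mono _ jj) p.
Qed.

Lemma bmeas_sparse m j : bmeas (fun x => (sparse m j x)%:R : R).
Proof.
apply: (@eq_bmeas _ _ _ (fun x =>
    \prod_(i < n | (i < j)%N) (cnt j x (cell (tnth x i)) <= m%:R)%R%:R)) => [x|].
  rewrite /sparse; case: (boolP [forall i, _]) => [/forallP H|].
    by rewrite big1// => i ij; have := H i; rewrite ij /= => ->.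
  rewrite negb_forall => /existsP[i]; rewrite negb_imply => /andP[ij nc].
  by rewrite (bigD1 i)//= (negbTE nc) mul0r.
apply: bmeas_prod => i _; apply: bmeas_bool; apply: measurable_fun_ler => //.
by case: (bmeas_cnt j i).
Qed.

Lemma bmeas_good m j : bmeas (fun x => (good m j x)%:R : R).
Proof.
apply: (@eq_bmeas _ _ _ (fun x =>
    (sparse m j x)%:R * (pairs j x <= 2 * n%:R)%R%:R)) => [x|].
  by rewrite -natrM mulnb.
apply: bmeasM; first exact: bmeas_sparse.
apply: bmeas_bool; apply: measurable_fun_ler => //.
by case: (bmeas_pairs j).
Qed.

Lemma sparse_upd m j x l y : (j <= l)%N -> sparse m j (upd x l y) = sparse m j x.
Proof.
move=> jl; apply: eq_forallb => i; case: (ltnP i j) => //= ij.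
rewrite cnt_upd// tnth_upd; case: (i =P l) => // il.
by move: ij; rewrite il ltnNge jl.
Qed.

Lemma good_upd m j x l y : (j <= l)%N -> good m j (upd x l y) = good m j x.
Proof. by move=> jl; rewrite /good sparse_upd// pairs_upd. Qed.

Lemma sum_offdiag_sym (f : 'I_n -> 'I_n -> R) : (forall i l, f i l = f l i) ->
  \sum_(i < n) \sum_(l < n | i != l) f i l =
  2 * \sum_(i < n) \sum_(l < n | (l < i)%N) f l i.
Proof.
move=> fC; rewrite mulr_natl mulr2n.
have -> : \sum_(i < n) \sum_(l < n | i != l) f i l =
    \sum_(i < n) (\sum_(l < n | (l < i)%N) f l i + \sum_(l < n | (i < l)%N) f i l).
  apply: eq_bigr => i _; rewrite (bigID (fun l : 'I_n => (l < i)%N))/=; congr (_ + _).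
    rewrite (eq_bigl (fun l : 'I_n => (l < i)%N)) => [|l]; first exact: eq_bigr.
    by rewrite -(inj_eq val_inj)/=; case: ltngtP.
  by apply: eq_bigl => l; rewrite -(inj_eq val_inj)/=; case: ltngtP.
rewrite big_split/=; congr (_ + _).
rewrite (exchange_big_dep xpredT)//=.
Qed.

(** Each unordered pair is counted when its later point arrives, which exhibits [pairs] as a sum of
    terms depending on the past and the current point. *)
Lemma pairsE x : pairs n x =
  n%:R + 2 * \sum_(i < n) cnt i x (cell (tnth x i)).
Proof.
rewrite -(@sum_offdiag_sym (fun i l => (cell (tnth x i) == cell (tnth x l))%R%:R)).
  rewrite -[in n%:R](card_ord n) -sum1_card natr_sum -big_split/= /pairs.
  apply: eq_big => [i|i _]; first by rewrite ltn_ord inE.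
  rewrite /cnt [LHS](eq_bigl xpredT) => [|l]; last by rewrite ltn_ord.
  rewrite (bigD1 i)//= eqxx; congr (_ + _); apply: eq_big => l; first by rewrite eq_sym.
  by move=> _; rewrite eq_sym.
by move=> i l; rewrite eq_sym.
Qed.

(** Chernoff bound at exponent 1 for [pairs n x - n], the sum of the terms [2 * cnt i]. On [sparse]
    a count is an integer at most [m], so the exponential of such a term is at most
    [1 + expR (2 * m) * cnt i]; averaged over the new point, the count is at most [n * (M / k)]. *)
Lemma tail_pairs m :
  Ex Q (fun x => (sparse m n x && (2 * n%:R < pairs n x)%R)%:R) <=
  expR (n%:R ^+ 2 * expR (2 * m%:R) * (M / k) - n%:R).
Proof.
pose B := n%:R * expR (2 * m%:R) * (M / k).
have B0 : 0 <= B by rewrite !mulr_ge0 ?expR_ge0// invr_ge0 ltW.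
pose F i x := expR (2 * cnt i x (cell (tnth x i)) * (sparse m i x)%:R - B).
have bF i : bmeas (F i).
  apply: bmeas_expR; apply: bmeasB; last exact: bmeas_cst.
  apply: bmeasM; last exact: bmeas_sparse.
  by apply: bmeasM; [exact: bmeas_cst|exact: bmeas_cnt].
have F1 : Ex Q (fun x => \prod_(i <- lst) F i x) <= 1.
  apply: (Ex_prod_le1 resampleQ bF) => [i x|i x _|].
  - exact: expR_ge0.
  - have bc : bmeas (fun y => cnt i x (cell y)).
      apply: bmeas_sum => l _; apply: (eq_bmeas _ (bmeas_cell (cell (tnth x l)))).
      by move=> y; rewrite eq_sym.
    apply: (@le_trans _ _ (Ex rho (fun y => expR (- B) *
        (1 + expR (2 * m%:R) * cnt i x (cell y))))).
      apply: Ex_le => [||y].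
      + exact: (bmeas_upd x i (bF i)).
      + apply: bmeasM; first exact: bmeas_cst.
        apply: bmeasD; first exact: bmeas_cst.
        by apply: bmeasM; first exact: bmeas_cst.
      rewrite /F cnt_upd// sparse_upd// tnth_upd eqxx expRD mulrC ler_wpM2l ?expR_ge0//.
      case: (boolP (sparse m i x)) => [sp|_]; last first.
        by rewrite mulr0 expR0 lerDl mulr_ge0 ?expR_ge0// cnt_ge0.
      rewrite mulr1; have := cnt_le_sparse (cell y) sp; rewrite cntE.
      (* Integrality matters: the count is 0, with equality in the bound, or at least 1, where
         [expR (2 * m)] alone dominates. *)
      case: (\sum_(_ < n | _) _)%N => [|N]; first by rewrite !mulr0 expR0 addr0.
      move=> Nm; apply: (@le_trans _ _ (expR (2 * m%:R) * N.+1%:R)); last by rewrite lerDr.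
      rewrite (@le_trans _ _ (expR (2 * m%:R)))// ?ler_expR ?ler_wpM2l//.
      by rewrite ler_peMr ?expR_ge0// ler1n.
    rewrite ExZl; last first.
      apply: bmeasD; first exact: bmeas_cst.
      by apply: bmeasM; first exact: bmeas_cst.
    rewrite ExD; [|exact: bmeas_cst|by apply: bmeasM; first exact: bmeas_cst].
    rewrite Ex_cst ExZl// expRN mulrC ler_pdivrMr ?expR_gt0// mul1r.
    apply: le_trans (expR_ge1Dx _); rewrite lerD2l /B [n%:R * _]mulrC -mulrA.
    rewrite ler_wpM2l ?expR_ge0// Ex_sum; last first.
      move=> l _; apply: (eq_bmeas _ (bmeas_cell (cell (tnth x l)))) => y.
      by rewrite eq_sym.
    apply: (@le_trans _ _ (\sum_(l < n) (M / k))).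
      rewrite big_mkcond/=; apply: ler_sum => l _; case: ifP => _.
        under [X in Ex _ X]eq_fun do rewrite eq_sym.
        exact: rho_cell.
      by rewrite divr_ge0// ltW.
    by rewrite sumr_const card_ord -[(_ / _) *+ _]mulr_natl.
  - apply: adapted_lst => i l x y il; rewrite /F cnt_upd ?(ltnW il)//.
    rewrite sparse_upd ?(ltnW il)// tnth_upd; case: (i =P l) => // ei.
    by move: il; rewrite ei ltnn.
have bp : bmeas (fun x => \prod_(i <- lst) F i x) by exact: bmeas_prod.
apply: (@le_trans _ _ (Ex Q (fun x =>
    expR (n%:R ^+ 2 * expR (2 * m%:R) * (M / k) - n%:R) * \prod_(i <- lst) F i x))).
  apply: Ex_le => [||x].
  - apply: (@eq_bmeas _ _ _ (fun x =>
      (sparse m n x)%:R * (2 * n%:R < pairs n x)%R%:R)) => [x|].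
      by rewrite -natrM mulnb.
    apply: bmeasM; first exact: bmeas_sparse.
    apply: bmeas_bool; apply: measurable_fun_ltr => //.
    by case: (bmeas_pairs n).
  - by apply: bmeasM; first exact: bmeas_cst.
  rewrite (big_lst _ (F^~ x)) /F -expR_sum -expRD.
  case: (boolP (sparse m n x)) => [sp|_]; last exact: expR_ge0.
  case: ltrP => px; last exact: expR_ge0.
  rewrite -[leLHS]expR0 ler_expR sumrB sumr_const card_ord -[B *+ _]mulr_natl.
  rewrite (eq_bigr (fun i : 'I_n => 2 * cnt i x (cell (tnth x i)))) => [|i _].
    move: px; rewrite pairsE -mulr_sumr /B => px.
    lra.
  by rewrite (sparse_mono _ sp) ?mulr1// ltnW.
by rewrite ExZl// ler_piMr// expR_ge0.
Qed.

(** With point [i] held fixed, the factors of the other points may be integrated out in any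
    order. *)
Lemma adapted_cell (F : 'I_n -> n.-tuple R -> R) i (s : seq 'I_n) :
  (forall l l' x y, l' != l -> i != l -> F l' (upd x l y) = F l' x) ->
  uniq s -> i \notin s -> adapted F s.
Proof.
move=> FU; elim: s => //= l s IH /andP[ls us]; rewrite inE negb_or => /andP[il is'].
split; last exact: IH.
move=> l' l's x y; apply: FU => //.
by apply: contraNneq ls => <-.
Qed.

(** Chernoff bound as for a binomial count: given point [i], every other point falls in its cell
    with probability at most [M / k]. *)
Lemma tail_cell m i (zeta : R) : 0 <= zeta ->
  Ex Q (fun x => (m%:R < cnt n x (cell (tnth x i)))%R%:R) <=
  expR (n%:R * expR zeta * (M / k) - zeta * m%:R).
Proof.
move=> z0; pose B := expR zeta * (M / k).
have B0 : 0 <= B by rewrite !mulr_ge0 ?expR_ge0// invr_ge0 ltW.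
pose s := [seq l <- enum 'I_n | l != i].
pose F l x := expR (zeta * (cell (tnth x l) == cell (tnth x i))%R%:R - B).
have bF l : bmeas (F l).
  apply: bmeas_expR; apply: bmeasB; last exact: bmeas_cst.
  by apply: bmeasM; [exact: bmeas_cst|exact: bmeas_same_cell].
have F1 : Ex Q (fun x => \prod_(l <- s) F l x) <= 1.
  apply: (Ex_prod_le1 resampleQ bF) => [l x|l x|].
  - exact: expR_ge0.
  - rewrite mem_filter eq_sym => /andP[il _].
    have bc := bmeas_cell (cell (tnth x i)).
    apply: (@le_trans _ _ (Ex rho (fun y => expR (- B) *
        (1 + expR zeta * (cell y == cell (tnth x i))%R%:R)))).
      apply: Ex_le => [||y].
      + exact: (bmeas_upd x l (bF l)).
      + apply: bmeasM; first exact: bmeas_cst.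
        apply: bmeasD; first exact: bmeas_cst.
        by apply: bmeasM; first exact: bmeas_cst.
      rewrite /F !tnth_upd eqxx (negbTE il) expRD mulrC ler_wpM2l ?expR_ge0//.
      by case: eqP => _; rewrite ?mulr1 ?lerDr// !mulr0 expR0 addr0.
    rewrite ExZl; last first.
      apply: bmeasD; first exact: bmeas_cst.
      by apply: bmeasM; first exact: bmeas_cst.
    rewrite ExD; [|exact: bmeas_cst|by apply: bmeasM; first exact: bmeas_cst].
    rewrite Ex_cst ExZl// expRN mulrC ler_pdivrMr ?expR_gt0// mul1r.
    apply: le_trans (expR_ge1Dx _); rewrite lerD2l /B.
    by rewrite ler_wpM2l ?expR_ge0// rho_cell.
  - apply: (@adapted_cell _ i); last 2 first.
    + by rewrite filter_uniq// enum_uniq.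
    + by rewrite mem_filter eqxx.
    by move=> l l' x y l'l il; rewrite /F !tnth_upd (negbTE l'l) (negbTE il).
have bp : bmeas (fun x => \prod_(l <- s) F l x) by exact: bmeas_prod.
apply: (@le_trans _ _ (Ex Q (fun x =>
    expR (n%:R * expR zeta * (M / k) - zeta * m%:R) * \prod_(l <- s) F l x))).
  apply: Ex_le => [||x].
  - apply: bmeas_bool; apply: measurable_fun_ltr => //.
    by case: (bmeas_cnt n i).
  - by apply: bmeasM; first exact: bmeas_cst.
  rewrite /F -expR_sum -expRD.
  case: ltrP => px; last exact: expR_ge0.
  rewrite -[leLHS]expR0 ler_expR sumrB -mulr_sumr big_filter big_enum_cond/=.
  rewrite [X in _ + (_ - X)](_ : _ = (size s)%:R * B); last first.
    by rewrite big_const_seq count_predT iter_addr_0 mulr_natl.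
  have sn : (size s)%:R * B <= n%:R * B.
    rewrite ler_wpM2r// ler_nat size_filter (leq_trans (count_size _ _))//.
    by rewrite size_enum_ord.
  (* Point [i] counts itself, so more than [m] points in all leave at least [m] others. *)
  have mc : m%:R <= \sum_(l < n | l != i) (cell (tnth x l) == cell (tnth x i))%R%:R :> R.
    move: px; rewrite cntE -natr_sum ler_nat ltr_nat.
    rewrite [X in (_ < X)%N](eq_bigl xpredT) => [|l]; last by rewrite ltn_ord.
    by rewrite (bigD1 i)//= eqxx add1n ltnS.
  by have := ler_wpM2l z0 mc; move: sn; rewrite /B; lra.
by rewrite ExZl// ler_piMr// expR_ge0.
Qed.

(** Union bound over the cells of the [n] sample points. *)
Lemma tail_sparse m (zeta : R) : 0 <= zeta ->
  Ex Q (fun x => (~~ sparse m n x)%:R) <=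
  n%:R * expR (n%:R * expR zeta * (M / k) - zeta * m%:R).
Proof.
move=> z0; apply: (@le_trans _ _ (Ex Q (fun x =>
    \sum_(i < n) (m%:R < cnt n x (cell (tnth x i)))%R%:R))).
  have bc i : bmeas (fun x => (m%:R < cnt n x (cell (tnth x i)))%R%:R : R).
    apply: bmeas_bool; apply: measurable_fun_ltr => //.
    by case: (bmeas_cnt n i).
  apply: Ex_le => [||x].
  - apply: (@eq_bmeas _ _ _ (fun x => 1 - (sparse m n x)%:R)) => [x|].
      by case: sparse; rewrite ?subrr ?subr0.
    by apply: bmeasB; [exact: bmeas_cst|exact: bmeas_sparse].
  - exact: bmeas_sum.
  case: (boolP (sparse m n x)) => [_|]; first exact: sumr_ge0.
  rewrite negb_forall => /existsP[i]; rewrite negb_imply -ltNge => /andP[_ ci].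
  by rewrite (bigD1 i)//= ci lerDl sumr_ge0.
rewrite Ex_sum; last first.
  move=> i _; apply: bmeas_bool; apply: measurable_fun_ltr => //.
  by case: (bmeas_cnt n i).
apply: (@le_trans _ _ (\sum_(i < n) expR (n%:R * expR zeta * (M / k) - zeta * m%:R))).
  by apply: ler_sum => i _; exact: tail_cell.
by rewrite sumr_const card_ord -[expR _ *+ _]mulr_natl.
Qed.

Lemma dev_le m x i y : sparse m i x ->
  `|dev i (upd x i y)| <= 2 * (b * k * r0%:R * m%:R + n%:R * A).
Proof.
move=> sp; have H z : `|incr i x z| <= b * k * r0%:R * m%:R + n%:R * A.
  apply: (le_trans (ler_normD _ _)); apply: lerD.
    apply: (le_trans (hsum_le _ _ _)); rewrite -!mulrA !ler_wpM2l ?(ltW k0)//.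
    apply: (@le_trans _ _ (\sum_(r < r0) m%:R)).
      by apply: ler_sum => r _; exact: cnt_le_sparse.
    by rewrite sumr_const card_ord mulr_natl.
  by rewrite normrM ler_pM// ?marg_le// ger0_norm// ler_nat leq_subr.
rewrite dev_upd (le_trans (ler_normB _ _))// mulr_natl mulr2n lerD//.
by apply: Ex_norm_le => //; exact: bmeas_incr.
Qed.

(** An inequality of Freedman type. While [good] holds, [lambda * dev] is at most [1 / 2], the
    quadratic bound on the exponential applies, and centring removes its linear term; once [good]
    fails, the factor is [expR (- B) <= 1]. *)
Lemma tail_good m (lambda t : R) : 0 <= lambda ->
  lambda * (b * k * r0%:R * m%:R + n%:R * A) *+ 4 <= 1 ->
  Ex Q (fun x => (good m n x && (t < devsum x)%R)%:R) <=
  expR (n%:R * lambda ^+ 2 * (c1 * k * n%:R *+ 4 + c2 * n%:R ^+ 2 *+ 2) - lambda * t).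
Proof.
move=> l0 l1.
(* Twice the bound of [Ex_dev_sqr] under [pairs i x <= 2 * n]; the factor 2 comes from
   [expR_le_quadratic]. *)
pose V := c1 * k * n%:R *+ 4 + c2 * n%:R ^+ 2 *+ 2.
pose B := lambda ^+ 2 * V.
have c10 : 0 <= c1 by rewrite !mulr_ge0 ?sqr_ge0.
have c20 : 0 <= c2 by rewrite !mulr_ge0 ?sqr_ge0.
have V0 : 0 <= V.
  by rewrite addr_ge0// mulrn_wge0// !mulr_ge0// ?sqr_ge0// ltW.
have B0 : 0 <= B by rewrite mulr_ge0 ?sqr_ge0.
pose F i x := expR (lambda * dev i x * (good m i x)%:R - B).
have bF i : bmeas (F i).
  apply: bmeas_expR; apply: bmeasB; last exact: bmeas_cst.
  apply: bmeasM; last exact: bmeas_good.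
  by apply: bmeasM; [exact: bmeas_cst|exact: bmeas_dev].
have F1 : Ex Q (fun x => \prod_(i <- lst) F i x) <= 1.
  apply: (Ex_prod_le1 resampleQ bF) => [i x|i x _|].
  - exact: expR_ge0.
  - case: (boolP (good m i x)) => gi; last first.
      apply: Ex_le_cst => [|y]; first exact: (bmeas_upd x i (bF i)).
      rewrite /F good_upd// (negbTE gi) mulr0 sub0r -[leRHS]expR0 ler_expR.
      by rewrite oppr_le0.
    have bd : bmeas (fun y => dev i (upd x i y)) by exact: (bmeas_upd x i (bmeas_dev i)).
    have bd1 : bmeas (fun y => lambda * dev i (upd x i y)).
      by apply: bmeasM; first exact: bmeas_cst.
    have bd2 : bmeas (fun y => 2 * lambda ^+ 2 * dev i (upd x i y) ^+ 2).
      by apply: bmeasM; [exact: bmeas_cst|exact: bmeasX].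
    have b1 : bmeas (fun y => 1 + lambda * dev i (upd x i y)).
      by apply: bmeasD => //; exact: bmeas_cst.
    apply: (@le_trans _ _ (Ex rho (fun y => expR (- B) *
        (1 + lambda * dev i (upd x i y) + 2 * lambda ^+ 2 * dev i (upd x i y) ^+ 2)))).
      apply: Ex_le => [||y].
      + exact: (bmeas_upd x i (bF i)).
      + by apply: bmeasM; [exact: bmeas_cst|exact: bmeasD].
      rewrite /F good_upd// gi mulr1 expRD mulrC ler_wpM2l ?expR_ge0//.
      rewrite -[2 * _ * _]mulrA -exprMn; apply: expR_le_quadratic.
      have /andP[sp _] := gi; have := dev_le y sp.
      move=> /(le_trans (ler_norm _))/(ler_wpM2l l0); move: l1.
      by rewrite !mulr2n; lra.
    rewrite ExZl; last exact: bmeasD.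
    rewrite ExD// ExD//; last exact: bmeas_cst.
    rewrite Ex_cst ExZl// Ex_dev mulr0 addr0 ExZl; last exact: bmeasX.
    rewrite expRN mulrC ler_pdivrMr ?expR_gt0// mul1r.
    apply: le_trans (expR_ge1Dx _); rewrite lerD2l /B [2 * _]mulrC -mulrA.
    rewrite ler_wpM2l ?sqr_ge0//.
    apply: (le_trans (ler_wpM2l _ (Ex_dev_sqr _ _))) => //.
    have /andP[_ pi] := gi.
    have : c1 * k * pairs i x <= c1 * k * (2 * n%:R).
      by rewrite ler_wpM2l// mulr_ge0// ltW.
    by rewrite /V; lra.
  - apply: adapted_lst => i l x y il; rewrite /F dev_depends// good_upd//.
    exact: ltnW.
have bp : bmeas (fun x => \prod_(i <- lst) F i x) by exact: bmeas_prod.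
apply: (@le_trans _ _ (Ex Q (fun x =>
    expR (n%:R * lambda ^+ 2 * V - lambda * t) * \prod_(i <- lst) F i x))).
  apply: Ex_le => [||x].
  - apply: (@eq_bmeas _ _ _ (fun x =>
      (good m n x)%:R * (t < devsum x)%R%:R)) => [x|].
      by rewrite -natrM mulnb.
    apply: bmeasM; first exact: bmeas_good.
    apply: bmeas_bool; apply: measurable_fun_ltr => //.
    by case: bmeas_devsum.
  - by apply: bmeasM; first exact: bmeas_cst.
  rewrite (big_lst _ (F^~ x)) /F -expR_sum -expRD.
  (* [good] for the whole sample implies [good] at every earlier index, so that no factor is
     truncated here. *)
  case: (boolP (good m n x)) => [gd|_]; last exact: expR_ge0.
  case: ltrP => px; last exact: expR_ge0.
  rewrite -[leLHS]expR0 ler_expR sumrB sumr_const card_ord -[B *+ _]mulr_natl.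
  rewrite (eq_bigr (fun i : 'I_n => lambda * dev i x)) => [|i _].
    rewrite -mulr_sumr -/(devsum x) /B; have := ler_wpM2l l0 (ltW px).
    by lra.
  by rewrite (good_mono _ gd) ?mulr1// ltnW.
by rewrite ExZl// ler_piMr// expR_ge0.
Qed.

(** The sample is good, or sparse with too many pairs, or not sparse: one term for each case. *)
Lemma tail_devsum m (lambda zeta t : R) : 0 <= lambda -> 0 <= zeta ->
  lambda * (b * k * r0%:R * m%:R + n%:R * A) *+ 4 <= 1 ->
  Ex Q (fun x => (t < devsum x)%R%:R) <=
  expR (n%:R * lambda ^+ 2 * (c1 * k * n%:R *+ 4 + c2 * n%:R ^+ 2 *+ 2) - lambda * t) +
  expR (n%:R ^+ 2 * expR (2 * m%:R) * (M / k) - n%:R) +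
  n%:R * expR (n%:R * expR zeta * (M / k) - zeta * m%:R).
Proof.
move=> l0 z0 l1.
have b1 : bmeas (fun x => (good m n x && (t < devsum x)%R)%:R : R).
  apply: (@eq_bmeas _ _ _ (fun x => (good m n x)%:R * (t < devsum x)%R%:R)) => [x|].
    by rewrite -natrM mulnb.
  apply: bmeasM; first exact: bmeas_good.
  by apply: bmeas_bool; apply: measurable_fun_ltr => //; case: bmeas_devsum.
have b2 : bmeas (fun x => (sparse m n x && (2 * n%:R < pairs n x)%R)%:R : R).
  apply: (@eq_bmeas _ _ _ (fun x =>
      (sparse m n x)%:R * (2 * n%:R < pairs n x)%R%:R)) => [x|].
    by rewrite -natrM mulnb.
  apply: bmeasM; first exact: bmeas_sparse.
  by apply: bmeas_bool; apply: measurable_fun_ltr => //; case: (bmeas_pairs n).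
have b3 : bmeas (fun x => (~~ sparse m n x)%:R : R).
  apply: (@eq_bmeas _ _ _ (fun x => 1 - (sparse m n x)%:R)) => [x|].
    by case: sparse; rewrite ?subrr ?subr0.
  by apply: bmeasB; [exact: bmeas_cst|exact: bmeas_sparse].
apply: (@le_trans _ _ (Ex Q (fun x => (good m n x && (t < devsum x)%R)%:R +
   (sparse m n x && (2 * n%:R < pairs n x)%R)%:R + (~~ sparse m n x)%:R))).
  apply: Ex_le => [||x].
  - by apply: bmeas_bool; apply: measurable_fun_ltr => //; case: bmeas_devsum.
  - by apply: bmeasD => //; exact: bmeasD.
  rewrite /good -!natrD ler_nat leNgt.
  by case: (sparse m n x) => //=; case: (_ < pairs n x); case: (t < _).
rewrite ExD//; last exact: bmeasD.
rewrite ExD// !lerD ?tail_pairs ?tail_sparse//.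
exact: tail_good.
Qed.

(** * From the martingale back to the U-statistic *)

Lemma sum_after l : \sum_(i < n | (l < i)%N) (1 : R) = (n - l.+1)%:R.
Proof.
rewrite -(big_mkord (fun p : nat => (l < p)%N) (fun=> 1)).
rewrite -(big_nat_widenl l.+1 0 n xpredT)//=.
by rewrite sumr_const_nat.
Qed.

Lemma sum_sum_before (F : 'I_n -> R) :
  \sum_(i < n) \sum_(l < n | (l < i)%N) F l = \sum_(l < n) (n - l.+1)%:R * F l.
Proof.
rewrite (exchange_big_dep xpredT)//=; apply: eq_bigr => l _.
by rewrite -sum_after mulr_suml; apply: eq_bigr => i _; rewrite mul1r.
Qed.

Definition ustat x : R := (n%:R * (n%:R - 1))^-1 *
  \sum_(i1 < n) \sum_(i2 < n | i1 != i2) h (tnth x i1) (tnth x i2).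

(** The averaged pairs with later points, added in one difference, are what later differences
    subtract when centring; by [sum_sum_before] these linear terms cancel and each unordered pair
    remains once. *)
Lemma devsumE : (forall y z, h y z = h z y) -> forall x,
  2 * devsum x = \sum_(i1 < n) \sum_(i2 < n | i1 != i2) h (tnth x i1) (tnth x i2)
               - n%:R * (n%:R - 1) * hmean.
Proof.
move=> hC x; rewrite sum_offdiag_sym; last by move=> i l; exact: hC.
have -> : n%:R * (n%:R - 1) = 2 * \sum_(i < n) (n - i.+1)%:R :> R.
  rewrite -[RHS]/(2 * _) -[X in 2 * X](_ : \sum_(i < n) \sum_(l < n | (l < i)%N) 1 = _).
    rewrite -(@sum_offdiag_sym (fun _ _ => 1))//.
    have E i : \sum_(l < n | i != l) (1 : R) = n%:R - 1.
      have : \sum_(l < n) (1 : R) = n%:R by rewrite sumr_const card_ord.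
      rewrite (bigD1 i)//= => <-; rewrite addrAC subrr add0r.
      by apply: eq_bigl => l; rewrite eq_sym.
    by under [RHS]eq_bigr do rewrite E; rewrite sumr_const card_ord mulr_natl.
  by rewrite sum_sum_before; apply: eq_bigr => i _; rewrite mulr1.
rewrite -mulrA -mulrBr; congr (2 * _).
rewrite /devsum mulr_suml -sumrB.
have -> : \sum_(i < n) dev i x = \sum_(i < n)
    ((hsum i x (tnth x i) - (n - i.+1)%:R * hmean) +
     ((n - i.+1)%:R * marg (tnth x i) - \sum_(l < n | (l < i)%N) marg (tnth x l))).
  by apply: eq_bigr => i _; rewrite /dev Ex_incr /incr; ring.
by rewrite big_split/= [X in _ + X]sumrB sum_sum_before subrr addr0.
Qed.

Lemma ustat_le x : `|ustat x| <= b * k * r0%:R.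
Proof.
have h_le y z : `|h y z| <= b * k * r0%:R.
  apply: (le_trans (hcell _ _)); rewrite ler_wpM2l ?mulr_ge0// ?(ltW k0)//.
  rewrite -[X in _ <= X%:R]card_ord -sum1_card natr_sum; apply: ler_sum => r _.
  by rewrite lern1 leq_b1.
have B0 : 0 <= b * k * r0%:R by rewrite !mulr_ge0// ltW.
have [n1|n2] := leqP n 1.
  (* For [n <= 1] the normalisation is the inverse of 0, which is 0 by convention. *)
  have -> : ustat x = 0; last by rewrite normr0.
  rewrite /ustat (_ : n%:R * (n%:R - 1) = 0) ?invr0 ?mul0r//.
  by case: (n) n1 => [|[|//]] _; rewrite ?mul0r// subrr mulr0.
have n10 : 0 < n%:R - 1 :> R by rewrite subr_gt0 ltr1n.
have n0 : 0 < n%:R :> R by rewrite ltr0n (ltn_trans _ n2).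
rewrite normrM gtr0_norm ?invr_gt0 ?mulr_gt0// mulrC ler_pdivrMr ?mulr_gt0//.
apply: (le_trans (ler_norm_sum _ _ _)).
apply: (@le_trans _ _ (\sum_(i1 < n) \sum_(i2 < n | i1 != i2) b * k * r0%:R)).
  apply: ler_sum => i1 _; apply: (le_trans (ler_norm_sum _ _ _)).
  by apply: ler_sum.
have E i : \sum_(l < n | i != l) b * k * r0%:R = (n%:R - 1) * (b * k * r0%:R).
  rewrite mulrBl mul1r mulr_natl.
  have : \sum_(l < n) (b * k * r0%:R) = (b * k * r0%:R) *+ n.
    by rewrite sumr_const card_ord.
  rewrite (bigD1 i)//= => <-; rewrite addrAC subrr add0r.
  by apply: eq_bigl => l; rewrite eq_sym.
under eq_bigr do rewrite E.
by rewrite sumr_const card_ord -[(_ * _) *+ _]mulr_natl; lra.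
Qed.

Lemma bmeas_ustat : bmeas ustat.
Proof.
apply: bmeasM; first exact: bmeas_cst.
apply: bmeas_sum => i _; apply: bmeas_sum => l _.
apply: (bmeas_comp (phi := fun x => (tnth x i, tnth x l)) _ bh).
by apply: measurable_fun_pair; exact: measurable_tnth.
Qed.

Hypothesis hC : forall y z, h y z = h z y.
Hypothesis n2 : (1 < n)%N.

Let n10 : 0 < n%:R - 1 :> R. Proof. by rewrite subr_gt0 ltr1n. Qed.
Let n0 : 0 < n%:R :> R. Proof. by rewrite ltr0n (ltn_trans _ n2). Qed.

Lemma ustatB x : ustat x - hmean = 2 / (n%:R * (n%:R - 1)) * devsum x.
Proof.
rewrite mulrAC devsumE// mulrBl /ustat [in RHS]mulrC; congr (_ - _).
have nn : n%:R != 0 :> R by rewrite gt_eqF.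
have nn1 : n%:R - 1 != 0 :> R by rewrite gt_eqF.
by field; rewrite nn nn1.
Qed.

Lemma ustat_variance : Ex Q (fun x => (ustat x - hmean) ^+ 2) <=
  16 * (c1 * k / n%:R ^+ 2 + (c1 * M + c2) / n%:R).
Proof.
have bd : bmeas (fun x => devsum x ^+ 2) by apply: bmeasX; exact: bmeas_devsum.
have b1 : bmeas (fun x => (ustat x - hmean) ^+ 2).
  by apply: bmeasX; apply: bmeasB; [exact: bmeas_ustat|exact: bmeas_cst].
have nn : n%:R != 0 :> R by rewrite gt_eqF.
apply: (@le_trans _ _ (Ex Q (fun x => 16 / n%:R ^+ 4 * devsum x ^+ 2))).
  apply: Ex_le => // [|x]; first by apply: bmeasM; first exact: bmeas_cst.
  rewrite ustatB exprMn ler_wpM2r ?sqr_ge0//.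
  (* The constant 16 is the square of 4: [2 / (n (n - 1)) <= 4 / n^2] as soon as [n >= 2]. *)
  rewrite (_ : 16 / _ = (4 / n%:R ^+ 2) ^+ 2); last by field.
  rewrite ler_sqr ?nnegrE ?divr_ge0// ?sqr_ge0// ?mulr_ge0// ?(ltW n0)// ?(ltW n10)//.
  rewrite ler_pdivrMr ?mulr_gt0// mulrAC ler_pdivlMr ?exprn_gt0//.
  have : 2 <= n%:R :> R by rewrite ler_nat.
  by nra.
rewrite ExZl//; apply: (le_trans (ler_wpM2l _ Ex_devsum_sqr)).
  by rewrite divr_ge0// exprn_ge0// ltW.
rewrite [leLHS](_ : _ = 16 * (c1 * k / n%:R ^+ 2 + (c1 * M + c2) / n%:R))//.
by field.
Qed.

Lemma ustat_tail m (lambda zeta t : R) : 0 <= lambda -> 0 <= zeta -> 0 <= t ->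
  lambda * (b * k * r0%:R * m%:R + n%:R * A) *+ 4 <= 1 ->
  Ex Q (fun x => (t < ustat x - hmean)%R%:R) <=
  expR (n%:R * lambda ^+ 2 * (c1 * k * n%:R *+ 4 + c2 * n%:R ^+ 2 *+ 2)
        - lambda * (t * n%:R ^+ 2 / 4)) +
  expR (n%:R ^+ 2 * expR (2 * m%:R) * (M / k) - n%:R) +
  n%:R * expR (n%:R * expR zeta * (M / k) - zeta * m%:R).
Proof.
move=> l0 z0 t0 l1; apply: le_trans (tail_devsum _ l0 z0 l1).
apply: Ex_le => [||x].
- apply: bmeas_bool; apply: measurable_fun_ltr => //.
  by apply: measurable_funB => //; case: bmeas_ustat.
- by apply: bmeas_bool; apply: measurable_fun_ltr => //; case: bmeas_devsum.
rewrite ler_nat; case: (ltrP t (ustat x - hmean)) => // tU.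
(* Again [n^2 / 4 <= n (n - 1) / 2], and [t] is nonnegative. *)
suff -> : t * n%:R ^+ 2 / 4 < devsum x by [].
move: tU; rewrite ustatB mulrAC ltr_pdivlMr ?mulr_gt0// => tS.
have : 2 <= n%:R :> R by rewrite ler_nat.
move=> n2R; have : 0 <= t * (n%:R * (n%:R - 2)) by rewrite !mulr_ge0 ?subr_ge0// ltW.
by move: tS; lra.
Qed.

End UStatistic.

(** * Densities and projection kernels *)

Section DensityIntegral.
Local Open Scope ereal_scope.
Context d (T : measurableType d) (R : realType).
Variables (mu nu : {measure set T -> \bar R}) (w : T -> R).
Hypotheses (w0 : forall x, (0 <= w x)%R) (mw : measurable_fun [set: T] w).
Hypothesis nuE : forall A, measurable A -> nu A = \int[mu]_(x in A) (w x)%:E.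

Let mwE : measurable_fun [set: T] (fun x => (w x)%:E).
Proof. exact/measurable_EFinP. Qed.

Let indic_density E : measurable E ->
  \int[nu]_x (\1_E x)%:E = \int[mu]_x ((\1_E x)%:E * (w x)%:E).
Proof.
move=> mE; rewrite integral_indic//= setIT nuE// integral_mkcond/=.
apply: eq_integral => x _; rewrite patchE indicE.
by case: ifPn => _; rewrite ?mul1e ?mul0e.
Qed.

Import HBNNSimple.

Let nnsfun_density (g : {nnsfun T >-> R}) :
  \int[nu]_x (g x)%:E = \int[mu]_x ((g x)%:E * (w x)%:E).
Proof.
under [LHS]eq_integral do rewrite fimfunE -fsumEFin//.
rewrite [LHS]ge0_integral_fsum//; last 2 first.
  - by move=> r; exact/measurable_EFinP/measurableT_comp.
  - by move=> n x _; rewrite EFinM nnfun_muleindic_ge0.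
under [RHS]eq_integral.
  move=> x xD; rewrite fimfunE -fsumEFin// muleC ge0_mule_fsumr; last first.
    by move=> r; rewrite EFinM nnfun_muleindic_ge0.
  over.
have wi0 r x : 0 <= (w x)%:E * (r * \1_(g @^-1` [set r]) x)%:E.
  by rewrite EFinM mule_ge0 ?lee_fin// -?lee_fin ?EFinM ?nnfun_muleindic_ge0.
rewrite [RHS]ge0_integral_fsum//; last first.
  move=> r; apply: emeasurable_funM => //.
  by apply/measurable_EFinP; exact/measurableT_comp.
apply: eq_fsbigr => r /set_mem[x _ grx].
have r0 : (0 <= r)%R by rewrite -grx.
under eq_integral do rewrite EFinM.
under [RHS]eq_integral do rewrite EFinM muleCA (muleC (w _)%:E).
rewrite !ge0_integralZl//.
- by rewrite indic_density.
- by apply: emeasurable_funM => //; exact/measurable_EFinP/measurable_indic.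
- by move=> y _; rewrite mule_ge0// lee_fin.
- exact/measurable_EFinP/measurable_indic.
Qed.

(** Indicators, then simple functions by linearity, then monotone limits. *)
Lemma ge0_integral_density (g : T -> \bar R) :
  measurable_fun [set: T] g -> (forall x, 0 <= g x) ->
  \int[nu]_x g x = \int[mu]_x (g x * (w x)%:E).
Proof.
move=> mg g0.
pose g_ := nnsfun_approx measurableT mg.
transitivity (limn (fun n => \int[nu]_x (g_ n x)%:E)).
  rewrite -monotone_convergence//=.
  - apply: eq_integral => ? /[!inE] xD; apply/esym/cvg_lim => //=.
    exact: cvg_nnsfun_approx.
  - by move=> n; exact/measurable_EFinP/measurable_funTS.
  - by move=> n ? _; rewrite lee_fin.
  - by move=> ? _ ? ? mn; rewrite lee_fin; exact/lefP/nd_nnsfun_approx.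
under eq_fun do rewrite nnsfun_density.
rewrite -monotone_convergence//=.
- apply: eq_integral => x _; apply/cvg_lim => //=.
  by apply: cvgeZr => //; exact: cvg_nnsfun_approx.
- move=> n; apply: emeasurable_funM => //.
  by apply/measurable_EFinP; exact/measurable_funTS.
- by move=> n x _; rewrite mule_ge0 ?lee_fin.
- move=> x _ m n mn; rewrite lee_pmul// ?lee_fin//.
  exact/lefP/nd_nnsfun_approx.
Qed.

End DensityIntegral.

Section Density01.
Context (R : realType).
Local Notation mu := (@lebesgue_measure R).

(** The values of [f] off [0, 1] are arbitrary. Cutting them off gives a density on the line, at the
    price of possible jumps at 0 and 1. *)
Definition ext01 (f : R -> R) (x : R) : R := if 0 <= x <= 1 then f x else 0.

Lemma ext01_restrict f : ext01 f = f \_ `[0, 1].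
Proof.
apply/funext => x; rewrite /ext01 patchE; case: ifPn => x01.
  by rewrite ifT// inE/= in_itv.
by rewrite ifF//; apply/negP; rewrite inE/= in_itv/=; exact/negP.
Qed.

Lemma measurable_ext01 f :
  measurable_fun (`[0, 1]%classic : set R) f -> measurable_fun [set: R] (ext01 f).
Proof. by rewrite ext01_restrict => /measurable_restrictT; apply. Qed.

Variables (rho : probability R R) (w : R -> R) (M : R).
Hypothesis rhoE : forall A, measurable A -> rho A = (\int[mu]_(x in A) (w x)%:E)%E.
Hypotheses (w0 : forall x, 0 <= w x) (wM : forall x, w x <= M).
Hypothesis mw : measurable_fun [set: R] w.

Lemma integral_density1 : (\int[mu]_x (w x)%:E = 1)%E.
Proof. by rewrite -rhoE// probability_setT. Qed.

Lemma integrable_density : mu.-integrable [set: R] (EFin \o w).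
Proof.
apply/integrableP; split; first exact/measurable_EFinP.
under eq_integral do rewrite /= ger0_norm//.
by rewrite integral_density1 ltry.
Qed.

Lemma integrable_Mdensity g : bmeas g ->
  mu.-integrable [set: R] (fun x => (g x * w x)%:E).
Proof.
move=> [mg [B HB]].
rewrite (_ : (fun _ => _) = (EFin \o g) \* (EFin \o w))%E//.
apply: integrableMr => //; last exact: integrable_density.
exists B; split; first exact: num_real.
by move=> C BC x _ /=; rewrite (le_trans (HB x))// ltW.
Qed.

(* Lebesgue measure lives on [measurableTypeR R], whose display differs from
   that of the measurable structure of [R]. *)
Let retype (x : R) : measurableTypeR R := x.

Let mretype : measurable_fun [set: R] retype.
Proof. by move=> _ A mA; rewrite setTI. Qed.

Let rho' : {measure set (measurableTypeR R) -> \bar R} :=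
  measure_function_pushforward__canonical__measure_function_Measure rho mretype.

Lemma Ex_density g : bmeas g -> Ex rho g = \int[mu]_x (g x * w x).
Proof.
move=> bg; have [mg [B HB]] := bg.
(* Shifting by the bound makes the integrand nonnegative; the shift is subtracted at the end, the
   density having mass 1. *)
have bgB : bmeas (fun x => g x + B) by apply: bmeasD => //; exact: bmeas_cst.
have gB0 x : 0 <= g x + B by rewrite -lerBlDr sub0r lerNnormlW.
have : Ex rho (fun x => g x + B) = \int[mu]_x ((g x + B) * w x).
  have mgB : measurable_fun [set: measurableTypeR R] (fun x => (g x + B)%:E).
    by apply/measurable_EFinP; case: bgB.
  rewrite /Rintegral; congr fine.
  apply: etrans (@ge0_integral_density _ (measurableTypeR R) R mu rho' w w0 mw rhoE _ mgB _).
    by rewrite ge0_integral_pushforward// => x _; rewrite lee_fin.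
  by move=> x; rewrite lee_fin.
rewrite ExD//; last exact: bmeas_cst.
rewrite Ex_cst (_ : (fun x => (g x + B) * w x) =
  (fun x => g x * w x + B * w x)); last first.
  by apply/funext => x; rewrite mulrDl.
rewrite RintegralD//; [|exact: integrable_Mdensity|]; last first.
  by apply: integrable_Mdensity; exact: bmeas_cst.
rewrite RintegralZl//; last exact: integrable_density.
rewrite [X in _ + _ * X](_ : _ = 1); first by rewrite mulr1 => /addIr.
by rewrite /Rintegral integral_density1.
Qed.

Lemma Ex_density_le (A : set R) : measurable A ->
  (rho A <= M%:E * mu A)%E.
Proof.
move=> mA; rewrite rhoE// -[leRHS]integral_cst//.
apply: ge0_le_integral => //.
- by move=> x _; rewrite lee_fin.
- by apply/measurable_EFinP; exact: measurable_funTS.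
- by move=> x _; rewrite /= lee_fin.
Qed.

End Density01.

Section Cells.
Context (R : realType).
Variables (rho : probability R R) (M : R).
Hypothesis rho_le : forall A : set R, measurable A ->
  (rho A <= M%:E * lebesgue_measure A)%E.

(** The index is kept as a real number: it is then a monotone, hence measurable, real function, and
    cells are shifted by adding reals. *)
Definition dyadic_cell (J : nat) (x : R) : R := (Num.floor (2 ^+ J * x))%:~R.

Lemma measurable_dyadic_cell J : measurable_fun [set: R] (dyadic_cell J).
Proof.
apply: nondecreasing_measurable => // x y xy.
by rewrite ler_int le_floor// ler_wpM2l// exprn_ge0.
Qed.

Lemma Ex_dyadic_cell J (c : R) : 0 <= M ->
  Ex rho (fun y => (dyadic_cell J y == c)%R%:R) <= M / 2 ^+ J.
Proof.
move=> M0; have J0 : 0 < 2 ^+ J :> R by rewrite exprn_gt0.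
(* A real [c] that is not an integer labels no cell, and the event is empty. *)
have [[y0 yc]|nc] := pselect (exists y0, dyadic_cell J y0 = c); last first.
  rewrite (_ : (fun _ => _) = fun=> 0); first by rewrite Ex_cst divr_ge0// ltW.
  by apply/funext => y; case: eqP => // yc; case: nc; exists y.
pose A := `[c / 2 ^+ J, (c + 1) / 2 ^+ J[%classic : set R.
have -> : Ex rho (fun y => (dyadic_cell J y == c)%R%:R) = fine (rho A).
  rewrite /Rintegral -[in RHS](setIT A) -integral_indic//; last exact: measurable_itv.
  congr fine; apply: eq_integral => y _; rewrite indicE; congr (_%:R%:E).
  rewrite mem_setE in_itv/= ler_pdivrMr// ltr_pdivlMr// [y * _]mulrC.
  by rewrite -yc /dyadic_cell eqr_int floor_eq intrD.
rewrite -lee_fin fineK ?fin_num_measure//; last exact: measurable_itv.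
apply: (le_trans (rho_le _)); first exact: measurable_itv.
rewrite lebesgue_measure_itv/= lte_fin ltr_pM2r ?invr_gt0// ltrDl ltr01.
by rewrite -EFinB -EFinM lee_fin -mulrBl addrAC subrr add0r mul1r.
Qed.

End Cells.

(** * Locality and size of the projection kernel *)

Lemma bounded_compact_supportP (R : realType) (g : R -> R) :
  bounded_compact_support g ->
  exists (B : R) (S : nat), [/\ 0 <= B, forall x, `|g x| <= B &
    forall x, S%:R <= `|x| -> g x = 0].
Proof.
move=> [_ [B0 [_ HB]] cg].
have [M [_ HM]] := compact_bounded cg.
pose B := Num.max B0 0 + 1; pose M' := Num.max M 0 + 1.
exists B, (Num.bound M'); split.
- by rewrite addr_ge0// le_max lexx orbT.
- move=> x; apply: (HB B) => //.
  by rewrite (@le_lt_trans _ _ (Num.max B0 0)) ?le_max ?lexx// ltrDl.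
move=> x Sx; apply/eqP; apply: contraPT Sx => gx; apply/negP; rewrite -ltNge.
have M'0 : 0 <= M' by rewrite addr_ge0// le_max lexx orbT.
rewrite (@le_lt_trans _ _ M')//; last by have := archi_boundP M'0.
apply: (HM M'); last exact: subset_closure.
by rewrite (@le_lt_trans _ _ (Num.max M 0)) ?le_max ?lexx// ltrDl.
Qed.

Lemma fsum_int_seq (R : realType) (F : int -> R) (s : seq int) :
  uniq s -> (forall j, j \notin s -> F j = 0) ->
  \sum_(j \in [set: int]) F j = \sum_(j <- s) F j.
Proof.
move=> us F0; rewrite [RHS]fsbig_seq// -(fsbig_widen [set` s] setT)//.
by move=> j [_ /= js]; apply: F0; apply/negP.
Qed.

(** If [|t - j| < S], then [j - floor t] is an integer of [[-S, S]], whence the [2 S + 1] terms. *)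
Lemma fsum_int_window (R : realType) (F : int -> R) (t : R) (S : nat) :
  (forall j : int, S%:R <= `|t - j%:~R| -> F j = 0) ->
  \sum_(j \in [set: int]) F j =
  \sum_(r < S.*2.+1) F (Num.floor t + (r%:Z - S%:Z)).
Proof.
move=> F0.
rewrite (@fsum_int_seq _ _ [seq Num.floor t + (r%:Z - S%:Z) | r <- iota 0 S.*2.+1]).
- by rewrite big_map -/(index_iota 0 S.*2.+1) big_mkord.
- by rewrite map_inj_uniq ?iota_uniq// => r1 r2 /addrI/addIr [].
move=> j js; apply: F0; rewrite leNgt; apply: contra js => /ltr_normlP[h1 h2].
have f1 := floor_le t; have f2 := floorD1_gt t.
have j0 : 0 <= (j : int) - Num.floor t + S%:Z.
  rewrite -ltzD1 -(ltr_int R) !rmorphD/= rmorphN/=; lra.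
have j1 : (j : int) - Num.floor t + S%:Z < S.*2.+1%:Z.
  rewrite -(ltr_int R) -addnn -addn1 !PoszD.
  by move: f2; rewrite !rmorphD/= rmorphN/=; lra.
apply/mapP; exists (absz ((j : int) - Num.floor t + S%:Z)); last by lia.
by rewrite mem_iota/=; lia.
Qed.

Section Kernel.
Context (R : realType) (phi : R -> R) (B : R) (S k : nat).
Hypotheses (B0 : 0 <= B) (mphi : measurable_fun [set: R] phi).
Hypotheses (phi_le : forall x, `|phi x| <= B).
Hypothesis phi_supp : forall x, S%:R <= `|x| -> phi x = 0.

Let J := up_log 2 k.

(** A window that moves with [x] has a fixed number of terms, which makes the kernel visibly bounded
    and measurable. *)
Lemma proj_kernelE x y : proj_kernel phi k x y = \sum_(r < S.*2.+1)
  2 ^+ J * phi (2 ^+ J * x - (dyadic_cell J x + (r%:R - S%:R))) *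
           phi (2 ^+ J * y - (dyadic_cell J x + (r%:R - S%:R))).
Proof.
rewrite /proj_kernel -/J (@fsum_int_window _ _ (2 ^+ J * x) S) => [|j Sj].
  by apply: eq_bigr => r _; rewrite /dyadic_cell rmorphD/= rmorphB/=.
by rewrite phi_supp// mulr0 mul0r.
Qed.

Lemma proj_kernelC x y : proj_kernel phi k x y = proj_kernel phi k y x.
Proof. by apply: eq_fsbigr => j _; rewrite mulrAC. Qed.

Let J0 : 0 < 2 ^+ J :> R. Proof. by rewrite exprn_gt0. Qed.

Let term_le u v : `|2 ^+ J * phi u * phi v| <= 2 ^+ J * B ^+ 2.
Proof.
rewrite -mulrA normrM ger0_norm ?(ltW J0)// ler_wpM2l ?(ltW J0)//.
by rewrite normrM expr2 ler_pM.
Qed.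

Let kernel_bound x y :
  `|proj_kernel phi k x y| <= B ^+ 2 * S.*2.+1%:R * 2 ^+ J.
Proof.
rewrite proj_kernelE (le_trans (ler_norm_sum _ _ _))//.
apply: (@le_trans _ _ (\sum_(r < S.*2.+1) 2 ^+ J * B ^+ 2)).
  by apply: ler_sum => r _; exact: term_le.
by rewrite sumr_const card_ord -[(_ * _) *+ _]mulr_natl; lra.
Qed.

Lemma bmeas_proj_kernel : bmeas (fun p : R * R => proj_kernel phi k p.1 p.2).
Proof.
split; last by exists (B ^+ 2 * S.*2.+1%:R * 2 ^+ J) => p; exact: kernel_bound.
under eq_fun do rewrite proj_kernelE.
have mc : measurable_fun [set: R * R] (fun p => dyadic_cell J p.1).
  by apply: measurableT_comp => //; exact: measurable_dyadic_cell.
apply: (@measurable_sum _ _ R [set: R * R] 'I_(S.*2.+1)).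
move=> r; have mj (g : R * R -> R) : measurable_fun [set: R * R] g ->
    measurable_fun [set: R * R]
      (fun p => phi (2 ^+ J * g p - (dyadic_cell J p.1 + (r%:R - S%:R)))).
  move=> mg; apply: measurableT_comp => //; apply: measurable_funB.
    by apply: measurable_funM.
  by apply: measurable_funD.
apply: measurable_funM; last exact: mj.
by apply: measurable_funM => //; exact: mj.
Qed.

(** A nonzero term needs [2^J x] and [2^J y] both within [S] of the same integer; their integer
    parts then differ by at most [2 S], which leaves [4 S + 1] shifts. *)
Lemma proj_kernel_le x y : `|proj_kernel phi k x y| <=
  B ^+ 2 * S.*2.+1%:R * 2 ^+ J * \sum_(r < (S.*2).*2.+1)
    (dyadic_cell J y == dyadic_cell J x + (r%:R - S.*2%:R))%R%:R.
Proof.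
set c := (X in X <= _).
have [/existsP[r r_]|] := boolP [exists r : 'I_((S.*2).*2.+1),
    dyadic_cell J y == dyadic_cell J x + (r%:R - S.*2%:R)].
  apply: (le_trans (kernel_bound x y)).
  rewrite ler_peMr ?mulr_ge0 ?sqr_ge0 ?(ltW J0)//.
  by rewrite (bigD1 r)//= r_ lerDl sumr_ge0.
rewrite negb_exists => /forallP H.
rewrite /c proj_kernelE big1 ?normr0 => [|r _].
  by rewrite !mulr_ge0 ?sqr_ge0 ?(ltW J0)// sumr_ge0.
set j := dyadic_cell J x + (r%:R - S%:R).
have [Sx|xS] := leP S%:R `|2 ^+ J * x - j|; first by rewrite phi_supp// mulr0 mul0r.
have [Sy|yS] := leP S%:R `|2 ^+ J * y - j|; first by rewrite [phi (_ * y - j)]phi_supp// mulr0.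
exfalso; pose m := Num.floor (2 ^+ J * y) - Num.floor (2 ^+ J * x) + S.*2%:Z.
have fx1 := floor_le (2 ^+ J * x); have fx2 := floorD1_gt (2 ^+ J * x).
have fy1 := floor_le (2 ^+ J * y); have fy2 := floorD1_gt (2 ^+ J * y).
move: xS yS => /ltr_normlP[x1 x2] /ltr_normlP[y1 y2].
have m0 : 0 <= m.
  rewrite -ltzD1 -(ltr_int R) /m -addnn PoszD !rmorphD/= rmorphN/=.
  by move: fx2 fy2; rewrite !rmorphD/=; lra.
have m1 : m < (S.*2).*2.+1%:Z.
  rewrite -(ltr_int R) /m -!addnn -addn1 !PoszD !rmorphD/= rmorphN/=.
  by move: fx2 fy2; rewrite !rmorphD/=; lra.
have mlt : (absz m < (S.*2).*2.+1)%N by lia.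
have := H (Ordinal mlt); rewrite /= => /eqP; apply.
rewrite /dyadic_cell -[(absz m)%:R]/((absz m)%:Z%:~R) gez0_abs// /m.
by rewrite !rmorphD/= rmorphN/=; ring.
Qed.

End Kernel.

(** * Decay of wavelet coefficients *)

Section Tame.
Context (R : realType).
Local Notation mu := (@lebesgue_measure R).
Local Notation Int g := (Rintegral mu [set: R] g).

(** Counterpart of [bmeas] for Lebesgue measure: its total mass being infinite, bounded functions
    are also required to vanish far out. *)
Definition tame (g : R -> R) : Prop :=
  measurable_fun [set: R] g /\ exists B A : R,
    (forall x, `|g x| <= B) /\ (forall x, A <= `|x| -> g x = 0).

Lemma eq_tame g h : g =1 h -> tame g -> tame h.
Proof. by move=> /funext ->. Qed.

Lemma tame0 : tame (fun=> 0).
Proof. by split=> //; exists 0, 0; split=> // x; rewrite normr0. Qed.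

Lemma tameD g h : tame g -> tame h -> tame (fun x => g x + h x).
Proof.
move=> [mg [B [A [gB gA]]]] [mh [C [D [hC hD]]]].
split; first exact: measurable_funD.
exists (B + C), (Num.max A D); split=> x; first by rewrite (le_trans (ler_normD _ _))// lerD.
by rewrite ge_max => /andP[/gA-> /hD->]; rewrite addr0.
Qed.

Lemma tameM_bounded (g h : R -> R) (C : R) : tame g -> measurable_fun [set: R] h ->
  (forall x, `|h x| <= C) -> tame (fun x => g x * h x).
Proof.
move=> [mg [B [A [gB gA]]]] mh hC; split; first exact: measurable_funM.
exists (B * C), A; split=> x; first by rewrite normrM ler_pM.
by move=> /gA ->; rewrite mul0r.
Qed.

Lemma tameM g h : tame g -> tame h -> tame (fun x => g x * h x).
Proof. by move=> tg [mh [C [D [hC _]]]]; exact: tameM_bounded hC. Qed.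

Lemma tameZ g c : tame g -> tame (fun x => c * g x).
Proof.
move=> tg; apply: (@eq_tame (fun x => g x * c)); first by move=> x; rewrite mulrC.
exact: (@tameM_bounded _ (fun=> c) `|c|).
Qed.

Lemma tameB g h : tame g -> tame h -> tame (fun x => g x - h x).
Proof.
move=> tg th; apply: tameD => //.
by apply: (eq_tame _ (tameZ (-1) th)) => x; rewrite mulN1r.
Qed.

Lemma tameX2 g : tame g -> tame (fun x => g x ^+ 2).
Proof. by move=> tg; exact: tameM. Qed.

Lemma tame_norm g : tame g -> tame (fun x => `|g x|).
Proof.
move=> [mg [B [A [gB gA]]]]; split; first exact: measurableT_comp.
by exists B, A; split=> x; [rewrite normr_id|move/gA => ->; rewrite normr0].
Qed.

Lemma tame_sum (I : Type) (s : seq I) (F : I -> R -> R) :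
  (forall i, tame (F i)) -> tame (fun x => \sum_(i <- s) F i x).
Proof.
move=> tF; elim: s => [|i s IH].
  by apply: (eq_tame _ tame0) => x; rewrite big_nil.
by apply: (eq_tame _ (tameD (tF i) IH)) => x; rewrite big_cons.
Qed.

Lemma tame_affine g a c : 0 < a -> tame g -> tame (fun x => g (a * x + c)).
Proof.
move=> a0 [mg [B [A [gB gA]]]]; split.
  apply: measurableT_comp => //; apply: measurable_funD; last exact: measurable_cst.
  exact: mulrl_measurable.
exists B, ((`|A| + `|c|) / a); split=> // x; rewrite ler_pdivrMr// => Ax.
apply: gA; have -> : a * x + c = a * x - (- c) by rewrite opprK.
apply: le_trans (lerB_dist _ _); rewrite normrM normrN gtr0_norm//.
by have := ler_norm A; lra.
Qed.

Lemma tame_integrable g : tame g -> mu.-integrable [set: R] (EFin \o g).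
Proof.
move=> [mg [B [A [gB gA]]]].
have muD : (mu `[(- A)%R, A] < +oo)%E.
  by rewrite lebesgue_measure_itv/=; case: ifP => _; rewrite ltry.
pose D := `[- A, A]%classic : set R.
have gD : EFin \o g = (EFin \o g) \_ D.
  apply/funext => x; rewrite patchE; case: ifPn => //= xD.
  rewrite gA// leNgt; apply: contra xD => /ltr_normlP[x1 x2].
  by rewrite /D mem_setE in_itv/=; apply/andP; split; lra.
have mD : measurable (D : set (measurableTypeR R)) by exact: measurable_itv.
rewrite gD -(integrable_mkcond (mu := mu) (EFin \o g) mD).
apply: measurable_bounded_integrable => //.
- exact: measurable_funTS.
exists B; split; first exact: num_real.
by move=> C BC x _ /=; rewrite (le_trans (gB x))// ltW.
Qed.

Lemma IntD g h : tame g -> tame h -> Int (fun x => g x + h x) = Int g + Int h.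
Proof. by move=> tg th; rewrite RintegralD//; exact: tame_integrable. Qed.

Lemma IntB g h : tame g -> tame h -> Int (fun x => g x - h x) = Int g - Int h.
Proof. by move=> tg th; rewrite RintegralB//; exact: tame_integrable. Qed.

Lemma IntZ g c : tame g -> Int (fun x => c * g x) = c * Int g.
Proof. by move=> tg; rewrite RintegralZl//; exact: tame_integrable. Qed.

Lemma Int0 : Int (fun=> 0) = 0.
Proof. by rewrite /Rintegral integral0. Qed.

Lemma Int_sum (I : Type) (s : seq I) (F : I -> R -> R) :
  (forall i, tame (F i)) ->
  Int (fun x => \sum_(i <- s) F i x) = \sum_(i <- s) Int (F i).
Proof.
move=> tF; elim: s => [|i s IH].
  by rewrite big_nil -[RHS]Int0; congr Rintegral; apply/funext => x; rewrite big_nil.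
rewrite big_cons -IH -IntD//; last exact: tame_sum.
by congr Rintegral; apply/funext => x; rewrite big_cons.
Qed.

Lemma Int_le g h : tame g -> tame h -> (forall x, g x <= h x) -> Int g <= Int h.
Proof. by move=> tg th gh; apply: le_Rintegral => //; exact: tame_integrable. Qed.

Lemma Int_norm g : tame g -> `|Int g| <= Int (fun x => `|g x|).
Proof. by move=> tg; apply: le_normr_Rintegral => //; exact: tame_integrable. Qed.

Section Affine.
Variables (a c : R).
Hypothesis a0 : 0 < a.

Let aff (x : measurableTypeR R) : measurableTypeR R := a * x + c.

Let maff : measurable_fun [set: measurableTypeR R] aff.
Proof. by apply: measurable_funD; [exact: mulrl_measurable|exact: measurable_cst]. Qed.

Let image_measure : {measure set (measurableTypeR R) -> \bar R} :=
  measure_function_pushforward__canonical__measure_function_Measure mu maff.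

Let a_nng : {nonneg R} := NngNum (ltW a0).

(** Lebesgue measure is determined by half-open intervals, and their preimages have length divided
    by [a]. *)
Let lebesgue_affine (A : set (measurableTypeR R)) : measurable A ->
  mu A = mscale a_nng image_measure A.
Proof.
apply: lebesgue_measure_unique => _ [[u v] /= uv <-].
rewrite /mscale/= /pushforward.
have -> : aff @^-1` `]u, v] = [set` `](u - c) / a, (v - c) / a]].
  apply/seteqP; split => x /=; rewrite !in_itv/= ltr_pdivrMr// ler_pdivlMr// /aff.
    by rewrite ltrBlDr lerBrDr [x * a]mulrC.
  by rewrite ltrBlDr lerBrDr [x * a]mulrC.
rewrite !lebesgue_measure_itv/= !lte_fin ltr_pM2r ?invr_gt0// ltrD2r.
case: ifP => _; last by rewrite mule0.
rewrite -!EFinB -EFinM; congr EFin.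
by field; rewrite gt_eqF.
Qed.

Let ge0_Int_affine g : tame g -> (forall x, 0 <= g x) ->
  Int g = a * Int (fun x => g (a * x + c)).
Proof.
move=> tg g0; have [mg _] := tg.
have mgE : measurable_fun [set: measurableTypeR R] (EFin \o g) by exact/measurable_EFinP.
have E : (\int[mu]_x (g x)%:E = a%:E * \int[mu]_x (g (a * x + c)%R)%:E)%E.
  rewrite (eq_measure_integral (mscale a_nng image_measure)); last first.
    by move=> A mA _; exact: lebesgue_affine.
  rewrite ge0_integral_mscale//; last by move=> x _; rewrite lee_fin.
  congr (_ * _)%E.
  by rewrite ge0_integral_pushforward// => x _; rewrite lee_fin.
rewrite /Rintegral E fineM//; apply: integrable_fin_num => //.
exact: (tame_integrable (tame_affine c a0 tg)).
Qed.

(** Difference of the nonnegative cases [g + |g|] and [|g|]. *)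
Lemma Int_affine g : tame g -> Int (fun x => g (a * x + c)) = a^-1 * Int g.
Proof.
move=> tg; have an : a != 0 by rewrite gt_eqF.
have tn := tame_norm tg.
have tgn : tame (fun x => g x + `|g x|) by exact: tameD.
have gn0 x : 0 <= g x + `|g x| by have := ler_norm (- g x); rewrite normrN; lra.
have /= := ge0_Int_affine tgn gn0; rewrite IntD//.
rewrite (IntD (tame_affine c a0 tg) (tame_affine c a0 tn)).
have -> := ge0_Int_affine tn (fun x => normr_ge0 (g x)).
by rewrite mulrDr => /addIr ->; rewrite mulrA mulVf// mul1r.
Qed.

End Affine.

End Tame.

(** * Bessel's inequality and an approximate Parseval identity *)

Section Basis.
Context (R : realType) (I : eqType) (e : I -> R -> R).
Local Notation mu := (@lebesgue_measure R).
Local Notation Int g := (Rintegral mu [set: R] g).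
Hypothesis te : forall a, tame (e a).
Hypothesis ON : forall a b, Int (fun x => e a x * e b x) = (a == b)%:R.

Definition coef (g : R -> R) (a : I) : R := Int (fun x => g x * e a x).

Lemma Int_sqr_sub (g : R -> R) (s : seq I) (c : I -> R) : tame g -> uniq s ->
  Int (fun x => (g x - \sum_(a <- s) c a * e a x) ^+ 2) =
  Int (fun x => g x ^+ 2) - 2 * (\sum_(a <- s) c a * coef g a)
  + \sum_(a <- s) c a ^+ 2.
Proof.
move=> tg us.
have tce a : tame (fun x => c a * e a x) by apply: tameZ.
have tge a : tame (fun x => c a * (g x * e a x)) by apply/tameZ/tameM.
have tee a b : tame (fun x => c a * (c b * (e a x * e b x)))
  by do 2 apply: tameZ; exact: tameM.
pose P x := \sum_(a <- s) c a * (g x * e a x).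
pose Q x := \sum_(a <- s) \sum_(b <- s) c a * (c b * (e a x * e b x)).
have tP : tame P by exact: tame_sum.
have tQ : tame Q by apply: tame_sum => a; exact: tame_sum.
have -> : (fun x => (g x - \sum_(a <- s) c a * e a x) ^+ 2) =
    (fun x => (g x ^+ 2 - 2 * P x) + Q x).
  apply/funext => x; rewrite sqrrB; congr (_ - _ + _).
    rewrite -mulr_natl mulr_sumr; congr (_ * _).
    by apply: eq_bigr => a _; ring.
  rewrite expr2 mulr_suml; apply: eq_bigr => a _; rewrite mulr_sumr.
  by apply: eq_bigr => b _; ring.
rewrite IntD//; last by apply: tameB; [exact: tameX2|exact: tameZ].
rewrite IntB; [|exact: tameX2|exact: tameZ].
rewrite IntZ// Int_sum//; congr (_ - 2 * _ + _).
  by apply: eq_bigr => a _; rewrite IntZ//; exact: tameM.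
rewrite Int_sum => [|a]; last exact: tame_sum.
apply: eq_big_seq => a sa; rewrite Int_sum// (bigD1_seq a)//= big1 ?addr0 => [|b ba].
  by rewrite !IntZ ?ON ?eqxx ?mulr1//; [exact: tameM|apply: tameZ; exact: tameM].
rewrite !IntZ ?ON; [|exact: tameM|by apply: tameZ; exact: tameM].
by rewrite eq_sym (negbTE ba) !mulr0.
Qed.

Lemma bessel (g : R -> R) (s : seq I) : tame g -> uniq s ->
  \sum_(a <- s) coef g a ^+ 2 <= Int (fun x => g x ^+ 2).
Proof.
move=> tg us; have := Int_sqr_sub (coef g) tg us.
have : 0 <= Int (fun x => (g x - \sum_(a <- s) coef g a * e a x) ^+ 2).
  by apply: Rintegral_ge0 => x _; exact: sqr_ge0.
move=> /[swap] ->; under eq_bigr do rewrite -expr2.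
by lra.
Qed.

(** Among combinations of the same functions, the one with coefficients [coef g] is closest to [g];
    an approximant within [eps] therefore bounds the energy that these coefficients miss. *)
Lemma parseval_approx (g : R -> R) (eps : R) : tame g -> 0 < eps ->
  (exists (s : seq I) (c : I -> R),
     ('N[mu]_2%:E[(fun x => (g x - \sum_(a <- s) c a * e a x)%R%:E)] <= eps%:E)%E) ->
  exists2 s : seq I, uniq s &
    Int (fun x => g x ^+ 2) <= \sum_(a <- s) coef g a ^+ 2 + eps ^+ 2.
Proof.
move=> tg eps0 [s [c Ngc]]; exists (undup s); first exact: undup_uniq.
(* A repeated index is merged, its coefficient being multiplied by the multiplicity. *)
pose c' a := c a *+ count_mem a s.
have sE x : \sum_(a <- s) c a * e a x = \sum_(a <- undup s) c' a * e a x.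
  rewrite -big_undup_iterop_count; apply: eq_bigr => a _.
  by rewrite Monoid.iteropE iter_addr_0 /c' mulrnAl.
pose D x := g x - \sum_(a <- undup s) c' a * e a x.
have tD : tame D by apply: tameB => //; apply: tame_sum => a; exact: tameZ.
have : Int (fun x => D x ^+ 2) <= eps ^+ 2.
  have : ('N[mu]_2%:E[(fun x => (D x)%R%:E)] <= eps%:E)%E.
    apply: le_trans Ngc; rewrite le_eqVlt; apply/orP; left; apply/eqP.
    by apply: eq_Lnorm => x; rewrite /D sE.
  move=> /(gt0_ler_poweR (ler0n R 2)); rewrite !in_itv/= !leey !andbT.
  rewrite Lnorm_ge0 lee_fin (ltW eps0) => /(_ isT isT).
  rewrite powR_Lnorm// powR_mulrn ?(ltW eps0)// => H.
  rewrite -lee_fin; apply: le_trans H; rewrite /Rintegral fineK; last first.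
    by apply: integrable_fin_num => //; exact: (tame_integrable (tameX2 tD)).
  rewrite le_eqVlt; apply/orP; left; apply/eqP; apply: eq_integral => x _ /=.
  by rewrite powR_mulrn// real_normK ?num_real.
rewrite /D Int_sqr_sub ?undup_uniq//.
have : 0 <= \sum_(a <- undup s) (c' a - coef g a) ^+ 2.
  by apply: sumr_ge0 => a _; exact: sqr_ge0.
under eq_bigr do rewrite sqrrB -addrA [- _ + _]addrC addrA -mulr_natl.
rewrite !sumrB big_split/= -mulr_sumr.
by lra.
Qed.

End Basis.

Lemma ler_sum_seq_supp (R : realType) (I : eqType) (s t : seq I) (F : I -> R) :
  uniq s -> uniq t -> (forall a, 0 <= F a) ->
  (forall a, a \in s -> a \notin t -> F a = 0) ->
  \sum_(a <- s) F a <= \sum_(a <- t) F a.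
Proof.
move=> us ut F0 st.
rewrite (bigID (mem t))/= [X in _ + X]big_seq_cond [X in _ + X]big1 ?addr0; last first.
  by move=> a /andP[]; exact: st.
rewrite [leRHS](bigID (mem s))/= -[leLHS]addr0 lerD ?sumr_ge0//.
rewrite -big_filter -[leRHS]big_filter le_eqVlt; apply/orP; left; apply/eqP.
apply: perm_big; apply: uniq_perm; rewrite ?filter_uniq// => a.
by rewrite !mem_filter andbC.
Qed.

Lemma sum_ltn_ord (R : realType) (m N : nat) :
  \sum_(r < N) (r < m)%N%:R <= m%:R :> R.
Proof.
suff -> : \sum_(r < N) (r < m)%N%:R = (minn N m)%:R :> R by rewrite ler_nat geq_minr.
elim: N => [|N IH]; first by rewrite big_ord0 min0n.
by rewrite big_ord_recr/= IH -natrD; congr _%:R; lia.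
Qed.

Lemma sum_gtn_ord (R : realType) (L N : nat) :
  \sum_(r < N) (L < r)%N%:R = (N - L.+1)%:R :> R.
Proof.
elim: N => [|N IH]; first by rewrite big_ord0.
by rewrite big_ord_recr/= IH -natrD; congr _%:R; lia.
Qed.

Lemma geometric_sum_le (R : realType) (q : R) (N : nat) : 0 <= q < 1 ->
  \sum_(i < N) q ^+ i <= (1 - q)^-1.
Proof.
move=> /andP[q0 q1]; have q10 : 0 < 1 - q by rewrite subr_gt0.
rewrite -[leRHS]mul1r ler_pdivlMr//.
have := subrX1 q N; have : 0 <= q ^+ N by rewrite exprn_ge0.
by set X := \sum_(_ < N) _; lra.
Qed.

Lemma tame_Lfun (R : realType) (g : R -> R) :
  tame g -> g \in Lfun (@lebesgue_measure R) 2%:E.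
Proof.
move=> tg; have [mg _] := tg; apply/andP; rewrite !inE; split => //=.
rewrite /finite_norm unlock /Lnorm; apply: poweR_lty.
have := integrable_lty measurableT (tame_integrable (tameX2 tg)); apply: le_lt_trans.
rewrite le_eqVlt; apply/orP; left; apply/eqP; apply: eq_integral => x _ /=.
by rewrite powR_mulrn// real_normK ?num_real.
Qed.

(** * Energy lost by projecting a density that is Hölder on [0, 1] *)

Section WaveletBias.
Context (R : realType).
Local Notation mu := (@lebesgue_measure R).
Local Notation Int g := (Rintegral mu [set: R] g).
Variables (phi psi w : R -> R) (S : nat) (M C beta : R).
Hypotheses (tphi : tame phi) (tpsi : tame psi) (tw : tame w).
Hypotheses (phi_supp : forall x, S%:R <= `|x| -> phi x = 0)
  (psi_supp : forall x, S%:R <= `|x| -> psi x = 0).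
Hypothesis basis : L2_orthonormal_basis (wavelet_system phi psi).
Hypothesis psi0 : Int psi = 0.
Hypotheses (w_supp : forall x, ~~ (0 <= x <= 1) -> w x = 0) (wM : forall x, `|w x| <= M).
Hypothesis w_holder : forall x y, 0 <= x <= 1 -> 0 <= y <= 1 ->
  `|w x - w y| <= C * `|x - y| `^ beta.
Hypotheses (C0 : 0 <= C) (M0 : 0 <= M) (beta0 : 0 < beta) (beta1 : beta <= 1 / 2).

Let e := wavelet_system phi psi.

Let P := Int (fun u => `|psi u|).

Let P0 : 0 <= P. Proof. by apply: Rintegral_ge0. Qed.

Lemma tame_wavelet a : tame (e a).
Proof.
case: a => [j|[i j]] /=.
  by apply: (eq_tame _ (tame_affine (- j%:~R) ltr01 tphi)) => x; rewrite mul1r.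
apply: tameZ; have i0 : 0 < 2 ^+ i :> R by rewrite exprn_gt0.
exact: (tame_affine (- j%:~R) i0 tpsi).
Qed.

(** Unnormalised wavelet coefficient of [w] at resolution [l], after the substitution
    [u = 2^l y - j], which moves the scale from [psi] to [w]. *)
Definition detail (l : nat) (j : int) : R :=
  Int (fun u => w ((2 ^+ l)^-1 * u + j%:~R / 2 ^+ l) * psi u).

Definition scaling (J : nat) (j : int) : R :=
  Int (fun y => w y * phi (2 ^+ J * y - j%:~R)).

(** The indices [-S, ..., 2^l + S]; every other translate vanishes on [0, 1]. *)
Definition window (l : nat) : seq int :=
  [seq r%:Z - S%:Z | r <- iota 0 (2 ^ l + S.*2).+1].

Lemma window_uniq l : uniq (window l).
Proof. by rewrite map_inj_uniq ?iota_uniq// => r1 r2 /addIr []. Qed.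

Let pow_gt0 l : 0 < 2 ^+ l :> R. Proof. by rewrite exprn_gt0. Qed.

Lemma notin_window l j y : j \notin window l -> 0 <= y <= 1 ->
  S%:R <= `|2 ^+ l * y - j%:~R| :> R.
Proof.
move=> jw /andP[y0 y1]; rewrite leNgt; apply: contra jw => /ltr_normlP[h1 h2].
have ly0 : 0 <= 2 ^+ l * y by rewrite mulr_ge0// ltW.
have ly1 : 2 ^+ l * y <= 2 ^+ l by rewrite ler_piMr// ltW.
have j0 : 0 <= j + S%:Z.
  by rewrite -ltzD1 -(ltr_int R) !rmorphD/=; lra.
have j1 : j + S%:Z < (2 ^ l + S.*2).+1%:Z.
  rewrite -(ltr_int R) -addnn -addn1 !PoszD !rmorphD/=.
  by rewrite -[(2 ^ l)%:Z%:~R]/((2 ^ l)%:R) natrX; lra.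
apply/mapP; exists (absz (j + S%:Z)); last by clear -j0 j1; lia.
by rewrite mem_iota/=; clear -j0 j1; lia.
Qed.

Lemma detail_window l j : j \notin window l -> detail l j = 0.
Proof.
move=> jw; rewrite -[RHS](Int0 R); congr Rintegral; apply/funext => u.
set y := _ + _; have [y01|/w_supp ->] := boolP (0 <= y <= 1); last by rewrite mul0r.
rewrite psi_supp ?mulr0//.
have := notin_window jw y01; rewrite /y; congr (_ <= `|_|).
by field; rewrite gt_eqF.
Qed.

Lemma scaling_window J j : j \notin window J -> scaling J j = 0.
Proof.
move=> jw; rewrite -[RHS](Int0 R); congr Rintegral; apply/funext => y.
have [y01|/w_supp ->] := boolP (0 <= y <= 1); last by rewrite mul0r.
by rewrite phi_supp ?mulr0// notin_window.
Qed.

Let tame_w_affine l (j : int) : tame (fun u => w ((2 ^+ l)^-1 * u + j%:~R / 2 ^+ l)).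
Proof. by apply: tame_affine => //; rewrite invr_gt0. Qed.

Lemma detail_le l j : `|detail l j| <= M * P.
Proof.
apply: (le_trans (Int_norm (tameM (tame_w_affine l j) tpsi))).
rewrite -IntZ; last exact: tame_norm.
apply: Int_le => [||u]; first by apply/tame_norm/tameM.
  by apply/tameZ/tame_norm.
by rewrite normrM ler_wpM2r.
Qed.

(** For [j] between [S] and [2^l - S] the wavelet lives inside [0, 1]. Since [psi] has integral 0,
    the value of [w] at the centre may be subtracted, and the Hölder condition applies at distance
    at most [S / 2^l]. *)
Lemma detail_interior_le l (r : nat) : (S.*2 <= r <= 2 ^ l)%N ->
  `|detail l (r%:Z - S%:Z)| <= C * (S%:R / 2 ^+ l) `^ beta * P.
Proof.
move=> /andP[r1 r2]; set j := _ - _.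
have jR : j%:~R = r%:R - S%:R :> R by rewrite /j rmorphB.
have r1R : S%:R + S%:R <= r%:R :> R by rewrite -natrD ler_nat addnn.
have r2R : r%:R <= 2 ^+ l :> R by rewrite -natrX ler_nat.
pose y (u : R) := (2 ^+ l)^-1 * u + j%:~R / 2 ^+ l.
have y01 (u : R) : `|u| < S%:R -> 0 <= y u <= 1.
  move=> /ltr_normlP[u1 u2]; rewrite /y mulrC -mulrDl jR.
  rewrite divr_ge0 ?(ltW (pow_gt0 l))//=; last by lra.
  by rewrite ler_pdivrMr// mul1r; lra.
have y0 : 0 <= y 0 <= 1.
  rewrite /y mulr0 add0r jR divr_ge0 ?(ltW (pow_gt0 l))//=; last by have := ler0n R S; lra.
  by rewrite ler_pdivrMr// mul1r; have := ler0n R S; lra.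
have -> : detail l j = Int (fun u => (w (y u) - w (y 0)) * psi u).
  have tz : tame (fun u => w (y 0) * psi u) by exact: tameZ.
  have ty : tame (fun u => w (y u) * psi u) by apply: tameM => //; exact: tame_w_affine.
  rewrite (_ : (fun u => _ * _) = (fun u => w (y u) * psi u - w (y 0) * psi u)).
    by rewrite IntB// IntZ// psi0 mulr0 subr0.
  by apply/funext => u; rewrite mulrBl.
have ty : tame (fun u => (w (y u) - w (y 0)) * psi u).
  have tz : tame (fun u => w (y 0) * psi u) by exact: tameZ.
  have tyu : tame (fun u => w (y u) * psi u) by apply: tameM => //; exact: tame_w_affine.
  by apply: (eq_tame _ (tameB tyu tz)) => u; rewrite mulrBl.
apply: (le_trans (Int_norm ty)).
rewrite -IntZ; last exact: tame_norm.
apply: Int_le => [||u]; first exact: tame_norm.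
  by apply/tameZ/tame_norm.
rewrite normrM; have [Su|uS] := leP S%:R `|u|.
  by rewrite psi_supp// normr0 !mulr0.
rewrite ler_wpM2r// (le_trans (w_holder (y01 u uS) y0))// ler_wpM2l//.
apply: ge0_ler_powR; rewrite ?nnegrE ?(ltW beta0)//.
rewrite /y mulr0 add0r addrK normrM gtr0_norm ?invr_gt0// [leRHS]mulrC.
by rewrite ler_wpM2l ?invr_ge0 ?(ltW (pow_gt0 l))// ltW.
Qed.

(** Factor by which squared interior coefficients shrink from one resolution to the next. *)
Let q := 2 `^ (- (2 * beta)) : R.

Let q0 : 0 < q. Proof. by rewrite powR_gt0. Qed.

Let q_lt1 : q < 1.
Proof.
rewrite /q powRN invf_lt1 ?powR_gt0//.
apply: (@le_lt_trans _ _ (1 `^ (2 * beta))); first by rewrite powR1.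
by apply: gt0_ltr_powR; rewrite ?nnegrE ?mulr_gt0 ?ltr1n.
Qed.

Let qge : 1 <= 2 * q.
Proof.
rewrite -ler_pdivrMl// mulr1 -[leLHS]powR_inv1// /q ler_powR ?ler1n//.
by rewrite lerN2 mulrC -ler_pdivlMr.
Qed.

Let powE l : ((2 ^+ l)^-1 `^ beta) ^+ 2 = q ^+ l.
Proof.
rewrite -powR_invn// -powRrM -powR_mulrn ?powR_ge0// -powRrM.
by rewrite -[RHS]powR_mulrn ?powR_ge0// -powRrM; congr (_ `^ _); ring.
Qed.

(* At every resolution, boundedly many wavelets straddle 0 or 1, where [w] may
   jump; they contribute [(M * P) ^+ 2] each, which is within the rate since
   [beta <= 1 / 2]. *)
Definition detail_const : R :=
  (S.*2.+2)%:R * (C * S%:R `^ beta * P) ^+ 2 + (S.*2.*2)%:R * (M * P) ^+ 2.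

Lemma detail_sum_le l :
  \sum_(j <- window l) detail l j ^+ 2 <= detail_const * (2 * q) ^+ l.
Proof.
have ge1 : 1 <= 2 ^+ l * q ^+ l by rewrite -exprMn exprn_ege1.
pose c1 := (C * S%:R `^ beta * P) ^+ 2; pose c2 := (M * P) ^+ 2.
have c10 : 0 <= c1 by exact: sqr_ge0.
have c20 : 0 <= c2 by exact: sqr_ge0.
rewrite /window big_map -/(index_iota 0 (2 ^ l + S.*2).+1) big_mkord.
(* The two indicators mark the translates that may reach beyond 0 and beyond 1. *)
apply: (@le_trans _ _ (\sum_(r < (2 ^ l + S.*2).+1)
    (c1 * q ^+ l + c2 * ((r < S.*2)%N%:R + (2 ^ l < r)%N%:R)))).
  apply: ler_sum => r _.
  have bnd2 : detail l (r%:Z - S%:Z) ^+ 2 <= c2.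
    rewrite -real_normK ?num_real// ler_sqr ?nnegrE ?mulr_ge0//.
    exact: detail_le.
  have c1q : 0 <= c1 * q ^+ l by rewrite mulr_ge0// exprn_ge0// ltW.
  case: (ltnP r S.*2) => r1.
    by rewrite (le_trans bnd2)// mulrDr mulr1 addrCA lerDl addr_ge0// mulr_ge0.
  case: (ltnP (2 ^ l) r) => r2; first by rewrite add0r mulr1 (le_trans bnd2)// lerDr.
  rewrite addr0 mulr0 addr0 -powE -exprMn -real_normK ?num_real//.
  have dl : `|detail l (r%:Z - S%:Z)| <= C * (S%:R / 2 ^+ l) `^ beta * P.
    by apply: detail_interior_le; rewrite r1 r2.
  rewrite ler_sqr ?nnegrE//; last by rewrite !mulr_ge0 ?powR_ge0.
  apply: (le_trans dl); rewrite powRM// ?invr_ge0 ?(ltW (pow_gt0 l))//.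
  by rewrite le_eqVlt; apply/orP; left; apply/eqP; ring.
rewrite big_split/= sumr_const card_ord -[(_ * _) *+ _]mulr_natl -mulr_sumr big_split/=.
rewrite sum_gtn_ord.
have := sum_ltn_ord R S.*2 (2 ^ l + S.*2).+1.
have -> : ((2 ^ l + S.*2).+1 - (2 ^ l).+1)%N = S.*2 by rewrite subSS addKn.
set X := \sum_(_ < _) _ => XS.
apply: (@le_trans _ _ ((2 ^ l + S.*2).+1%:R * (c1 * q ^+ l) + c2 * (S.*2%:R + S.*2%:R))).
  by rewrite lerD2l ler_wpM2l// lerD2r.
rewrite /detail_const -/c1 -/c2 exprMn mulrDl.
have N0 : (2 ^ l + S.*2).+1%:R <= S.*2.+2%:R * 2 ^+ l :> R.
  rewrite -natrX -natrM ler_nat; have : (0 < 2 ^ l)%N by rewrite expn_gt0.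
  by clear; nia.
apply: lerD.
  rewrite [leRHS](_ : _ = S.*2.+2%:R * 2 ^+ l * (c1 * q ^+ l)); last by ring.
  by rewrite ler_wpM2r// mulr_ge0// exprn_ge0// ltW.
rewrite -natrD addnn [_ * c2]mulrC.
by rewrite ler_peMr// mulr_ge0.
Qed.

Variable J : nat.

(* The basis starts at resolution 0: stretching [w] by [2 ^+ J] turns the
   projection at resolution [J] into the projection on the translates of [phi]. *)
Let gJ (x : R) := w ((2 ^+ J)^-1 * x).

Let tgJ : tame gJ.
Proof.
have J0 : 0 < (2 ^+ J)^-1 :> R by rewrite invr_gt0.
by apply: (eq_tame _ (tame_affine 0 J0 tw)) => x; rewrite addr0.
Qed.

Lemma coef_scaling j : coef e gJ (inl j) = 2 ^+ J * scaling J j.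
Proof.
have J0 : 0 < (2 ^+ J)^-1 :> R by rewrite invr_gt0.
have th : tame (fun y => w y * phi (2 ^+ J * y - j%:~R)).
  apply: tameM => //; exact: (tame_affine (- j%:~R) (pow_gt0 J) tphi).
rewrite /scaling -[X in X * _](invrK (2 ^+ J)) -(Int_affine 0 J0 th).
congr Rintegral; apply/funext => x; rewrite addr0 /gJ /=; congr (_ * phi (_ - _)).
by rewrite mulrA divff ?mul1r// gt_eqF.
Qed.

(** Resolution [i] for the stretched function is resolution [i + J] for [w]. *)
Lemma coef_detail i j : coef e gJ (inr (i, j)) ^+ 2 =
  (2 ^+ i)^-1 * detail (i + J) j ^+ 2.
Proof.
pose h (u : R) := w ((2 ^+ (i + J))^-1 * u + j%:~R / 2 ^+ (i + J)) * psi u.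
have th : tame h by apply: tameM => //; exact: tame_w_affine.
have i0 : 2 ^+ i != 0 :> R by rewrite gt_eqF.
have J0 : 2 ^+ J != 0 :> R by rewrite gt_eqF.
have -> : coef e gJ (inr (i, j)) = Num.sqrt (2 ^+ i) * ((2 ^+ i)^-1 * detail (i + J) j).
  rewrite -(Int_affine (- j%:~R) (pow_gt0 i) th) -IntZ; last first.
    exact: (tame_affine (- j%:~R) (pow_gt0 i) th).
  congr Rintegral; apply/funext => x; rewrite /gJ /h /= mulrCA; congr (_ * (w _ * _)).
  by rewrite exprD; field; rewrite ?i0 ?J0.
rewrite exprMn sqr_sqrtr; last by rewrite ltW.
by rewrite exprMn; field.
Qed.

Let sqr_gJ : Int (fun x => gJ x ^+ 2) = 2 ^+ J * Int (fun x => w x ^+ 2).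
Proof.
have J0 : 0 < (2 ^+ J)^-1 :> R by rewrite invr_gt0.
have := Int_affine 0 J0 (tameX2 tw); rewrite invrK => <-.
by congr Rintegral; apply/funext => x; rewrite addr0.
Qed.

Let onb : forall a b, Int (fun x => e a x * e b x) = (a == b)%:R.
Proof. by case: basis. Qed.

Let sum_scaling : \sum_(a <- map inl (window J)) coef e gJ a ^+ 2 =
  2 ^+ J * \sum_(j <- window J) 2 ^+ J * scaling J j ^+ 2.
Proof.
rewrite big_map mulr_sumr; apply: eq_bigr => j _.
by rewrite coef_scaling; ring.
Qed.

(** Bessel's inequality for the translates of [phi] alone; the stretching factor [2 ^+ J]
    cancels. *)
Lemma scaling_energy_le :
  \sum_(j <- window J) 2 ^+ J * scaling J j ^+ 2 <= Int (fun x => w x ^+ 2).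
Proof.
rewrite -(ler_pM2l (pow_gt0 J)) -sqr_gJ -sum_scaling.
apply: (bessel tame_wavelet onb tgJ).
by rewrite map_inj_uniq ?window_uniq// => j1 j2 [].
Qed.

(** The level sums grow like [(2 * q) ^+ i]; the normalisation [2 ^- i] leaves a geometric series of
    ratio [q < 1]. *)
Let sum_details (N : nat) :
  \sum_(i < N) (2 ^+ i)^-1 * \sum_(j <- window (i + J)) detail (i + J) j ^+ 2 <=
  2 ^+ J * (detail_const / (1 - q) * q ^+ J).
Proof.
have dc0 : 0 <= detail_const.
  by rewrite addr_ge0// mulr_ge0// sqr_ge0.
apply: (@le_trans _ _ (\sum_(i < N) detail_const * (2 * q) ^+ J * q ^+ i)).
  apply: ler_sum => i _; rewrite ler_pdivrMl//.
  apply: (le_trans (detail_sum_le _)).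
  rewrite le_eqVlt; apply/orP; left; apply/eqP.
  by rewrite exprD !exprMn; ring.
rewrite -mulr_sumr.
have := geometric_sum_le N (q := q); rewrite (ltW q0) q_lt1 => /(_ isT) g.
rewrite [leRHS](_ : _ = detail_const * (2 * q) ^+ J * (1 - q)^-1); last first.
  by rewrite exprMn; ring.
by rewrite ler_wpM2l// mulr_ge0// exprn_ge0// mulr_ge0// ltW.
Qed.

(** Parseval up to [eps]: the energy not carried by the scaling functions is carried by details at
    resolution [J] and finer. *)
Lemma scaling_energy_ge :
  Int (fun x => w x ^+ 2) <= \sum_(j <- window J) 2 ^+ J * scaling J j ^+ 2
    + detail_const / (1 - q) * q ^+ J.
Proof.
apply/ler_addgt0Pr => eps eps0.
rewrite -(ler_pM2l (pow_gt0 J)) -sqr_gJ !mulrDr -sum_scaling.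
have [_ _ dense] := basis.
have eps'0 : 0 < Num.sqrt eps by rewrite sqrtr_gt0.
have [s us] := parseval_approx tame_wavelet onb tgJ eps'0
  (dense _ _ (tame_Lfun tgJ) eps'0).
rewrite sqr_sqrtr ?(ltW eps0)// => /le_trans; apply.
apply: lerD; last by rewrite ler_peMl ?(ltW eps0)// exprn_ege1// ler1n.
pose lev (a : wavelet_index) := if a is inr (i, _) then i else 0%N.
pose N := (\max_(a <- s) lev a).+1.
(* The approximating set [s] is replaced by full windows at all levels up to its highest; indices of
   [s] left out have coefficient 0. *)
pose t : seq wavelet_index := map inl (window J) ++
  [seq inr (i, j) | i <- iota 0 N, j <- window (i + J)].
apply: (@le_trans _ _ (\sum_(a <- t) coef e gJ a ^+ 2)).
  apply: ler_sum_seq_supp => //.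
  - rewrite cat_uniq; apply/and3P; split.
    + by rewrite map_inj_uniq ?window_uniq// => j1 j2 [].
    + apply/hasPn => a /allpairsPdep[i [j [_ _ ->]]].
      by apply/mapP => -[].
    apply: allpairs_uniq_dep; first exact: iota_uniq.
      by move=> i _; exact: window_uniq.
    by move=> [i1 j1] [i2 j2] _ _ /= [-> ->].
  - by move=> a; exact: sqr_ge0.
  move=> [j|[i j]] sa; rewrite mem_cat negb_or => /andP[nl nr].
    rewrite coef_scaling scaling_window ?mulr0 ?expr0n//.
    by apply: contra nl => jw; apply/mapP; exists j.
  rewrite coef_detail detail_window ?expr0n ?mulr0//.
  apply: contra nr => jw; apply/allpairsPdep; exists i, j; split=> //.
  rewrite mem_iota/= add0n ltnS.
  exact: (@leq_bigmax_seq _ s xpredT lev (inr (i, j))).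
rewrite big_cat lerD2l big_allpairs_dep.
rewrite -/(index_iota 0 N) big_mkord; apply: le_trans (sum_details N).
apply: ler_sum => i _; rewrite mulr_sumr; apply: ler_sum => j _.
by rewrite coef_detail.
Qed.

End WaveletBias.

(** * The adaptive estimator *)

Section Adaptive.
Context (R : realType) d (T : measurableType d) (Q : probability T R).
Variables (U0 U1 Us : T -> R) (theta0 theta1 thetas Phi tau V0 V1 Vs : R).
Hypotheses (b0 : bmeas U0) (b1 : bmeas U1) (bs : bmeas Us).
Hypotheses (v0 : Ex Q (fun x => (U0 x - theta0) ^+ 2) <= V0)
  (v1 : Ex Q (fun x => (U1 x - theta1) ^+ 2) <= V1)
  (vs : Ex Q (fun x => (Us x - thetas) ^+ 2) <= Vs).
Hypotheses (bias0 : theta0 <= Phi) (biass : thetas <= Phi) (tau0 : 0 <= tau).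

Definition lepski (x : T) : R := if tau < Us x - U0 x then U1 x else U0 x.

Lemma bmeas_lepski : bmeas lepski.
Proof.
have bd : bmeas (fun x => (tau < Us x - U0 x)%R%:R : R).
  apply: bmeas_bool; apply: measurable_fun_ltr => //.
  by apply: measurable_funB; [case: bs|case: b0].
apply: (@eq_bmeas _ _ _ (fun x => (tau < Us x - U0 x)%R%:R * (U1 x - U0 x) + U0 x)).
  by move=> x; rewrite /lepski; case: ifP => _; rewrite ?mul1r ?mul0r ?add0r ?subrK.
by apply: bmeasD => //; apply: bmeasM => //; exact: bmeasB.
Qed.

Let bmeas_dist (U : T -> R) c : bmeas U -> bmeas (fun x => (U x - c) ^+ 2).
Proof. by move=> bU; apply: bmeasX; apply: bmeasB => //; exact: bmeas_cst. Qed.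

Let bmeasZ c (F : T -> R) : bmeas F -> bmeas (fun x => c * F x).
Proof. by move=> bF; apply: bmeasM => //; exact: bmeas_cst. Qed.

(* When the coarse estimator is kept, its bias is at most
   [tau + |Us - thetas| + |U0 - theta0| + (Phi - thetas)]. *)
Lemma lepski_risk_rough : Ex Q (fun x => (lepski x - Phi) ^+ 2) <=
  2 * V1 + 10 * V0 + 8 * Vs
  + (2 * (Phi - theta1) ^+ 2 + 8 * (tau ^+ 2 + (Phi - thetas) ^+ 2)).
Proof.
set c := 2 * (Phi - theta1) ^+ 2 + _.
have d0 := bmeas_dist theta0 b0; have d1 := bmeas_dist theta1 b1.
have ds := bmeas_dist thetas bs.
apply: (@le_trans _ _ (Ex Q (fun x => 2 * (U1 x - theta1) ^+ 2 +
    10 * (U0 x - theta0) ^+ 2 + 8 * (Us x - thetas) ^+ 2 + c))).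
  apply: Ex_le => [||x]; first exact/bmeas_dist/bmeas_lepski.
    by do 3 (apply: bmeasD; last by [exact: bmeasZ|exact: bmeas_cst]); exact: bmeasZ.
  have s2 (u v : R) : (u + v) ^+ 2 <= 2 * u ^+ 2 + 2 * v ^+ 2.
    by have := sqr_ge0 (u - v); rewrite !expr2; lra.
  have := sqr_ge0 (U1 x - theta1); have := sqr_ge0 (U0 x - theta0).
  have := sqr_ge0 (Us x - thetas); have := sqr_ge0 (Phi - theta1).
  have := sqr_ge0 tau; have := sqr_ge0 (Phi - thetas).
  rewrite /lepski /c; case: (ltrP tau) => dec.
    have := s2 (U1 x - theta1) (theta1 - Phi).
    rewrite addrA subrK -[(theta1 - Phi) ^+ 2]sqrrN opprB.
    by lra.
  have bb : (Phi - theta0) ^+ 2 <= 4 * (tau ^+ 2 + (Us x - thetas) ^+ 2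
      + (U0 x - theta0) ^+ 2 + (Phi - thetas) ^+ 2).
    set p := Us x - thetas; set r := U0 x - theta0; set s := Phi - thetas.
    have le1 : Phi - theta0 <= tau + (- p) + r + s by rewrite /p /r /s; lra.
    have le2 : 0 <= Phi - theta0 by rewrite subr_ge0.
    apply: (@le_trans _ _ ((tau - p + r + s) ^+ 2)).
      by rewrite ler_sqr ?nnegrE// (le_trans le2).
    have := s2 (tau - p) (r + s); rewrite addrA.
    have := s2 tau (- p); have := s2 r s; rewrite sqrrN.
    by lra.
  have := s2 (U0 x - theta0) (theta0 - Phi).
  rewrite addrA subrK -[(theta0 - Phi) ^+ 2]sqrrN opprB.
  by lra.
rewrite ExD; [|by do 2 (apply: bmeasD; last exact: bmeasZ); exact: bmeasZ|exact: bmeas_cst].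
rewrite ExD; [|by apply: bmeasD; exact: bmeasZ|exact: bmeasZ].
rewrite ExD; [|exact: bmeasZ|exact: bmeasZ].
by rewrite Ex_cst !ExZl// lerD2r; have := v0; have := v1; have := vs; lra.
Qed.

(** Split [Us - U0] as [(Us - thetas) + (thetas - theta0) + (theta0 - U0)]. The middle term is at
    most [Phi - theta0 <= tau / 3], so a test exceeding [tau] forces one of the other two above
    [tau / 3]; on that event the loss is bounded by [G ^+ 2]. *)
Lemma lepski_risk_smooth (G : R) : 3 * (Phi - theta0) <= tau ->
  (forall x, `|U1 x - Phi| <= G) ->
  Ex Q (fun x => (lepski x - Phi) ^+ 2) <=
  2 * V0 + 2 * (Phi - theta0) ^+ 2 +
  G ^+ 2 * (Ex Q (fun x => (tau / 3 < Us x - thetas)%R%:R) +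
            Ex Q (fun x => (tau / 3 < theta0 - U0 x)%R%:R)).
Proof.
move=> b3 UG; have hs := biass.
have d0 := bmeas_dist theta0 b0.
have t1 : bmeas (fun x => (tau / 3 < Us x - thetas)%R%:R : R).
  apply: bmeas_bool; apply: measurable_fun_ltr => //.
  by apply: measurable_funB => //; case: bs.
have t2 : bmeas (fun x => (tau / 3 < theta0 - U0 x)%R%:R : R).
  apply: bmeas_bool; apply: measurable_fun_ltr => //.
  by apply: measurable_funB => //; case: b0.
apply: (@le_trans _ _ (Ex Q (fun x => (2 * (U0 x - theta0) ^+ 2 +
    2 * (Phi - theta0) ^+ 2) + G ^+ 2 * ((tau / 3 < Us x - thetas)%R%:R +
    (tau / 3 < theta0 - U0 x)%R%:R)))).
  apply: Ex_le => [||x]; first exact/bmeas_dist/bmeas_lepski.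
    apply: bmeasD; last by apply: bmeasZ; exact: bmeasD.
    by apply: bmeasD; [exact: bmeasZ|exact: bmeas_cst].
  rewrite /lepski; case: (ltrP tau) => dec.
    have : (U1 x - Phi) ^+ 2 <= G ^+ 2.
      rewrite -real_normK ?num_real// ler_sqr ?nnegrE//.
      exact: le_trans (normr_ge0 _) (UG x).
    have := sqr_ge0 (U0 x - theta0); have := sqr_ge0 (Phi - theta0).
    have := sqr_ge0 G.
    case: (ltrP (tau / 3) (Us x - thetas)) => h1;
      case: (ltrP (tau / 3) (theta0 - U0 x)) => h2 //=; try lra.
  have : 0 <= G ^+ 2 * ((tau / 3 < Us x - thetas)%R%:R + (tau / 3 < theta0 - U0 x)%R%:R).
    by rewrite mulr_ge0 ?sqr_ge0// addr_ge0.
  have := sqr_ge0 (U0 x - theta0 - (theta0 - Phi)); rewrite !expr2.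
  by lra.
rewrite ExD; last 2 first.
- by apply: bmeasD; [exact: bmeasZ|exact: bmeas_cst].
- by apply: bmeasZ; exact: bmeasD.
rewrite ExD; [|exact: bmeasZ|exact: bmeas_cst].
rewrite Ex_cst !ExZl//; last exact: bmeasD.
by rewrite ExD// lerD2r lerD2r ler_wpM2l.
Qed.

End Adaptive.

Section KernelMean.
Context (R : realType) (rho : probability R R) (phi w : R -> R) (S k : nat).
Local Notation mu := (@lebesgue_measure R).
Let J := up_log 2 k.
Hypotheses (tphi : tame phi) (tw : tame w) (w0 : forall x, 0 <= w x).
Hypotheses (phi_supp : forall x, S%:R <= `|x| -> phi x = 0).
Hypotheses (w_supp : forall x, ~~ (0 <= x <= 1) -> w x = 0).
Hypothesis rhoE : forall A, measurable A -> rho A = (\int[mu]_(x in A) (w x)%:E)%E.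
Hypothesis bK : bmeas (fun p : R * R => proj_kernel phi k p.1 p.2).

(** The kernel is a sum over [j] of products of a function of [y] and the same function of [z], so
    its mean is a sum of squares: the energy of the projected density. *)
Lemma hmean_proj_kernel : hmean rho (proj_kernel phi k) =
  \sum_(j <- window S J) 2 ^+ J * scaling phi w J j ^+ 2.
Proof.
have mw : measurable_fun [set: R] w by case: tw.
have ExE (g : R -> R) : bmeas g -> Ex rho g = \int[mu]_x (g x * w x).
  exact: (Ex_density rhoE w0 mw).
have tphiJ j : tame (fun y => w y * phi (2 ^+ J * y - j%:~R)).
  apply: tameM => //; apply: (tame_affine (- j%:~R) _ tphi).
  by rewrite exprn_gt0.
(* For [y] in [0, 1] one window serves all [y], so that sums and integrals can be exchanged;
   elsewhere [w] vanishes. *)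
have KE y z : 0 <= y <= 1 -> proj_kernel phi k y z =
    \sum_(j <- window S J) 2 ^+ J * phi (2 ^+ J * y - j%:~R) * phi (2 ^+ J * z - j%:~R).
  move=> y01; rewrite /proj_kernel -/J; apply: fsum_int_seq; first exact: window_uniq.
  by move=> j jw; rewrite phi_supp ?mulr0 ?mul0r// notin_window.
have margE y : 0 <= y <= 1 -> marg rho (proj_kernel phi k) y =
    \sum_(j <- window S J) 2 ^+ J * phi (2 ^+ J * y - j%:~R) * scaling phi w J j.
  move=> y01; rewrite /marg ExE; last exact: (bmeas_pair1 y bK).
  rewrite (_ : (fun _ => _) = (fun z => \sum_(j <- window S J)
      2 ^+ J * phi (2 ^+ J * y - j%:~R) * (w z * phi (2 ^+ J * z - j%:~R)))).
    rewrite Int_sum => [|j]; last exact: tameZ.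
    by apply: eq_bigr => j _; rewrite IntZ.
  apply/funext => z; rewrite KE// mulr_suml; apply: eq_bigr => j _; ring.
rewrite /hmean ExE; last exact: (bmeas_marg _ bK).
rewrite (_ : (fun _ => _) = (fun y => \sum_(j <- window S J)
    2 ^+ J * scaling phi w J j * (w y * phi (2 ^+ J * y - j%:~R)))).
  rewrite Int_sum => [|j]; last exact: tameZ.
  by apply: eq_bigr => j _; rewrite IntZ// -/(scaling phi w J j); ring.
apply/funext => y; have [y01|/w_supp wy] := boolP (0 <= y <= 1).
  by rewrite margE// mulr_suml; apply: eq_bigr => j _; ring.
by rewrite wy mulr0 big1// => j _; rewrite mul0r mulr0.
Qed.

End KernelMean.

(** This and [linear_const] weight the two parts of the conditional variances: pairs with earlier
    points, and averaged pairs with later ones. *)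
Definition pair_const (R : realType) (b : R) (r0 : nat) (M : R) : R :=
  2 * b ^+ 2 * r0%:R ^+ 2 * M.

Definition linear_const (R : realType) (b : R) (r0 : nat) (M : R) : R :=
  2 * (b * r0%:R * M) ^+ 2.

Definition variance_bound (R : realType) (b : R) (r0 : nat) (M : R) (n : nat)
    (kk : R) : R :=
  16 * (pair_const b r0 M * kk / n%:R ^+ 2 +
        (pair_const b r0 M * M + linear_const b r0 M) / n%:R).

(** In order: a deviation on good samples, too many same-cell pairs, an overfull cell. *)
Definition tail_bound (R : realType) (b : R) (r0 : nat) (M : R) (n : nat) (kk : R)
    (m : nat) (lambda zeta t : R) : R :=
  expR (n%:R * lambda ^+ 2 * (pair_const b r0 M * kk * n%:R *+ 4
          + linear_const b r0 M * n%:R ^+ 2 *+ 2) - lambda * (t * n%:R ^+ 2 / 4)) +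
  expR (n%:R ^+ 2 * expR (2 * m%:R) * (M / kk) - n%:R) +
  n%:R * expR (n%:R * expR zeta * (M / kk) - zeta * m%:R).

Lemma powR_expn (R : realType) (a s : R) (l : nat) : 0 <= a ->
  (a ^+ l) `^ s = (a `^ s) ^+ l.
Proof. by move=> a0; rewrite -(powR_mulrn l a0) powRAC powR_mulrn ?powR_ge0. Qed.

(** * Bias, variance and tails under a density of the class *)

Section Model.
Context (R : realType) (phi psi : R -> R).
Local Notation mu := (@lebesgue_measure R).
Variables (B : R) (S : nat).
Hypothesis B0 : 0 <= B.
Hypotheses (tphi : tame phi) (tpsi : tame psi) (phi_le : forall x, `|phi x| <= B).
Hypotheses (phi_supp : forall x, S%:R <= `|x| -> phi x = 0)
  (psi_supp : forall x, S%:R <= `|x| -> psi x = 0).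
Hypothesis basis : L2_orthonormal_basis (wavelet_system phi psi).
Hypothesis psi0 : \int[mu]_x psi x = 0.
Variables (f : R -> R) (C Mlow M beta : R).
Hypotheses (C0 : 0 <= C) (M0 : 0 <= M) (beta0 : 0 < beta) (beta1 : beta <= 1 / 2).
Hypothesis ff : density_class C Mlow M beta f.

Let b := B ^+ 2 * S.*2.+1%:R.
Let r0 := (S.*2).*2.+1.
Let w := ext01 f.

Let in01 (x : R) : 0 <= x <= 1 -> x \in `[0, 1].
Proof. by rewrite in_itv. Qed.

Let w_ge0 x : 0 <= w x.
Proof.
rewrite /w /ext01; case: ifPn => // /in01 x01.
by have [[_ + _] _ _] := ff; exact.
Qed.

Let w_leM x : w x <= M.
Proof.
rewrite /w /ext01; case: ifPn => // /in01 x01.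
by have [_ _ /(_ x x01)/andP[]] := ff.
Qed.

Let w_norm x : `|w x| <= M. Proof. by rewrite ger0_norm. Qed.

Let w_supp x : ~~ (0 <= x <= 1) -> w x = 0.
Proof. by rewrite /w /ext01 => /negbTE ->. Qed.

Let mw : measurable_fun [set: R] w.
Proof. by apply: measurable_ext01; have [[]] := ff. Qed.

Let tw : tame w.
Proof.
split=> //; exists M, 2; split=> // x x2; apply: w_supp.
apply: contraTN x2 => /andP[x0 x1]; rewrite -ltNge ger0_norm//.
by rewrite (le_lt_trans x1)// ltr1n.
Qed.

Let w_holder x y : 0 <= x <= 1 -> 0 <= y <= 1 ->
  `|w x - w y| <= C * `|x - y| `^ beta.
Proof.
move=> x01 y01; rewrite /w /ext01 x01 y01.
by have [_ [_ +] _] := ff; apply; exact: in01.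
Qed.

Let quadE : quad_functional f = \int[mu]_x (w x ^+ 2).
Proof.
rewrite /quad_functional Rintegral_mkcond; congr Rintegral; apply/funext => x.
rewrite patchE /w /ext01 mem_setE in_itv/=; case: ifP => // _.
by rewrite expr0n.
Qed.

Lemma quad_functional_ge0_le : 0 <= quad_functional f <= M.
Proof.
rewrite quadE; apply/andP; split.
  by apply: Rintegral_ge0 => x _; exact: sqr_ge0.
have w1 : \int[mu]_x w x = 1.
  rewrite /Rintegral (_ : (\int[mu]_x (w x)%:E)%E = 1%E)//.
  have [[_ _ <-] _ _] := ff; rewrite [RHS]integral_mkcond; apply: eq_integral => x _.
  by rewrite patchE /w /ext01 mem_setE in_itv/=; case: ifP.
apply: (@le_trans _ _ (\int[mu]_x (M * w x))).
  apply: Int_le => [||x]; [exact: tameX2|exact: tameZ|].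
  by rewrite expr2 ler_wpM2r.
by rewrite IntZ// w1 mulr1.
Qed.

Variables (n : nat) (d : measure_display) (T : measurableType d) (P : probability T R).
Variable X : 'I_n -> {RV P >-> R}.
Hypotheses (n1 : (1 < n)%N) (iidX : iid_density01 X f).

Let i0 : 'I_n := Ordinal (ltnW n1).
Let rho : probability R R := distribution P (X i0).
Let Q := sample_law X.

Let rhoE (A : set R) : measurable A -> rho A = (\int[mu]_(x in A) (w x)%:E)%E.
Proof.
move=> mA; have [_ dens] := iidX; apply: (etrans (dens i0 A mA)).
rewrite integral_mkcondr; apply: eq_integral => x _.
by rewrite patchE /w /ext01 mem_setE in_itv/=; case: ifP.
Qed.

Let resampleQ : resampling rho Q.
Proof.
have [indep dens] := iidX; apply: sample_law_resampling => // i A mA.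
exact: (etrans (dens i A mA) (esym (dens i0 A mA))).
Qed.

Let J (k : nat) := up_log 2 k.
Let theta (k : nat) := hmean rho (proj_kernel phi k).
Let U (k : nat) (x : n.-tuple R) := U_stat phi k (tnth x).

Let bK k : bmeas (fun p : R * R => proj_kernel phi k p.1 p.2).
Proof. by have [mphi _] := tphi; exact: (bmeas_proj_kernel k mphi phi_le phi_supp). Qed.

Lemma ustat_bias k : 0 <= quad_functional f - theta k <=
  detail_const psi S M C beta / (1 - 2 `^ (- (2 * beta))) * (2 ^+ J k) `^ (- (2 * beta)).
Proof.
rewrite /theta (hmean_proj_kernel tphi tw w_ge0 phi_supp w_supp rhoE (bK k)) quadE.
have -> : (2 ^+ J k) `^ (- (2 * beta)) = (2 `^ (- (2 * beta))) ^+ J k :> R.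
  exact: powR_expn.
apply/andP; split.
  by rewrite subr_ge0; exact: (scaling_energy_le S tphi tpsi tw basis).
rewrite lerBlDl.
exact: (scaling_energy_ge tphi tpsi tw phi_supp psi_supp basis psi0 w_supp w_norm
  w_holder C0 M0 beta0 beta1).
Qed.

Let kk (k : nat) : R := 2 ^+ J k.
Let kk0 k : 0 < kk k. Proof. by rewrite exprn_gt0. Qed.
Let b_ge0 : 0 <= b. Proof. by rewrite mulr_ge0// sqr_ge0. Qed.

Let cell k : R -> R := dyadic_cell (J k).
Let mcell k : measurable_fun [set: R] (cell k).
Proof. exact: measurable_dyadic_cell. Qed.

Let shift (r : nat) : R := r%:R - S.*2%:R.

Let K_le k x y : `|proj_kernel phi k x y| <=
  b * kk k * \sum_(r < r0) (cell k y == cell k x + shift r)%R%:R.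
Proof. exact: proj_kernel_le. Qed.

Let rho_cell k c : Ex rho (fun y => (cell k y == c)%R%:R) <= M / kk k.
Proof.
apply: Ex_dyadic_cell => // A mA.
exact: (Ex_density_le rhoE w_ge0 w_leM mw).
Qed.

Let UE k x : U k x = ustat (proj_kernel phi k) x. Proof. by []. Qed.

Lemma bmeas_U k : bmeas (U k).
Proof. exact: (bmeas_ustat n (bK k)). Qed.

Lemma U_le k x : `|U k x| <= b * kk k * r0%:R.
Proof. exact: (ustat_le b_ge0 (kk0 k) (@K_le k)). Qed.

Lemma U_variance k : Ex Q (fun x => (U k x - theta k) ^+ 2) <=
  variance_bound b r0 M n (kk k).
Proof.
exact: (ustat_variance resampleQ b_ge0 (kk0 k) M0 (bK k) (mcell k) (@K_le k)
  (rho_cell k) (proj_kernelC phi k) n1).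
Qed.

Lemma U_tail_upper k m lambda zeta t : 0 <= lambda -> 0 <= zeta -> 0 <= t ->
  lambda * (b * kk k * r0%:R * m%:R + n%:R * (b * r0%:R * M)) *+ 4 <= 1 ->
  Ex Q (fun x => (t < U k x - theta k)%R%:R) <=
  tail_bound b r0 M n (kk k) m lambda zeta t.
Proof.
exact: (ustat_tail resampleQ b_ge0 (kk0 k) M0 (bK k) (mcell k) (@K_le k)
  (rho_cell k) (proj_kernelC phi k) n1).
Qed.

(** The upper tail for the negated kernel, which has the same absolute value. *)
Lemma U_tail_lower k m lambda zeta t : 0 <= lambda -> 0 <= zeta -> 0 <= t ->
  lambda * (b * kk k * r0%:R * m%:R + n%:R * (b * r0%:R * M)) *+ 4 <= 1 ->
  Ex Q (fun x => (t < theta k - U k x)%R%:R) <=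
  tail_bound b r0 M n (kk k) m lambda zeta t.
Proof.
pose h x y := - proj_kernel phi k x y.
have bh : bmeas (fun p : R * R => h p.1 p.2) by exact: (bmeasN (bK k)).
have h_le x y : `|h x y| <= b * kk k *
    \sum_(r < r0) (cell k y == cell k x + shift r)%R%:R.
  by rewrite normrN.
have hC x y : h x y = h y x by rewrite /h proj_kernelC.
move=> l0 z0 t0 l1.
have := ustat_tail resampleQ b_ge0 (kk0 k) M0 bh (mcell k) h_le
  (rho_cell k) hC n1 l0 z0 t0 l1.
apply: le_trans; rewrite le_eqVlt; apply/orP; left; apply/eqP.
congr Rintegral; apply/funext => x; congr (_ < _)%R%:R.
have -> : hmean rho h = - theta k.
  rewrite /hmean /theta /hmean -ExN; last exact: bmeas_marg.
  congr Rintegral; apply/funext => y; rewrite /marg -ExN//.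
  exact: (bmeas_pair1 y (bK k)).
rewrite UE opprK addrC; congr (_ + _); rewrite /ustat -mulrN; congr (_ * _).
rewrite -sumrN; apply: eq_bigr => i1 _.
by rewrite -sumrN.
Qed.

Lemma expectation_risk (est : ('I_n -> R) -> R) (c : R) :
  bmeas (fun x : n.-tuple R => est (tnth x)) ->
  'E_P[(fun w => ((est (fun i => X i w) - c) ^+ 2)%R)]%E =
  (Ex Q (fun x => (est (tnth x) - c) ^+ 2))%:E.
Proof.
move=> be; have bd : bmeas (fun x : n.-tuple R => (est (tnth x) - c) ^+ 2).
  by apply: bmeasX; apply: bmeasB => //; exact: bmeas_cst.
rewrite Ex_sample_law// -EFin_Ex; last first.
  by apply: (bmeas_comp _ bd); exact: measurable_sample.
rewrite unlock; apply: eq_integral => t _ /=; congr ((est _ - c) ^+ 2)%:E.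
by apply/funext => i; rewrite tnth_mktuple.
Qed.

End Model.

(** * Growth of logarithms and rounding of the levels *)

Lemma near_ln_ge (R : realType) (K : R) : \forall n \near \oo, K <= ln (n%:R : R).
Proof.
exists (Num.bound (expR K)) => // n /= Kn.
have eK0 : 0 <= expR K by exact: expR_ge0.
have := archi_boundP eK0 => h.
have Kn' : expR K <= n%:R by rewrite (le_trans (ltW h))// ler_nat.
by rewrite -[leLHS]expRK ler_ln// posrE ?expR_gt0// (lt_le_trans _ Kn')// expR_gt0.
Qed.

(** Since [expR u >= u ^+ 2 / 2], it suffices that [ln n] exceed [2 * c / eps ^+ 2]. *)
Lemma near_ln_le_expR (R : realType) (c eps : R) : 0 < eps ->
  \forall n \near \oo, c * ln (n%:R : R) <= expR (eps * ln n%:R).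
Proof.
move=> eps0; near=> n.
have L1 : 1 <= ln (n%:R : R) by near: n; exact: near_ln_ge.
have Lc : 2 * c / eps ^+ 2 <= ln (n%:R : R) by near: n; exact: near_ln_ge.
have L0 : 0 <= ln (n%:R : R) by exact: le_trans L1.
have := @expR_ge1Dxn R (eps * ln n%:R) 1%N; rewrite mulr_ge0 ?(ltW eps0)// => /(_ isT).
rewrite (_ : 2`! = 2%N)//; apply: le_trans.
move: Lc; rewrite ler_pdivrMr ?exprn_gt0// => Lc.
have := ler_wpM2r L0 Lc; rewrite exprMn.
by lra.
Unshelve. all: by end_near.
Qed.

Lemma up_log2_bounds (R : realType) (k : nat) : (0 < k)%N ->
  k%:R <= (2 ^+ up_log 2 k : R) <= 2 * k%:R.
Proof.
move=> k0; rewrite -natrX -natrM !ler_nat up_logP//=.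
have [k1|k1] := leqP k 1.
  by rewrite (_ : k = 1%N) ?up_log1//; apply/eqP; rewrite eqn_leq k1.
have J0 : (0 < up_log 2 k)%N by rewrite up_log_gt0.
by rewrite -(prednK J0) expnS leq_mul2l/= ltnW// up_log_gtn.
Qed.

(** Two roundings, each costing at most a factor 2: to an integer, as [expR y >= 1], then to a power
    of 2. *)
Lemma dyadic_level (R : realType) (y : R) : 0 <= y ->
  let k := ceil_nat (expR y) in
  [/\ expR y <= k%:R, k%:R <= 2 * expR y, k%:R <= 2 ^+ up_log 2 k :> R &
      2 ^+ up_log 2 k <= 4 * expR y].
Proof.
move=> y0 k.
have x1 : 1 <= expR y by rewrite -[leLHS]expR0 ler_expR.
have c0 : 0 <= Num.ceil (expR y).
  by rewrite -(ler_int R) (le_trans (expR_ge0 y))// ceil_ge.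
have kE : k%:R = (Num.ceil (expR y))%:~R :> R.
  by rewrite /k /ceil_nat -[in RHS](gez0_abs c0).
have k1 : expR y <= k%:R by rewrite kE ceil_ge.
have k2 : k%:R <= 2 * expR y.
  have := ceilB1_lt (expR y); rewrite kE rmorphB/=; lra.
have k0 : (0 < k)%N by rewrite -(ltr_nat R); exact: lt_le_trans (expR_gt0 y) k1.
have /andP[J1 J2] := up_log2_bounds R k0.
by split=> //; lra.
Qed.

Lemma dyadic_level_bias (R : realType) (y beta : R) : 0 <= y -> 0 <= beta ->
  (2 ^+ up_log 2 (ceil_nat (expR y))) `^ (- (2 * beta)) <= expR (- (2 * beta * y)).
Proof.
move=> y0 b0; have [h1 _ h2 _] := dyadic_level y0.
rewrite powRN expRN lef_pV2 ?posrE ?powR_gt0 ?exprn_gt0 ?expR_gt0//.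
rewrite [2 * beta * y]mulrC -[in leLHS](expRK y) -[ln _ * _]mulrC.
have -> : expR (2 * beta * ln (expR y)) = expR y `^ (2 * beta).
  by rewrite /powR gt_eqF ?expR_gt0.
apply: ge0_ler_powR; rewrite ?nnegrE ?mulr_ge0 ?expR_ge0 ?exprn_ge0//.
exact: le_trans h1 h2.
Qed.

(** * Choice of the exponential parameters *)

Section Tail.
Context (R : realType) (b M : R) (r0 n : nat).
Hypotheses (b0 : 0 <= b) (M0 : 0 <= M) (n0 : (0 < n)%N).
Let N : R := n%:R.
Let L := ln N.
Let c1 := pair_const b r0 M.
Let c2 := linear_const b r0 M.

(* Makes the sub-Gaussian part of the tail bound at most [n ^ (- 5)]. *)
Definition lepski_const : R := 12 * (8 * c1 + 2 * c2 + 5).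

Let c1_ge0 : 0 <= c1. Proof. by rewrite !mulr_ge0 ?sqr_ge0. Qed.
Let c2_ge0 : 0 <= c2. Proof. by rewrite !mulr_ge0 ?sqr_ge0. Qed.

Lemma lepski_const_gt0 : 0 < lepski_const.
Proof. by rewrite mulr_gt0// ltr_wpDl// addr_ge0// mulr_ge0. Qed.

Let N0 : 0 < N. Proof. by rewrite ltr0n. Qed.
Let NE : N = expR L. Proof. by rewrite lnK// posrE. Qed.

Variables (kk ks delta : R) (m : nat).
Hypotheses (L1 : 1 <= L) (ks_ge : N <= ks) (kk_le : kk <= 2 * ks) (delta0 : 0 <= delta).
Hypotheses (kk_ge : N * expR (delta * L) <= kk) (m_ge : 6 <= delta * m%:R).
Hypotheses (D_ge : 2 * expR (2 * m%:R) * M <= expR (delta * L)) (N_ge : 10 * L <= N).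

(** With this [lambda] the quadratic and the linear term of the exponent are both of order [L], and
    [lambda * (t * N ^+ 2 / 4)] is [lepski_const / 12 * L]. The choice of [zeta] gives
    [expR zeta = kk / N], so that the mean term in the cell count bound is exactly [M]. *)
Let lambda := Num.sqrt L / (N * Num.sqrt ks).
Let zeta := ln (kk / N).
Let t := lepski_const * Num.sqrt L * (Num.sqrt ks / N) / 3.

Let ks0 : 0 < ks. Proof. exact: lt_le_trans ks_ge. Qed.
Let L0 : 0 < L. Proof. exact: lt_le_trans L1. Qed.
Let kk0 : 0 < kk.
Proof. by apply: lt_le_trans kk_ge; rewrite mulr_gt0// expR_gt0. Qed.

Lemma lambda_ge0 : 0 <= lambda.
Proof. by rewrite divr_ge0 ?sqrtr_ge0// mulr_ge0 ?sqrtr_ge0// ltW. Qed.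

Lemma zeta_ge : delta * L <= zeta.
Proof.
rewrite /zeta -[leLHS]expRK ler_ln ?posrE ?expR_gt0 ?divr_gt0//.
by rewrite ler_pdivlMr// mulrC.
Qed.

Lemma zeta_ge0 : 0 <= zeta.
Proof. by apply: le_trans zeta_ge; rewrite mulr_ge0// ltW. Qed.

Lemma t_ge0 : 0 <= t.
Proof.
have k0 := ltW lepski_const_gt0.
rewrite /t divr_ge0// mulr_ge0 ?divr_ge0 ?sqrtr_ge0 ?(ltW N0)//.
by rewrite mulr_ge0 ?sqrtr_ge0.
Qed.

Lemma tail_bound_small :
  tail_bound b r0 M n kk m lambda zeta t <= (2 + expR M) * expR (- (5 * L)).
Proof.
have sk : Num.sqrt ks != 0 by rewrite gt_eqF// sqrtr_gt0.
have Nn : N != 0 by rewrite gt_eqF.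
have kn : ks != 0 by rewrite gt_eqF.
rewrite mulrDl mulr_natl mulr2n -expRD /tail_bound -/N -/c1 -/c2; apply: lerD; first apply: lerD.
- rewrite ler_expR.
  have -> : lambda * (t * N ^+ 2 / 4) = (8 * c1 + 2 * c2 + 5) * L.
    rewrite /lambda /t /lepski_const -[in RHS](sqr_sqrtr (ltW L0)).
    by field; rewrite sk Nn.
  have -> : lambda ^+ 2 = L / (N ^+ 2 * ks).
    by rewrite /lambda exprMn exprVn exprMn !sqr_sqrtr// ltW.
  have h1 : c1 * kk <= c1 * (2 * ks) by rewrite ler_wpM2l.
  have h2 : c2 * N <= c2 * ks by rewrite ler_wpM2l.
  have -> : N * (L / (N ^+ 2 * ks)) * (c1 * kk * N *+ 4 + c2 * N ^+ 2 *+ 2) =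
      L * ((c1 * kk *+ 4 + c2 * N *+ 2) / ks).
    by rewrite !mulr2n !mulrSr; field; rewrite Nn kn.
  have : (c1 * kk *+ 4 + c2 * N *+ 2) / ks <= 8 * c1 + 2 * c2.
    by rewrite ler_pdivrMr//; lra.
  by move=> /(ler_wpM2l (ltW L0)); lra.
(* The pair term is at most [N / 2], so the exponent is at most [- N / 2], and [N >= 10 * L]. *)
- rewrite ler_expR.
  have : N ^+ 2 * expR (2 * m%:R) * (M / kk) <= N / 2.
    rewrite !mulrA ler_pdivrMr//.
    have h : N / 2 * (N * expR (delta * L)) <= N / 2 * kk.
      by rewrite ler_wpM2l// divr_ge0// ltW.
    apply: le_trans h; have N20 : 0 <= N ^+ 2 / 2 by rewrite divr_ge0// sqr_ge0.
    by have := ler_wpM2l N20 D_ge; lra.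
  by have := N_ge; lra.
(* Here [zeta * m >= 6 * L]: five units give the rate, the sixth pays for the factor [N] of the
   union bound. *)
- rewrite -/zeta (_ : expR zeta = kk / N); last by rewrite lnK// posrE divr_gt0.
  rewrite (_ : N * (kk / N) * (M / kk) = M); last by field; rewrite Nn gt_eqF.
  rewrite {1}NE -expRD ler_expR.
  have h : zeta * m%:R >= delta * L * m%:R by rewrite ler_wpM2r// zeta_ge.
  by have := ler_wpM2r (ltW L0) m_ge; lra.
Qed.

Hypothesis ks_small :
  16 * (2 * b * r0%:R * m%:R + b * r0%:R * M) ^+ 2 * (L * ks) <= N ^+ 2.

(** The largest difference is of order [ks], and [lambda * ks = sqrt (L * ks) / N] is small because
    [L * ks] is well below [N ^+ 2]. *)
Lemma lambda_small :
  lambda * (b * kk * r0%:R * m%:R + N * (b * r0%:R * M)) *+ 4 <= 1.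
Proof.
set E := 2 * b * r0%:R * m%:R + b * r0%:R * M.
have E0 : 0 <= E by rewrite addr_ge0// !mulr_ge0.
apply: (@le_trans _ _ (lambda * (E * ks) *+ 4)).
  rewrite lerMn2r//= ler_wpM2l ?lambda_ge0// /E mulrDl; apply: lerD.
    have p0 : 0 <= b * r0%:R * m%:R by rewrite !mulr_ge0.
    by have := ler_wpM2l p0 kk_le; lra.
  by rewrite mulrC ler_wpM2l// !mulr_ge0.
have -> : lambda * (E * ks) *+ 4 = (4 * E * Num.sqrt (L * ks)) / N.
  have sk : Num.sqrt ks != 0 by rewrite gt_eqF// sqrtr_gt0.
  have Nn : N != 0 by rewrite gt_eqF.
  rewrite (_ : E * ks = E * Num.sqrt ks ^+ 2); last by rewrite sqr_sqrtr// ltW.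
  rewrite sqrtrM ?(ltW L0)// /lambda -[_ *+ 4]mulr_natl.
  by field; rewrite sk Nn.
rewrite ler_pdivrMr// mul1r -ler_sqr ?nnegrE ?mulr_ge0 ?sqrtr_ge0 ?(ltW N0)//.
rewrite exprMn sqr_sqrtr ?mulr_ge0 ?(ltW L0) ?(ltW ks0)//.
by apply: le_trans ks_small; rewrite exprMn -/E; lra.
Qed.

End Tail.

(* The constants [b] and [r0] depend on the parent wavelets only, hence so does
   the threshold given [M]; the Hoelder constants enter through [cB] only. *)
Definition ustat_spec (R : realType) (phi : R -> R) (b M : R) (r0 : nat)
    (cB beta : R) (n : nat) (Phi : R) (Q : probability (n.-tuple R) R)
    (theta : nat -> R) : Prop :=
  let U k (x : n.-tuple R) := U_stat phi k (tnth x) in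
  let kk k : R := 2 ^+ up_log 2 k in
  [/\ 0 <= Phi <= M, forall k, bmeas (U k),
      forall k x, `|U k x| <= b * kk k * r0%:R,
      forall k, 0 <= Phi - theta k <= cB * kk k `^ (- (2 * beta)) &
      (forall k, Ex Q (fun x => (U k x - theta k) ^+ 2) <=
         variance_bound b r0 M n (kk k)) /\
      (forall k m lambda zeta t, 0 <= lambda -> 0 <= zeta -> 0 <= t ->
         lambda * (b * kk k * r0%:R * m%:R + n%:R * (b * r0%:R * M)) *+ 4 <= 1 ->
         Ex Q (fun x => (t < U k x - theta k)%R%:R) <=
           tail_bound b r0 M n (kk k) m lambda zeta t /\
         Ex Q (fun x => (t < theta k - U k x)%R%:R) <=
           tail_bound b r0 M n (kk k) m lambda zeta t)].

Lemma ustat_specP (R : realType) (phi psi : R -> R) : parent_wavelets phi psi ->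
  exists (b : R) (r0 : nat), 0 <= b /\
  forall C Mlow M beta : R, 0 <= C -> 0 <= M -> 0 < beta -> beta <= 1 / 2 ->
  exists cB : R, forall n (f : R -> R) d (T : measurableType d) (P : probability T R)
    (X : 'I_n -> {RV P >-> R}), (1 < n)%N ->
    density_class C Mlow M beta f -> iid_density01 X f ->
    exists (Q : probability (n.-tuple R) R) (theta : nat -> R),
      ustat_spec phi b M r0 cB beta (quad_functional f) Q theta /\
      forall (est : ('I_n -> R) -> R) (c : R),
        bmeas (fun x : n.-tuple R => est (tnth x)) ->
        'E_P[(fun w => ((est (fun i => X i w) - c) ^+ 2)%R)]%E =
        (Ex Q (fun x => (est (tnth x) - c) ^+ 2))%:E.
Proof.
move=> [bphi bpsi basis psi0].
have [B1 [S1 [B10 phi_le1 phi_s1]]] := bounded_compact_supportP bphi.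
have [B2 [S2 [B20 psi_le2 psi_s2]]] := bounded_compact_supportP bpsi.
pose S := maxn S1 S2.
have phi_supp x : S%:R <= `|x| -> phi x = 0.
  by move=> Sx; apply: phi_s1; rewrite (le_trans _ Sx)// ler_nat leq_maxl.
have psi_supp x : S%:R <= `|x| -> psi x = 0.
  by move=> Sx; apply: psi_s2; rewrite (le_trans _ Sx)// ler_nat leq_maxr.
have tphi : tame phi by case: bphi => mphi _ _; split=> //; exists B1, S%:R.
have tpsi : tame psi by case: bpsi => mpsi _ _; split=> //; exists B2, S%:R.
exists (B1 ^+ 2 * S.*2.+1%:R), (S.*2.*2.+1); split; first by rewrite mulr_ge0// sqr_ge0.
move=> C Mlow M beta C0 M0 beta0 beta1.
exists (detail_const psi S M C beta / (1 - 2 `^ (- (2 * beta)))).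
move=> n f d T P X n1 ff iidX.
exists (sample_law X),
  (fun k => hmean (distribution P (X (Ordinal (ltnW n1)))) (proj_kernel phi k)).
split; last by move=> est c be; exact: expectation_risk.
split.
- exact: (quad_functional_ge0_le M0 ff).
- move=> k; exact: (bmeas_U tphi phi_le1 phi_supp).
- move=> k x; exact: (U_le B10 phi_le1 phi_supp).
- move=> k; exact: (ustat_bias tphi tpsi phi_le1 phi_supp psi_supp basis psi0
    C0 M0 beta0 beta1 ff n1 iidX).
split; first by move=> k; exact: (U_variance B10 tphi phi_le1 phi_supp M0 ff n1 iidX).
move=> k m lambda zeta t l0 z0 t0 l1; split.
  exact: (U_tail_upper B10 tphi phi_le1 phi_supp M0 ff n1 iidX).
exact: (U_tail_lower B10 tphi phi_le1 phi_supp M0 ff n1 iidX).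
Qed.

Definition variance_const (R : realType) (b : R) (r0 : nat) (M : R) : R :=
  16 * (4 * pair_const b r0 M + (pair_const b r0 M * M + linear_const b r0 M)).

(** Half the exponent of the risk. Writing [g] for it, the level is [n^(2 (1 - g))], the rate is
    [n^(-2 g)], squared bias and variance balance through [4 beta (1 - g) = g], and [beta < 1 / 4]
    means [g < 1 / 2]. *)
Definition rate_exp (R : realType) (beta : R) : R := 4 * beta / (1 + 4 * beta).

Lemma rate_exp_bounds (R : realType) (beta0 beta1 : R) :
  0 < beta1 -> beta1 < beta0 -> beta0 < 1 / 4 ->
  [/\ 0 < rate_exp beta1, rate_exp beta1 < rate_exp beta0 & rate_exp beta0 < 1 / 2].
Proof.
move=> h1 h h0; have b0 : 0 < beta0 by exact: lt_trans h.
rewrite /rate_exp; split; first by rewrite divr_gt0 ?mulr_gt0// addr_gt0// mulr_gt0.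
- rewrite ltr_pdivrMr ?addr_gt0 ?mulr_gt0//.
  by rewrite mulrAC ltr_pdivlMr ?addr_gt0 ?mulr_gt0//; lra.
- by rewrite ltr_pdivrMr ?addr_gt0 ?mulr_gt0//; lra.
Qed.

(** * Risk bounds over the two classes *)

Section Risk.
Context (R : realType) (phi : R -> R) (b M : R) (r0 n : nat) (cB Phi : R).
Variables (Q : probability (n.-tuple R) R) (theta : nat -> R).
Variables (beta0 beta1 : R).
Hypotheses (b_ge0 : 0 <= b) (M_ge0 : 0 <= M) (n1 : (1 < n)%N).
Hypotheses (beta1_gt0 : 0 < beta1) (beta10 : beta1 < beta0) (beta0_lt : beta0 < 1 / 4).

Let N : R := n%:R.
Let L := ln N.
Hypothesis L1 : 1 <= L.

Let g0 := rate_exp beta0.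
Let g1 := rate_exp beta1.

Let betaE (beta : R) : 0 < beta -> (1 / (1 + 4 * beta) = 1 - rate_exp beta) *
  (2 / (1 + 4 * beta) = 2 * (1 - rate_exp beta)) *
  (8 * beta / (1 + 4 * beta) = 2 * rate_exp beta) *
  (4 * beta * (1 - rate_exp beta) = rate_exp beta).
Proof.
move=> h; have b4 : 1 + 4 * beta != 0 by rewrite gt_eqF// addr_gt0// mulr_gt0.
by rewrite /rate_exp; do !split; field.
Qed.

Let b1E : 4 * beta1 * (1 - g1) = g1. Proof. exact: (betaE beta1_gt0).2. Qed.

Let beta0_gt0 : 0 < beta0. Proof. exact: lt_trans beta10. Qed.

Let b0E : 4 * beta0 * (1 - g0) = g0. Proof. exact: (betaE beta0_gt0).2. Qed.

Let g_bounds : [/\ 0 < g1, g1 < g0 & g0 < 1 / 2].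
Proof. exact: rate_exp_bounds. Qed.

Let g1_gt0 : 0 < g1. Proof. by case: g_bounds. Qed.
Let g10 : g1 < g0. Proof. by case: g_bounds. Qed.
Let g0_lt : g0 < 1 / 2. Proof. by case: g_bounds. Qed.

Let N0 : 0 < N. Proof. by rewrite ltr0n (ltn_trans _ n1). Qed.
Let NE : N = expR L. Proof. by rewrite lnK// posrE. Qed.
Let L0 : 0 < L. Proof. exact: lt_le_trans L1. Qed.

(* Logarithms of the unrounded levels [k_0], [k_1] and [k_*]. *)
Let y0 := 2 * (1 - g0) * L.
Let y1 := 2 * (1 - g1) * L.
Let ys := (1 - g1) * (2 * L - ln L).

Let levelE (beta : R) : 0 < beta ->
  level beta n = ceil_nat (expR (2 * (1 - rate_exp beta) * L)).
Proof.
by move=> h; rewrite /level !(betaE h) /powR -/N gt_eqF.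
Qed.

Let level_starE : level_star beta1 n = ceil_nat (expR ys).
Proof.
rewrite /level_star !(betaE beta1_gt0) /powR -/N -/L gt_eqF ?divr_gt0 ?exprn_gt0//.
rewrite ln_div ?posrE ?exprn_gt0// lnXn//; congr (ceil_nat (expR _)).
by rewrite /ys /g1 -/L mulr2n; ring.
Qed.

Let lnL0 : 0 <= ln L. Proof. exact: ln_ge0. Qed.
Let lnL_lt : ln L < L. Proof. exact: ln_sublinear. Qed.

Let y0_ge0 : 0 <= y0.
Proof.
have h := g0_lt; rewrite /y0 mulr_ge0 ?(ltW L0)// mulr_ge0//; lra.
Qed.

Let y1_ge0 : 0 <= y1.
Proof.
have h := g0_lt; have h' := g10; rewrite /y1 mulr_ge0 ?(ltW L0)// mulr_ge0//; lra.
Qed.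

Let ys_ge0 : 0 <= ys.
Proof.
have h := g0_lt; have h' := g10; have l := lnL_lt; have l0 := L0.
by rewrite /ys mulr_ge0//; lra.
Qed.

Let y01 : y0 <= y1.
Proof. by have h := g10; rewrite /y0 /y1 ler_wpM2r ?(ltW L0)// ler_wpM2l//; lra. Qed.

Let ys1 : ys <= y1.
Proof.
have h := g0_lt; have h' := g10; have l := lnL0.
rewrite /ys /y1 [leRHS](_ : _ = (1 - g1) * (2 * L)); last by ring.
by rewrite ler_wpM2l//; lra.
Qed.

Let U k (x : n.-tuple R) := U_stat phi k (tnth x).
Let kk k : R := 2 ^+ up_log 2 k.
Let k0 := level beta0 n.
Let k1 := level beta1 n.
Let ks := level_star beta1 n.

Let kappa := lepski_const b M r0.
Let tau := kappa * Num.sqrt L * (Num.sqrt ks%:R / N).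

Let tau0 : 0 <= tau.
Proof.
rewrite /tau mulr_ge0 ?divr_ge0 ?sqrtr_ge0 ?(ltW N0)// mulr_ge0 ?sqrtr_ge0//.
exact/ltW/lepski_const_gt0.
Qed.

Let c1 := pair_const b r0 M.
Let c2 := linear_const b r0 M.
Let vc : R := variance_const b r0 M.

Let c1_ge0 : 0 <= c1. Proof. by rewrite !mulr_ge0 ?sqr_ge0. Qed.
Let c2_ge0 : 0 <= c2. Proof. by rewrite !mulr_ge0 ?sqr_ge0. Qed.

(** The first term, of order [K / n^2], has the rate by the choice of level; the second, of order
    [1 / n], is below it because [g <= 1 / 2]. *)
Let variance_le (K y g : R) : K <= 4 * expR y -> y <= 2 * (1 - g) * L -> g <= 1 / 2 ->
  variance_bound b r0 M n K <= vc * expR (- (2 * g * L)).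
Proof.
move=> Ky yg g2; rewrite /variance_bound /vc /variance_const -/c1 -/c2 -/N.
rewrite -[leRHS]mulrA ler_wpM2l// [leRHS]mulrDl.
apply: lerD.
  rewrite ler_pdivrMr ?exprn_gt0//.
  rewrite [leRHS](_ : _ = c1 * (4 * (expR (- (2 * g * L)) * N ^+ 2))); last by ring.
  rewrite ler_wpM2l//.
  apply: (le_trans Ky); rewrite ler_wpM2l// NE -expRM_natl -expRD ler_expR.
  by lra.
rewrite ler_wpM2l//; first by rewrite addr_ge0// mulr_ge0.
rewrite NE -expRN ler_expR lerN2.
have := ler_wpM2r (ltW L0) g2; lra.
Qed.

Let bias_sqr_le (k : nat) (beta y : R) : 0 <= y -> 0 < beta ->
  k = ceil_nat (expR y) ->
  0 <= Phi - theta k <= cB * kk k `^ (- (2 * beta)) ->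
  [/\ 0 <= cB, Phi - theta k <= cB * expR (- (2 * beta * y)) &
      (Phi - theta k) ^+ 2 <= cB ^+ 2 * expR (- (4 * beta * y))].
Proof.
move=> y_ge0 be kE /andP[h0 h1].
have p0 : 0 < kk k `^ (- (2 * beta)) by rewrite powR_gt0// exprn_gt0.
(* The sign of [cB] is deduced from its bounding a nonnegative bias. *)
have c0 : 0 <= cB by rewrite -(pmulr_lge0 _ p0); exact: le_trans h1.
have le1 : Phi - theta k <= cB * expR (- (2 * beta * y)).
  apply: (le_trans h1); rewrite ler_wpM2l// /kk kE.
  by apply: dyadic_level_bias => //; exact: ltW.
split=> //.
rewrite (_ : cB ^+ 2 * _ = (cB * expR (- (2 * beta * y))) ^+ 2); last first.
  by rewrite exprMn -expRM_natl; congr (_ * expR _); ring.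
by rewrite ler_sqr ?nnegrE// mulr_ge0 ?expR_ge0.
Qed.

Let kk0_le : kk k0 <= 4 * expR y0.
Proof. by rewrite /kk /k0 levelE//; have [] := dyadic_level y0_ge0. Qed.
Let kk1_le : kk k1 <= 4 * expR y1.
Proof. by rewrite /kk /k1 levelE//; have [] := dyadic_level y1_ge0. Qed.
Let kks_le : kk ks <= 4 * expR ys.
Proof. by rewrite /kk /ks level_starE//; have [] := dyadic_level ys_ge0. Qed.
Let ks_ge : expR ys <= ks%:R.
Proof. by rewrite /ks level_starE//; have [] := dyadic_level ys_ge0. Qed.
Let ks_le : ks%:R <= 2 * expR ys.
Proof. by rewrite /ks level_starE//; have [] := dyadic_level ys_ge0. Qed.

Let tau_sqrE : tau ^+ 2 = kappa ^+ 2 * (L * ks%:R / N ^+ 2).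
Proof.
rewrite /tau !exprMn exprVn !sqr_sqrtr ?(ltW L0)//.
by rewrite !mulrA.
Qed.

(** The logarithm in the rate is the price of the test: the level of [Us] is chosen so that its
    squared bias and [tau ^+ 2] are both of order [L^g1 N^(-2 g1)]. All three variances are within
    [N^(-2 g1)], since no level exceeds the order of [k1]. *)
Lemma risk_rough : ustat_spec phi b M r0 cB beta1 Phi Q theta ->
  Ex Q (fun x => (phi_hat phi kappa beta0 beta1 (tnth x) - Phi) ^+ 2) <=
  (20 * vc + 10 * cB ^+ 2 + 16 * kappa ^+ 2) * expR (g1 * ln L - 2 * g1 * L).
Proof.
move=> [Phi0 bU U_le bias [var tail]].
set rate := expR (g1 * _ - _).
have rate_ge : expR (- (2 * g1 * L)) <= rate.
  by rewrite ler_expR -[leLHS]add0r lerD2r mulr_ge0// ltW.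
have g1_le : g1 <= 1 / 2 by have := g10; have := g0_lt; lra.
have vc0 : 0 <= vc by rewrite mulr_ge0// !addr_ge0// ?mulr_ge0.
have vrate : vc * expR (- (2 * g1 * L)) <= vc * rate by rewrite ler_wpM2l.
have V0 := le_trans (variance_le kk0_le y01 g1_le) vrate.
have V1 := le_trans (variance_le kk1_le (lexx _) g1_le) vrate.
have Vs := le_trans (variance_le kks_le ys1 g1_le) vrate.
have b0_ge : theta k0 <= Phi by have /andP[+ _] := bias k0; rewrite subr_ge0.
have := lepski_risk_rough tau (bU k0) (bU k1) (bU ks) (le_trans (var k0) V0)
  (le_trans (var k1) V1) (le_trans (var ks) Vs) b0_ge.
move=> /le_trans; apply.
have [_ _ B1] := bias_sqr_le y1_ge0 beta1_gt0 (levelE beta1_gt0) (bias k1).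
have [_ _ Bs] := bias_sqr_le ys_ge0 beta1_gt0 level_starE (bias ks).
have {}B1 : (Phi - theta k1) ^+ 2 <= cB ^+ 2 * rate.
  apply: (le_trans B1); rewrite ler_wpM2l ?sqr_ge0//; apply: le_trans rate_ge.
  rewrite ler_expR lerN2 /y1.
  by have /= := congr1 (fun z => z * L) b1E; lra.
have {}Bs : (Phi - theta ks) ^+ 2 <= cB ^+ 2 * rate.
  apply: (le_trans Bs); rewrite ler_wpM2l ?sqr_ge0// /rate ler_expR.
  rewrite /ys mulrA b1E.
  by rewrite le_eqVlt; apply/orP; left; apply/eqP; ring.
have T2 : tau ^+ 2 <= 2 * kappa ^+ 2 * rate.
  rewrite tau_sqrE [leRHS](_ : _ = kappa ^+ 2 * (2 * rate)); last by ring.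
  rewrite ler_wpM2l ?sqr_ge0// ler_pdivrMr ?exprn_gt0//.
  apply: (@le_trans _ _ (L * (2 * expR ys))); first by rewrite ler_wpM2l// ltW.
  have -> : L = expR (ln L) by rewrite lnK// posrE.
  rewrite mulrCA -mulrA ler_wpM2l//.
  rewrite NE -expRM_natl /rate -!expRD ler_expR.
  by rewrite le_eqVlt; apply/orP; left; apply/eqP; rewrite /ys; ring.
by move: rate vrate rate_ge {V0 V1 Vs} B1 Bs T2 => rate _ _; lra.
Qed.

Variables (m : nat).
Let delta := 1 - 2 * g0.
Hypothesis m_ge : 6 <= delta * m%:R.
Hypothesis D_ge : 2 * expR (2 * m%:R) * M <= expR (delta * L).
Hypothesis N_ge : 10 * L <= expR (1 * L).
Hypothesis gap : y0 <= ys.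
Hypothesis E_le :
  32 * (2 * b * r0%:R * m%:R + b * r0%:R * M) ^+ 2 * L <= expR (2 * g1 * L).
Hypothesis cB_le : 3 * cB <= kappa * expR ((g0 - g1) * L).

(** When the test keeps [U0], bias and variance at level [k0] give the rate. When it rejects, the
    fine statistic is bounded crudely, the event having probability of order [N^(-5)]. *)
Lemma risk_smooth : ustat_spec phi b M r0 cB beta0 Phi Q theta ->
  Ex Q (fun x => (phi_hat phi kappa beta0 beta1 (tnth x) - Phi) ^+ 2) <=
  (2 * vc + 2 * cB ^+ 2 + (4 * b * r0%:R + M) ^+ 2 * (2 * (2 + expR M))) *
  expR (- (2 * g0 * L)).
Proof.
move=> [/andP[Phi0 PhiM] bU U_le bias [var tail]].
set rate := expR (- _).
have g0_le : g0 <= 1 / 2 by exact: ltW.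
have V0 : variance_bound b r0 M n (kk k0) <= vc * rate.
  exact: (variance_le kk0_le (lexx _) g0_le).
have delta_ge0 : 0 <= delta by rewrite /delta; have := g0_lt; lra.
have bs_ge : theta ks <= Phi by have /andP[+ _] := bias ks; rewrite subr_ge0.
have [cB0 B0 B0s] := bias_sqr_le y0_ge0 beta0_gt0 (levelE beta0_gt0) (bias k0).
have kappa0 : 0 <= kappa by exact/ltW/lepski_const_gt0.
have yE : 2 * beta0 * y0 = g0 * L.
  by rewrite /y0 -[in RHS]b0E; ring.
have {}B0s : (Phi - theta k0) ^+ 2 <= cB ^+ 2 * rate.
  apply: (le_trans B0s); rewrite ler_wpM2l ?sqr_ge0// ler_expR lerN2.
  by rewrite le_eqVlt; apply/orP; left; apply/eqP; lra.
have Nys : N <= expR ys.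
  rewrite NE ler_expR (le_trans _ gap)// /y0 ler_peMl ?(ltW L0)//.
  by have := g0_lt; lra.
have ks_pos : 0 < ks%:R :> R by apply: lt_le_trans ks_ge; exact: expR_gt0.
have kks_gap : forall k, k0 = k \/ ks = k ->
    N * expR (delta * L) <= kk k /\ kk k <= 2 * ks%:R.
  (* An equality: [delta] is defined so that [2 * (1 - g0) = 1 + delta]. *)
  have h0 : N * expR (delta * L) <= expR y0.
    rewrite NE -expRD ler_expR /y0 /delta.
    by rewrite le_eqVlt; apply/orP; left; apply/eqP; ring.
  have dl : N * expR (delta * L) <= k0%:R /\ (k0 <= ks)%N.
    rewrite /k0 levelE//; have [h1 _ _ _] := dyadic_level y0_ge0.
    split; first exact: le_trans h0 h1.
    rewrite /ks level_starE /ceil_nat.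
    have cc y : 0 <= Num.ceil (expR y : R).
      by rewrite -(ler_int R) (le_trans (expR_ge0 y))// ceil_ge.
    rewrite -lez_nat !gez0_abs//; apply: le_ceil.
    by rewrite ler_expR.
  have [dl1 dl2] := dl.
  have k0p : (0 < k0)%N.
    rewrite -(ltr_nat R); apply: lt_le_trans dl1.
    by rewrite mulr_gt0// expR_gt0.
  have k0s : k0%:R <= ks%:R :> R by rewrite ler_nat.
  have lt4 : N * expR (delta * L) <= k0%:R -> k0%:R <= kk k0 -> kk k0 <= 2 * k0%:R ->
      k0%:R <= ks%:R :> R -> ks%:R <= kk ks -> kk ks <= 2 * ks%:R ->
      (N * expR (delta * L) <= kk k0 /\ kk k0 <= 2 * ks%:R) /\
      (N * expR (delta * L) <= kk ks /\ kk ks <= 2 * ks%:R).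
    by move: (kk k0) (kk ks) (k0%:R : R) (ks%:R : R) (N * _) => *; split; split; lra.
  have /andP[a1 a2] := up_log2_bounds R k0p.
  have /andP[a3 a4] := up_log2_bounds R (leq_trans k0p dl2).
  by have [h1 h2] := lt4 dl1 a1 a2 k0s a3 a4; move=> k [<-|<-].
have tailk k : k0 = k \/ ks = k ->
    Ex Q (fun x => (tau / 3 < U k x - theta k)%R%:R) <= (2 + expR M) * expR (- (5 * L)) /\
    Ex Q (fun x => (tau / 3 < theta k - U k x)%R%:R) <= (2 + expR M) * expR (- (5 * L)).
  move=> /kks_gap[kk_ge kk_le].
  have nn : (0 < n)%N by exact: ltn_trans n1.
  have NeL : 10 * L <= N by rewrite NE -[in leRHS](mul1r L).
  have ks_N : N <= ks%:R by exact: le_trans Nys ks_ge.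
  have small : 16 * (2 * b * r0%:R * m%:R + b * r0%:R * M) ^+ 2 * (L * ks%:R) <= N ^+ 2.
    set E2 := (_ + _) ^+ 2.
    have E20 : 0 <= 16 * E2 * L by rewrite mulr_ge0 ?(ltW L0)// mulr_ge0// sqr_ge0.
    apply: (@le_trans _ _ (16 * E2 * L * (2 * expR y1))).
      rewrite mulrA ler_wpM2l// (le_trans ks_le)// ler_wpM2l//.
      by rewrite ler_expR.
    have -> : N ^+ 2 = expR (2 * g1 * L) * expR y1.
      by rewrite NE -expRM_natl -expRD; congr expR; rewrite /y1; ring.
    have := ler_wpM2r (expR_ge0 y1) E_le; rewrite -/E2.
    by lra.
  have sm := lambda_small b_ge0 M_ge0 nn L1 ks_N kk_le small.
  have sb := tail_bound_small r0 b_ge0 M_ge0 nn L1 ks_N kk_le kk_ge m_ge D_ge NeL.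
  have [t1 t2] := tail k m _ _ _ (lambda_ge0 n ks%:R)
    (zeta_ge0 nn L1 delta_ge0 kk_ge) (t_ge0 r0 b_ge0 M_ge0 nn ks%:R) sm.
  by split; [exact: le_trans t1 sb|exact: le_trans t2 sb].
have [ts _] := tailk ks (or_intror erefl).
have [_ t0] := tailk k0 (or_introl erefl).
(* The bias is at most [cB N^(-g0)], while [tau] is at least [kappa N^(-g1)]; the power
   [N^(g0 - g1)] between them absorbs [cB]. *)
have b3 : 3 * (Phi - theta k0) <= tau.
  apply: (@le_trans _ _ (3 * (cB * expR (- (g0 * L))))).
    by rewrite ler_wpM2l// -yE.
  apply: (@le_trans _ _ (kappa * expR (- (g1 * L)))).
    have -> : expR (- (g1 * L)) = expR ((g0 - g1) * L) * expR (- (g0 * L)).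
      by rewrite -expRD; congr expR; ring.
    by have := ler_wpM2r (expR_ge0 (- (g0 * L))) cB_le; lra.
  have p0 : 0 <= kappa * expR (- (g1 * L)) by rewrite mulr_ge0// expR_ge0.
  have sq : (kappa * expR (- (g1 * L))) ^+ 2 <= tau ^+ 2.
    rewrite tau_sqrE exprMn ler_wpM2l ?sqr_ge0//.
    rewrite ler_pdivlMr ?exprn_gt0//.
    apply: (@le_trans _ _ (L * expR ys)); last by rewrite ler_wpM2l// ltW.
    have -> : L * expR ys = expR (ln L) * expR ys by rewrite lnK// posrE.
    rewrite NE -!expRM_natl -!expRD ler_expR /ys.
    have : 0 <= g1 * ln L by rewrite mulr_ge0// ltW.
    by lra.
  rewrite -(ger0_norm p0) -(ger0_norm tau0) -!sqrtr_sqr.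
  exact: ler_wsqrtr.
(* The height of the kernel at level [k1] is at most of order [N ^+ 2]. Squared, [N ^ 4] against the
   probability [N ^ (- 5)] leaves [1 / N], which is below the rate as [g0 < 1 / 2]. *)
pose G := (4 * b * r0%:R + M) * N ^+ 2.
have UG x : `|U k1 x - Phi| <= G.
  apply: (le_trans (ler_normB _ _)); rewrite /G mulrDl.
  have N1 : 1 <= N ^+ 2 by rewrite exprn_ege1// ler1n ltnW.
  apply: lerD; last by rewrite ger0_norm// (le_trans PhiM)// ler_peMr.
  apply: (le_trans (U_le _ _)).
  have kN : kk k1 <= 4 * N ^+ 2.
    apply: (le_trans kk1_le); rewrite ler_wpM2l// NE -expRM_natl ler_expR /y1.
    have : 0 <= g1 * L by rewrite mulr_ge0// ltW.
    by lra.
  have br0 : 0 <= b * r0%:R by rewrite mulr_ge0.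
  rewrite -/(kk k1) (mulrAC b) -(mulrA 4 b) (mulrC 4) -[leRHS]mulrA.
  exact: ler_wpM2l br0 _ _ kN.
have := lepski_risk_smooth (U1 := U k1) (bU k0) (bU k1) (bU ks) (le_trans (var k0) V0) bs_ge b3 UG.
move=> /le_trans; apply.
have G2 : G ^+ 2 * ((2 + expR M) * expR (- (5 * L)) + (2 + expR M) * expR (- (5 * L))) <=
    (4 * b * r0%:R + M) ^+ 2 * (2 * (2 + expR M)) * rate.
  have -> : G ^+ 2 = (4 * b * r0%:R + M) ^+ 2 * expR (4 * L).
    by rewrite /G exprMn -exprM NE -expRM_natl.
  move: (expR_ge0 M) (sqr_ge0 (4 * b * r0%:R + M)).
  move: (expR M) (_ ^+ 2) => eM A eM0 A0.
  have -> : A * expR (4 * L) *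
        ((2 + eM) * expR (- (5 * L)) + (2 + eM) * expR (- (5 * L))) =
      A * (2 * (2 + eM)) * (expR (4 * L) * expR (- (5 * L))) by ring.
  apply: ler_wpM2l; first by rewrite mulr_ge0// mulr_ge0// addr_ge0.
  rewrite -expRD ler_expR.
  by have := ler_wpM2r (ltW L0) g0_le; lra.
have G0 : 0 <= G ^+ 2 by exact: sqr_ge0.
have := ler_wpM2l G0 (lerD ts t0).
by lra.
Qed.

End Risk.

(** * From bounds for large [n] to the theorem *)

Lemma lesssim_sup_risk (R : realType) (F : set (R -> R))
    (est : forall n, ('I_n -> R) -> R) (rate : nat -> R) (c : R) :
  (forall n, 0 <= rate n) ->
  (\forall n \near \oo, forall (f : R -> R) d (T : measurableType d)
     (P : probability T R) (X : 'I_n -> {RV P >-> R}), F f -> iid_density01 X f ->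
     ('E_P[(fun w => ((est n (fun i => X i w) - quad_functional f) ^+ 2)%R)]
        <= (c * rate n)%:E)%E) ->
  lesssim (fun n => sup_risk F (@est n)) rate.
Proof.
(* [lesssim] asks for a positive constant, while the sign of [c] is unknown. *)
move=> rate0 risk; exists (Num.max 1 c); first by rewrite lt_max ltr01.
near=> n; apply: ge_ereal_sup => _ [f [Ff [d [T [P [X [iidX ->]]]]]]].
have /le_trans -> // : ('E_P[(fun w => ((est n (fun i => X i w) - quad_functional f) ^+ 2)%R)]
    <= (c * rate n)%:E)%E.
  by move: (f) d T P X Ff iidX; near: n.
by rewrite lee_fin ler_wpM2r// le_max lexx orbT.
Unshelve. all: by end_near.
Qed.

Lemma powR_rate (R : realType) (n : nat) (beta : R) : (0 < n)%N ->
  n%:R `^ (- (8 * beta / (1 + 4 * beta))) = expR (- (2 * rate_exp beta * ln n%:R)).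
Proof.
move=> n0; rewrite /powR pnatr_eq0 gtn_eqF//; congr expR.
by rewrite /rate_exp mulNr; congr (- (_ * _)); rewrite mulrA; congr (_ / _); ring.
Qed.

(** Compares the logarithms of [k_0] and [k_*]: dividing by a power of [log n] costs less than the
    polynomial gap left by [g1 < g0]. *)
Lemma near_exponent_gap (R : realType) (g0 g1 : R) : g1 < g0 -> g0 < 1 ->
  \forall n \near \oo, 2 * (1 - g0) * ln (n%:R : R) <=
    (1 - g1) * (2 * ln n%:R - ln (ln n%:R)).
Proof.
move=> g10 g0_lt; have g1_gt : 0 < 1 - g1 by lra.
have eps0 : 0 < 2 * (g0 - g1) / (1 - g1) by rewrite divr_gt0//; lra.
near=> n.
have L1 : 1 <= ln (n%:R : R) by near: n; exact: near_ln_ge.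
have L0 : 0 < ln (n%:R : R) by exact: lt_le_trans L1.
have : 1 * ln (n%:R : R) <= expR (2 * (g0 - g1) / (1 - g1) * ln n%:R).
  by near: n; exact: near_ln_le_expR.
rewrite mul1r -[leLHS](lnK L0) ler_expR.
move=> /(ler_wpM2l (ltW g1_gt)); rewrite mulrA [_ * (_ / _)]mulrC divfK ?gt_eqF//.
by lra.
Unshelve. all: by end_near.
Qed.

Lemma near_le_expR (R : realType) (c eps : R) : 0 < eps ->
  \forall n \near \oo, c <= expR (eps * ln (n%:R : R)).
Proof.
move=> eps0; near=> n; have [c0|c0] := leP c 0; first exact: le_trans (expR_ge0 _).
apply: (@le_trans _ _ (c * ln n%:R)); last by near: n; exact: near_ln_le_expR.
by rewrite ler_peMr ?(ltW c0)//; near: n; exact: near_ln_ge.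
Unshelve. all: by end_near.
Qed.

Theorem theorem3p1 (R : realType) (phi psi : R -> R) (Mup : R)
    (hwav : parent_wavelets phi psi) (hMup : 0 < Mup) :
  exists kappa : R, 0 < kappa /\
    forall C Mlow beta0 beta1 : R,
      0 < C -> 0 < Mlow -> Mlow < Mup ->
      0 < beta1 -> beta1 < beta0 -> beta0 < 1 / 4 ->
      lesssim
        (fun n => sup_risk (density_class C Mlow Mup beta0)
                    (@phi_hat R phi kappa beta0 beta1 n))
        (fun n => n%:R `^ (- (8 * beta0 / (1 + 4 * beta0))))
      /\
      lesssim
        (fun n => sup_risk (density_class C Mlow Mup beta1)
                    (@phi_hat R phi kappa beta0 beta1 n))
        (fun n => ln n%:R `^ (4 * beta1 / (1 + 4 * beta1)) *
                  n%:R `^ (- (8 * beta1 / (1 + 4 * beta1)))).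
Proof.
have [b [r0 [b0 spec]]] := ustat_specP hwav.
(* [b] and [r0] are known before the Hölder radius and the smoothness, so [kappa] depends only on
   the wavelets and [Mup]. *)
have M0 := ltW hMup; pose kappa := lepski_const b Mup r0.
have kappa0 : 0 < kappa by exact: lepski_const_gt0.
exists kappa; split=> // C Mlow beta0 beta1 C0 _ _ b1 b10 b0_lt.
have beta0_gt0 : 0 < beta0 by exact: lt_trans b10.
have [|cB0 spec0] := spec C Mlow Mup beta0 (ltW C0) M0 beta0_gt0; first by lra.
have [|cB1 spec1] := spec C Mlow Mup beta1 (ltW C0) M0 b1; first by lra.
have [g1_gt0 g10 g0_lt] := rate_exp_bounds b1 b10 b0_lt.
have bmeas_hat n (Q : probability (n.-tuple R) R) cB beta Phi theta :
    ustat_spec phi b Mup r0 cB beta Phi Q theta ->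
    bmeas (fun x : n.-tuple R => phi_hat phi kappa beta0 beta1 (tnth x)).
  by move=> [_ bU _ _ _]; exact: (bmeas_lepski _ (bU _) (bU _) (bU _)).
split.
- pose g0 := rate_exp beta0; pose g1 := rate_exp beta1.
  pose delta := 1 - 2 * g0; have delta0 : 0 < delta by rewrite /delta /g0; lra.
  (* The cap on cell counts does not grow with [n]: a cell exceeds it with probability of order
     [n^(- delta m)], hence at most of order [n^(-6)]. *)
  pose m := Num.bound (6 / delta).
  have m_ge : 6 <= delta * m%:R.
    by rewrite mulrC -ler_pdivrMr// ltW// archi_boundP// divr_ge0// ltW.
  pose E := 2 * b * r0%:R * m%:R + b * r0%:R * Mup.
  apply: (@lesssim_sup_risk _ _ _ _ (2 * variance_const b r0 Mup + 2 * cB0 ^+ 2 +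
      (4 * b * r0%:R + Mup) ^+ 2 * (2 * (2 + expR Mup)))) => [n|].
    exact: powR_ge0.
  near=> n => f d T P X ff iidX.
  have L1 : 1 <= ln (n%:R : R) by near: n; exact: near_ln_ge.
  have n1 : (1 < n)%N by near: n; exact: nbhs_infty_gt.
  have [Q [theta [sp tr]]] := spec0 n f d T P X n1 ff iidX.
  rewrite tr ?lee_fin; last exact: bmeas_hat sp.
  rewrite powR_rate ?(ltnW n1)//.
  have D_ge : 2 * expR (2 * m%:R) * Mup <= expR (delta * ln n%:R).
    by near: n; exact: near_le_expR.
  have N_ge : 10 * ln n%:R <= expR (1 * ln n%:R) :> R.
    by near: n; exact: near_ln_le_expR.
  have gap : 2 * (1 - g0) * ln n%:R <= (1 - g1) * (2 * ln n%:R - ln (ln n%:R)).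
    by near: n; apply: near_exponent_gap => //; rewrite /g0; lra.
  have E_le : 32 * E ^+ 2 * ln n%:R <= expR (2 * g1 * ln n%:R).
    by near: n; apply: near_ln_le_expR; rewrite mulr_gt0.
  have cB_le : 3 * cB0 <= kappa * expR ((g0 - g1) * ln n%:R).
    rewrite [leRHS]mulrC -ler_pdivrMr//; near: n; apply: near_le_expR.
    by rewrite subr_gt0.
  exact: (risk_smooth b0 M0 n1 b1 b10 b0_lt L1 m_ge D_ge N_ge gap E_le cB_le sp).
- apply: (@lesssim_sup_risk _ _ _ _ (20 * variance_const b r0 Mup + 10 * cB1 ^+ 2 +
      16 * kappa ^+ 2)) => [n|].
    by rewrite mulr_ge0 ?powR_ge0.
  near=> n => f d T P X ff iidX.
  have L1 : 1 <= ln (n%:R : R) by near: n; exact: near_ln_ge.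
  have n1 : (1 < n)%N by near: n; exact: nbhs_infty_gt.
  have [Q [theta [sp tr]]] := spec1 n f d T P X n1 ff iidX.
  rewrite tr ?lee_fin; last exact: bmeas_hat sp.
  rewrite powR_rate ?(ltnW n1)// {1}/powR gt_eqF ?(lt_le_trans _ L1)// -expRD.
  exact: (risk_rough b0 M0 n1 b1 b10 b0_lt L1 sp).
Unshelve. all: by end_near.
Qed.
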